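(* Let $K$ be a field of characteristic zero. Every quartic monoid surface of $\mathbb{P}^3_K$ which has no singular points other than its triple point and which contains the maximum number of lines (namely $31$) is projectively equivalent to a surface of equation $Q(a)=0$ for some $a\in K\setminus\{-1,0,1/2,1,2\}$, where $$\begin{aligned} Q(a) ={}& 2ax^3y+ 4ax^2y^2+ 2axy^3 -(2a - 1)(a - 2)x^3z -(5a^2 - 17a + 5)x^2yz\\ & -3(a^2 - 4a + 1)xy^2z + ay^3z -3(2a - 1)(a - 2)x^2z^2 -(7a^2 - 19a + 7)xyz^2\\ & + 2ay^2z^2 -2(2a - 1)(a - 2)xz^3 +ayz^3 -2atx^2y-2atxy^2+ 2(2a - 1)(a - 2)tx^2z\\ & + 4(a^2 - 3a + 1)txyz -2aty^2z+ 2(2a - 1)(a - 2)txz^2 -2atyz^2 . \end{aligned}$$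
   Context: A quartic monoid surface of $\mathbb{P}^3_K$ is a quartic surface in $\mathbb{P}^3_K$ with a triple point; when the triple point is placed at the origin $O=(0,0,0,1)$ its equation, in homogeneous coordinates $(x,y,z,t)$, has the form $tF_3(x,y,z)+F_4(x,y,z)=0$ with $F_3,F_4\in K[x,y,z]$ forms of degree $3$ and $4$. The maximum number of lines contained in a quartic monoid surface is $31$ (a theorem of Rohn), made up of $12$ lines through the triple point and $19$ lines not through it. Two surfaces in $\mathbb{P}^3_K$ are projectively equivalent if some element of $\mathrm{PGL}(4,K)$ maps one to the other. *)

(* Defs.v *)
From HB Require Import structures.
From mathcomp Require Import all_boot all_order all_algebra.
From mathcomp Require Import mpoly.

Set Implicit Arguments.
Unset Strict Implicit.
Unset Printing Implicit Defensive.

Import GRing.Theory.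
Local Open Scope ring_scope.

(* A surface of P^3_K is given by its homogeneous equation F, in the
   coordinates (x, y, z, t) = ('X_0, 'X_1, 'X_2, 'X_3), considered up to a
   nonzero scalar; a K-point of P^3 is a nonzero row vector, up to scalars. *)

Definition quartic_surface (K : fieldType) (F : {mpoly K[4]}) : Prop :=
  F != 0 /\ F \is 4.-homog.

Definition eval_at (K : fieldType) (F : {mpoly K[4]}) (P : 'rV[K]_4) : K :=
  F.@[fun i => P 0 i].

(* In characteristic zero, the multiplicity of a surface at a point is the
   least order of a partial derivative of its equation not vanishing there. *)
Definition multiplicity_at (K : fieldType) (F : {mpoly K[4]}) (P : 'rV[K]_4)
    (k : nat) : Prop :=
  (forall m : 'X_{1..4}, (mdeg m < k)%N -> eval_at (F^`M[m]) P = 0) /\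
  (exists m : 'X_{1..4}, mdeg m = k /\ eval_at (F^`M[m]) P != 0).

Definition triple_point (K : fieldType) (F : {mpoly K[4]}) (P : 'rV[K]_4) :
    Prop :=
  P != 0 /\ multiplicity_at F P 3.

Definition singular_point (K : fieldType) (F : {mpoly K[4]}) (P : 'rV[K]_4) :
    Prop :=
  [/\ P != 0, eval_at F P = 0 & forall i : 'I_4, eval_at (F^`M(i)) P = 0].

(* Singular points are taken in the geometric sense: K need not be
   algebraically closed, so points over all extension fields are considered. *)
Definition no_singular_point_but (K : fieldType) (F : {mpoly K[4]})
    (O : 'rV[K]_4) : Prop :=
  forall (L : fieldType) (f : {rmorphism K -> L}) (P : 'rV[L]_4),
    singular_point (map_mpoly f F) P -> exists c : L, P = c *: map_mx f O.

Definition quartic_monoid (K : fieldType) (F : {mpoly K[4]}) (O : 'rV[K]_4) :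
    Prop :=
  quartic_surface F /\ triple_point F O.

(* The lines of P^3_K are the vector planes of K^4. For K infinite, F vanishes
   identically on a line as soon as it vanishes at all its K-points. *)
Definition line_in (K : fieldType) (F : {mpoly K[4]})
    (l : {vspace 'rV[K]_4}) : Prop :=
  \dim l = 2%N /\ (forall P : 'rV[K]_4, P \in l -> eval_at F P = 0).

Definition number_of_lines (K : fieldType) (F : {mpoly K[4]}) (n : nat) :
    Prop :=
  exists s : seq {vspace 'rV[K]_4},
    [/\ uniq s, size s = n & forall l, l \in s <-> line_in F l].

(* F (P *m A), as a polynomial in the coordinates of the row vector P. *)
Definition linear_subst (K : fieldType) (A : 'M[K]_4) (F : {mpoly K[4]}) :
    {mpoly K[4]} :=
  F \mPo [tuple \sum_(i < 4) A i j *: 'X_i | j < 4].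

Definition projectively_equivalent (K : fieldType) (F G : {mpoly K[4]}) :
    Prop :=
  exists (A : 'M[K]_4) (c : K),
    [/\ A \in unitmx, c != 0 & linear_subst A F = c *: G].

Definition Q (K : fieldType) (a : K) : {mpoly K[4]} :=
  let x : {mpoly K[4]} := 'X_(inord 0) in
  let y : {mpoly K[4]} := 'X_(inord 1) in
  let z : {mpoly K[4]} := 'X_(inord 2) in
  let t : {mpoly K[4]} := 'X_(inord 3) in
  (2 * a) *: (x ^+ 3 * y) + (4 * a) *: (x ^+ 2 * y ^+ 2)
  + (2 * a) *: (x * y ^+ 3)
  - ((2 * a - 1) * (a - 2)) *: (x ^+ 3 * z)
  - (5 * a ^+ 2 - 17 * a + 5) *: (x ^+ 2 * y * z)
  - (3 * (a ^+ 2 - 4 * a + 1)) *: (x * y ^+ 2 * z)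
  + a *: (y ^+ 3 * z)
  - (3 * (2 * a - 1) * (a - 2)) *: (x ^+ 2 * z ^+ 2)
  - (7 * a ^+ 2 - 19 * a + 7) *: (x * y * z ^+ 2)
  + (2 * a) *: (y ^+ 2 * z ^+ 2)
  - (2 * (2 * a - 1) * (a - 2)) *: (x * z ^+ 3)
  + a *: (y * z ^+ 3)
  - (2 * a) *: (t * x ^+ 2 * y) - (2 * a) *: (t * x * y ^+ 2)
  + (2 * (2 * a - 1) * (a - 2)) *: (t * x ^+ 2 * z)
  + (4 * (a ^+ 2 - 3 * a + 1)) *: (t * x * y * z)
  - (2 * a) *: (t * y ^+ 2 * z)
  + (2 * (2 * a - 1) * (a - 2)) *: (t * x * z ^+ 2)
  - (2 * a) *: (t * y * z ^+ 2).

(* Main.v *)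
(* Place the triple point at (0, 0, 0, 1), so that the equation reads t F3 + F4.  The
   lines through the triple point are the common zeros of F3 and F4 in P^2 (the base
   points); the other lines project isomorphically to the lines l of P^2 on which F4
   is a multiple of F3 (the lifting lines).  A singular surface point over a base
   point p is a value of t for which t F3 + F4 has order 2 at p, so smoothness is only
   needed at K-points, and the whole argument takes place over K.

   Restricting to the lines through a base point and taking the remainder and norm of
   F4 modulo F3 bounds the number of lifting lines through a base point by 5.  Three
   lifting lines l1, l2, l3 that pairwise meet off the cubic F3 = 0 give
   F4 = a F3 + l1 l2 l3 n, and counting on these four lines shows that 31 lines are
   12 base points and 19 lifting lines with three base points each, n being a lifting
   line and the four lines partitioning the base points.  When two such lines are
   joined by three lifting lines, F3 is a combination of the two triangles of the
   resulting 3 x 2 grid, so the third points of the three rows are collinear on a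
   lifting line.  A finite search shows that this closure rule leaves only one
   incidence table.

   Taking three of the base points as a frame, the incidences leave one free
   parameter a, the restriction of a grid determines F3, and four lifting lines
   determine F4 modulo F3; the multiple of F3 is absorbed by a change of t. *)
Require Import Defs.
From HB Require Import structures.
From mathcomp Require Import all_boot all_order all_algebra.
From mathcomp Require Import ring zify.
From mathcomp Require Import mpoly.
From Stdlib Require Import Classical.
Set Implicit Arguments.
Unset Strict Implicit.
Unset Printing Implicit Defensive.
Import GRing.Theory.
Local Open Scope ring_scope.

(** * Ternary forms *)

Section Forms.
Variable K : fieldType.

(** [K] need not be algebraically closed, and this shapes the counting: a lifting line may carry
    fewer than three base points simply because F3 does not split on it. The remedy is the identity
    F4 = a F3 + l1 l2 l3 n. On any other lifting line, where F4 = b F3, it reads (b - a) F3 = l1 l2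
    l3 n, so F3 splits there into linear forms over [K]. With fewer than three base points such a
    line then carries a double root of F3, at a base point where F3 itself has order 2. Only one
    lifting line passes through such a point, so the deficient lines are charged injectively to the
    four lines and the counts still close. The three pairwise disjoint lines exist for combinatorial
    reasons: seven pairwise meeting lines would form a Fano plane, impossible since 2 is invertible,
    and 57 is not divisible by 5. Plane forms are functions on triples, which loses nothing over an
    infinite field. Points and lines are both triples, paired by [dot], joined or intersected by
    [cross], and proportional when [cross] is [null]. *)

Definition pt := (K * K * K)%type.
Implicit Types (p q r l P Q : pt) (G H : pt -> K).

Definition cmb p q r (x y z : K) : pt :=
  (x * p.1.1 + y * q.1.1 + z * r.1.1, x * p.1.2 + y * q.1.2 + z * r.1.2,
   x * p.2 + y * q.2 + z * r.2).
Definition dot p q : K := p.1.1 * q.1.1 + p.1.2 * q.1.2 + p.2 * q.2.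
Definition cross p q : pt :=
  (p.1.2 * q.2 - p.2 * q.1.2, p.2 * q.1.1 - p.1.1 * q.2,
   p.1.1 * q.1.2 - p.1.2 * q.1.1).
Definition det3 p q r : K := dot p (cross q r).
Definition null : pt := (0, 0, 0).
Definition seg p q (u v : K) : pt := cmb p q null u v 0.

(* In [binform], [y] is factored out first and a power of [z] remains; in
   [form], [x] is factored out first and a binary form in [y, z] remains. *)
Fixpoint binform d (B : K -> K -> K) : Prop :=
  match d with
  | 0 => exists b, forall y z, B y z = b
  | d'.+1 => exists (B1 : K -> K -> K) (b : K),
      binform d' B1 /\ forall y z, B y z = y * B1 y z + b * z ^+ d
  end.

Fixpoint form d G : Prop :=
  match d with
  | 0 => exists c, forall p, G p = c
  | d'.+1 => exists (G1 : pt -> K) (B : K -> K -> K),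
      [/\ form d' G1, binform d B & forall x y z, G (x, y, z) = x * G1 (x, y, z) + B y z]
  end.

Lemma eq_form d G G' : (forall p, G p = G' p) -> form d G -> form d G'.
Proof.
case: d => [|d] e /=; first by case=> b h; exists b => p; rewrite -e.
by case=> G1 [B [h1 h2 h3]]; exists G1, B; split=> // x y z; rewrite -e.
Qed.

Lemma binform_add d B B' : binform d B -> binform d B' -> binform d (fun y z => B y z + B' y z).
Proof.
elim: d B B' => [|d IH] B B' /=.
  by move=> [b h] [b' h']; exists (b + b') => y z; rewrite h h'.
move=> [B1 [b [h1 h2]]] [B1' [b' [h1' h2']]].
exists (fun y z => B1 y z + B1' y z), (b + b'); split; first exact: IH.
by move=> y z; rewrite h2 h2'; ring.
Qed.

Lemma binform_scale d k B : binform d B -> binform d (fun y z => k * B y z).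
Proof.
elim: d B => [|d IH] B /=.
  by move=> [b h]; exists (k * b) => y z; rewrite h.
move=> [B1 [b [h1 h2]]].
exists (fun y z => k * B1 y z), (k * b); split; first exact: IH.
by move=> y z; rewrite h2; ring.
Qed.

Lemma binform_mulz d B : binform d B -> binform d.+1 (fun y z => z * B y z).
Proof.
elim: d B => [|d IH] B.
  case=> b h; exists (fun _ _ => 0), b; split; first by exists 0.
  by move=> y z; rewrite h; ring.
case=> B1 [b [h1 h2]]; exists (fun y z => z * B1 y z), b; split; first exact: IH.
by move=> y z; rewrite h2 [in RHS]exprS; ring.
Qed.

Lemma binform_muly d B : binform d B -> binform d.+1 (fun y z => y * B y z).
Proof. by move=> h; exists B, 0; split=> // y z; ring. Qed.

Lemma binform_zero d : binform d (fun _ _ => 0).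
Proof.
elim: d => [|d IH] /=; first by exists 0.
by exists (fun _ _ => 0), 0; split=> // y z; ring.
Qed.

Lemma form_add d G H : form d G -> form d H -> form d (fun p => G p + H p).
Proof.
elim: d G H => [|d IH] G H.
  by move=> [b h] [b' h']; exists (b + b') => p; rewrite h h'.
move=> [G1 [B [h1 h2 h3]]] [H1 [B' [k1 k2 k3]]].
exists (fun p => G1 p + H1 p), (fun y z => B y z + B' y z); split; first exact: IH.
  exact: (binform_add h2 k2).
by move=> x y z; rewrite h3 k3; ring.
Qed.

Lemma form_scale d k G : form d G -> form d (fun p => k * G p).
Proof.
elim: d G => [|d IH] G.
  by move=> [b h]; exists (k * b) => p; rewrite h.
move=> [G1 [B [h1 h2 h3]]].
exists (fun p => k * G1 p), (fun y z => k * B y z); split; first exact: IH.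
  exact: (binform_scale k h2).
by move=> x y z; rewrite h3; ring.
Qed.

Lemma form_zero d : form d (fun _ => 0).
Proof.
elim: d => [|d IH]; first by exists 0.
exists (fun _ => 0), (fun _ _ => 0); split=> //; first exact: binform_zero.
by move=> x y z; ring.
Qed.

Lemma form_mulx d G : form d G -> form d.+1 (fun p => p.1.1 * G p).
Proof.
move=> h; exists G, (fun _ _ => 0); split=> //; first exact: binform_zero.
by move=> x y z /=; ring.
Qed.

Lemma form_muly d G : form d G -> form d.+1 (fun p => p.1.2 * G p).
Proof.
elim: d G => [|d IH] G.
  case=> c h; exists (fun _ => 0), (fun y _ => y * c); split.
  - by exists 0.
  - by exists (fun _ _ => c), 0; split; [exists c | move=> y z; ring].
  - by move=> x y z; rewrite h /=; ring.
case=> G1 [B [h1 h2 h3]]; exists (fun p => p.1.2 * G1 p), (fun y z => y * B y z); split.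
- exact: IH.
- exact: binform_muly.
- by move=> x y z; rewrite h3 /=; ring.
Qed.

Lemma form_mulz d G : form d G -> form d.+1 (fun p => p.2 * G p).
Proof.
elim: d G => [|d IH] G.
  case=> c h; exists (fun _ => 0), (fun _ z => z * c); split.
  - by exists 0.
  - by exists (fun _ _ => 0), c; split; [exists 0 | move=> y z; ring].
  - by move=> x y z; rewrite h /=; ring.
case=> G1 [B [h1 h2 h3]]; exists (fun p => p.2 * G1 p), (fun y z => z * B y z); split.
- exact: IH.
- exact: binform_mulz.
- by move=> x y z; rewrite h3 /=; ring.
Qed.

Lemma form_dot d l G : form d G -> form d.+1 (fun p => dot l p * G p).
Proof.
move=> h.
apply: (@eq_form _ (fun p => l.1.1 * (p.1.1 * G p) + l.1.2 * (p.1.2 * G p) + l.2 * (p.2 * G p))).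
  by move=> p; rewrite /dot; ring.
apply: form_add; first apply: form_add; apply: form_scale.
- exact: form_mulx.
- exact: form_muly.
- exact: form_mulz.
Qed.

Lemma form_sub d G H : form d G -> form d H -> form d (fun p => G p - H p).
Proof.
move=> h k; apply: eq_form (form_add h (form_scale (-1) k)) => p; ring.
Qed.

Lemma form_one : form 0 (fun _ => 1).
Proof. by exists 1. Qed.

Lemma form_lin l : form 1 (dot l).
Proof. by apply: eq_form (form_dot l form_one) => p; rewrite mulr1. Qed.

Lemma binform_cmb d B m n : binform d B -> form d (fun p => B (dot m p) (dot n p)).
Proof.
elim: d B => [|d IH] B.
  by case=> b h; exists b => p; rewrite h.
case=> B1 [b [h1 h2]].
have hz k : form k (fun p => dot n p ^+ k).
  elim: k => [|k ih]; first exact: form_one.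
  by apply: eq_form (form_dot n ih) => p; rewrite exprS.
apply: eq_form (form_add (form_dot m (IH _ h1)) (form_scale b (hz d.+1))) => p.
by rewrite h2.
Qed.

Lemma form_comp d G k m n : form d G -> form d (fun p => G (dot k p, dot m p, dot n p)).
Proof.
elim: d G => [|d IH] G.
  by case=> b h; exists b => p; rewrite h.
case=> G1 [B [h1 h2 h3]].
apply: eq_form (form_add (form_dot k (IH _ h1)) (binform_cmb m n h2)) => p.
by rewrite h3.
Qed.

Lemma form_basis d G a b c : form d G -> form d (fun p => G (cmb (a : pt) b c p.1.1 p.1.2 p.2)).
Proof.
move=> h.
apply: eq_form (form_comp (a.1.1, b.1.1, c.1.1) (a.1.2, b.1.2, c.1.2) (a.2, b.2, c.2) h) => p.
by congr (G (_, _, _)); rewrite /dot /=; ring.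
Qed.

Lemma form_homog d G k x y z : form d G -> G (k * x, k * y, k * z) = k ^+ d * G (x, y, z).
Proof.
have hb e B : binform e B -> forall u v, B (k * u) (k * v) = k ^+ e * B u v.
  elim: e B => [|e IH] B.
    by case=> b h u v; rewrite !h expr0 mul1r.
  by case=> B1 [b [h1 h2]] u v; rewrite !h2 IH // exprMn exprS; ring.
elim: d G => [|d IH] G.
  by case=> b h; rewrite !h expr0 mul1r.
by case=> G1 [B [h1 h2 h3]]; rewrite !h3 IH // (hb _ _ h2) exprS; ring.
Qed.

Lemma seg1E P Q s : seg P Q 1 s = (P.1.1 + s * Q.1.1, P.1.2 + s * Q.1.2, P.2 + s * Q.2).
Proof. by rewrite /seg /cmb /null /=; congr (_, _, _); ring. Qed.

(** Turns questions on forms into root counting in one variable. The point Q itself, at s infinite,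
    is not covered. *)
Lemma form_poly d G P Q : form d G ->
  exists2 r : {poly K}, (size r <= d.+1)%N & forall s, G (seg P Q 1 s) = r.[s].
Proof.
have hlin (u v : K) : (size (u%:P + v%:P * 'X : {poly K})%R <= 2)%N.
  rewrite (leq_trans (size_polyD _ _)) // geq_max (leq_trans (size_polyC_leq1 _)) //=.
  by rewrite (leq_trans (size_polyMleq _ _)) // size_polyX addn2 /= ltnS size_polyC_leq1.
have hmul (u v : K) (r : {poly K}) e : (size r <= e.+1)%N ->
    (size ((u%:P + v%:P * 'X) * r)%R <= e.+2)%N.
  move=> hr; rewrite (leq_trans (size_polyMleq _ _)) //.
  have := leq_add (hlin u v) hr; rewrite add2n => hh.
  by case: (_ + _)%N hh => // n; rewrite ltnS.
have hb e B : binform e B -> exists2 r : {poly K}, (size r <= e.+1)%N &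
    forall s, B (P.1.2 + s * Q.1.2) (P.2 + s * Q.2) = r.[s].
  elim: e B => [|e IH] B.
    by case=> b h; exists b%:P => [|s]; rewrite ?size_polyC_leq1 // h hornerC.
  case=> B1 [b [h1 h2]]; have [r hr1 hr2] := IH _ h1.
  have hz n : (size ((P.2%:P + Q.2%:P * 'X) ^+ n : {poly K})%R <= n.+1)%N.
    elim: n => [|n ih]; first by rewrite expr0 size_poly1.
    by rewrite exprS; apply: hmul.
  exists ((P.1.2%:P + Q.1.2%:P * 'X) * r + b%:P * (P.2%:P + Q.2%:P * 'X) ^+ e.+1).
    rewrite (leq_trans (size_polyD _ _)) // geq_max hmul //=.
    rewrite mul_polyC; exact: leq_trans (size_scale_leq _ _) (hz _).
  move=> s; rewrite h2 hr2 !(hornerE, horner_exp).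
  by rewrite ![_ * s]mulrC.
elim: d G => [|d IH] G.
  by case=> b h; exists b%:P => [|s]; rewrite ?size_polyC_leq1 // h hornerC.
case=> G1 [B [h1 h2 h3]].
have [r hr1 hr2] := IH _ h1; have [t ht1 ht2] := hb _ _ h2.
exists ((P.1.1%:P + Q.1.1%:P * 'X) * r + t).
  by rewrite (leq_trans (size_polyD _ _)) // geq_max hmul.
by move=> s; rewrite !hornerE -hr2 -ht2 seg1E h3 (mulrC Q.1.1).
Qed.

(** The monomials are grouped by decreasing powers of x: in a frame (p, q, r), c0 is the value at p
    and (c1, c2) the linear part at p. *)
Lemma form3_coef G : form 3 G -> exists c0 c1 c2 c3 c4 c5 c6 c7 c8 c9, forall x y z,
  G (x, y, z) = c0 * x ^+ 3 + x ^+ 2 * (c1 * y + c2 * z)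
    + x * (c3 * y ^+ 2 + c4 * y * z + c5 * z ^+ 2)
    + (c6 * y ^+ 3 + c7 * y ^+ 2 * z + c8 * y * z ^+ 2 + c9 * z ^+ 3).
Proof.
case=> G2 [B3 [[G1 [B2 [[G0 [B1 [[c0 e0]]]]]]]]].
case=> [?] [c2] [[c1 e1] f1] g1 [?] [c5] [[?] [c4] [[c3 e3] f4] f5] g2.
case=> [?] [c9] [[?] [c8] [[?] [c7] [[c6 e6] f7] f8] f9] g3.
exists c0, c1, c2, c3, c4, c5, c6, c7, c8, c9 => x y z.
rewrite g3 g2 g1 e0 f9 f8 f7 e6 f5 f4 e3 f1 e1; ring.
Qed.

Lemma form4_coef G : form 4 G ->
  exists c0 c1 c2 c3 c4 c5 c6 c7 c8 c9, exists d0 d1 d2 d3 d4, forall x y z,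
  G (x, y, z) = c0 * x ^+ 4 + x ^+ 3 * (c1 * y + c2 * z)
    + x ^+ 2 * (c3 * y ^+ 2 + c4 * y * z + c5 * z ^+ 2)
    + x * (c6 * y ^+ 3 + c7 * y ^+ 2 * z + c8 * y * z ^+ 2 + c9 * z ^+ 3)
    + (d0 * y ^+ 4 + d1 * y ^+ 3 * z + d2 * y ^+ 2 * z ^+ 2 + d3 * y * z ^+ 3 + d4 * z ^+ 4).
Proof.
case=> G3 [B4 [/form3_coef]].
case=> c0 [c1] [c2] [c3] [c4] [c5] [c6] [c7] [c8] [c9] e.
case=> [?] [d4] [[?] [d3] [[?] [d2] [[?] [d1] [[d0 f0] f1] f2] f3] f4] f.
exists c0, c1, c2, c3, c4, c5, c6, c7, c8, c9, d0, d1, d2, d3, d4 => x y z.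
rewrite f e f4 f3 f2 f1 f0; ring.
Qed.

Lemma form2_coef G : form 2 G -> exists c0 c1 c2 c3 c4 c5, forall x y z,
  G (x, y, z) = c0 * x ^+ 2 + x * (c1 * y + c2 * z)
    + (c3 * y ^+ 2 + c4 * y * z + c5 * z ^+ 2).
Proof.
case=> G1 [B2 [[G0 [B1 [[c0 e0]]]]]].
case=> [?] [c2] [[c1 e1] f1] g1 [?] [c5] [[?] [c4] [[c3 e3] f4] f5] g2.
exists c0, c1, c2, c3, c4, c5 => x y z.
rewrite g2 g1 e0 f5 f4 e3 f1 e1; ring.
Qed.

Lemma form1_dot G : form 1 G -> exists l, forall p, G p = dot l p.
Proof.
case=> G1 [B [[a ha] [B1 [c [[b hb] hB]]] h]].
exists (a, b, c) => -[[x y] z]; rewrite h ha hB hb /dot /= expr1; ring.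
Qed.

End Forms.

(** * Points and lines of the projective plane *)

Section Points.
Variable K : fieldType.
Hypothesis charK : [pchar K] =i pred0.
Local Notation pt := (pt K).
Implicit Types (p q l m P Q X : pt) (G H : pt -> K) (r : {poly K}) (d : nat).

Definition scal (k : K) p : pt := (k * p.1.1, k * p.1.2, k * p.2).

(** In characteristic zero the integers are distinct in [K], so among [size h] of them there is a
    non-root of h, the product of r and the linear factors at [xs]. With r = 1 this picks an element
    outside a finite list. *)
Lemma poly_avoid r (xs : seq K) : r != 0 -> exists2 s, s \notin xs & r.[s] != 0.
Proof.
move=> r0; pose h := r * \prod_(x <- xs) ('X - x%:P).
have h0 : h != 0.
  by rewrite mulf_neq0 // monic_neq0 // monic_prod // => x _; exact: monicXsubC.
pose ns := [seq (i%:R : K) | i <- iota 0 (size h)].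
have uns : uniq ns.
  rewrite map_inj_uniq ?iota_uniq // => i j /eqP.
  wlog le_ij : i j / (i <= j)%N.
    by move=> W; case/orP: (leq_total i j) => le; [exact: W | rewrite eq_sym => /(W _ _ le)].
  rewrite eq_sym -subr_eq0 -natrB // ((pcharf0P K).1 charK) subn_eq0 => le_ji.
  by apply/eqP; rewrite eqn_leq le_ij.
have [/allP ha | /allPn [s _ hs]] := boolP (all (root h) ns).
  have : all (root h) ns by apply/allP.
  by move/(max_poly_roots h0)/(_ uns); rewrite size_map size_iota ltnn.
move: hs; rewrite /h rootM negb_or root_prod_XsubC => /andP[h1 h2].
by exists s.
Qed.

Lemma poly_dense r (xs : seq K) : (forall s, s \notin xs -> r.[s] = 0) -> r = 0.
Proof.
move=> h; apply/eqP; apply: contraT => /(poly_avoid xs) [s /h ->].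
by rewrite eqxx.
Qed.

Lemma dotC p q : dot p q = dot q p. Proof. by rewrite /dot; ring. Qed.

Lemma dot_cmb l p q X x y z :
  dot l (cmb p q X x y z) = x * dot l p + y * dot l q + z * dot l X.
Proof. by rewrite /dot /cmb /=; ring. Qed.

Lemma dot_seg l p q u v : dot l (seg p q u v) = u * dot l p + v * dot l q.
Proof. by rewrite /seg dot_cmb mul0r addr0. Qed.

Lemma dot_scal l k p : dot l (scal k p) = k * dot l p.
Proof. by rewrite /dot /=; ring. Qed.

Lemma dot_crossl p q : dot (cross p q) p = 0.
Proof. by rewrite /dot /cross /=; ring. Qed.

Lemma dot_crossr p q : dot (cross p q) q = 0.
Proof. by rewrite /dot /cross /=; ring. Qed.

Lemma dot_cross p q X : dot (cross p q) X = det3 p q X.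
Proof. by rewrite /det3 /dot /cross /=; ring. Qed.

Lemma pt_ext p q : p.1.1 = q.1.1 -> p.1.2 = q.1.2 -> p.2 = q.2 -> p = q.
Proof. by case: p q => [[? ?] ?] [[? ?] ?] /= -> -> ->. Qed.

Lemma crossC p q : cross p q = scal (-1) (cross q p).
Proof. by apply: pt_ext => /=; ring. Qed.

Lemma crosspp p : cross p p = null K.
Proof. by apply: pt_ext => /=; ring. Qed.

Lemma scal_eq0 k p : k != 0 -> (scal k p == null K) = (p == null K).
Proof.
by case: p => [[x y] z] k0; rewrite !xpair_eqE !mulf_eq0 (negbTE k0).
Qed.

Lemma scal_neq0 k p : scal k p != null K -> k != 0 /\ p != null K.
Proof.
move=> h; have k0 : k != 0.
  by apply: contraNneq h => ->; apply/eqP/pt_ext; rewrite /= mul0r.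
by rewrite scal_eq0 in h.
Qed.

Lemma crossC_eq0 p q : (cross p q == null K) = (cross q p == null K).
Proof. by rewrite crossC scal_eq0 // oppr_eq0 oner_eq0. Qed.

Lemma null_dot l : l != null K -> exists a, dot l a != 0.
Proof.
move=> l0; have : (l.1.1 != 0) || (l.1.2 != 0) || (l.2 != 0).
  by apply: contraR l0; case: l => [[x y] z] /=; rewrite !xpair_eqE /= -!negb_and negbK.
case/orP => [/orP[h|h]|h]; [exists (1, 0, 0) | exists (0, 1, 0) | exists (0, 0, 1)];
  apply: contraNneq h; rewrite /dot /= => <-; apply/eqP; ring.
Qed.

Lemma line_basis l : l != null K ->
  exists b c, exists2 k, k != 0 & cross b c = scal k l.
Proof.
move=> l0; have : (l.1.1 != 0) || (l.1.2 != 0) || (l.2 != 0).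
  by apply: contraR l0; case: l => [[x y] z] /=; rewrite !xpair_eqE /= -!negb_and negbK.
case: l {l0} => [[x y] z] /=.
case/orP => [/orP[h|h]|h].
- exists (- y, x, 0), (- z, 0, x), x => //; apply: pt_ext => /=; ring.
- exists (y, - x, 0), (0, - z, y), (- y); rewrite ?oppr_eq0 //; apply: pt_ext => /=; ring.
- exists (0, z, - y), (- z, 0, x), z => //; apply: pt_ext => /=; ring.
Qed.

Lemma cross_null p q : p != null K -> cross p q = null K -> exists k, q = scal k p.
Proof.
move=> p0 e; have [a ha] := null_dot p0.
have e1 := congr1 (fun X => X.1.1) e; have e2 := congr1 (fun X => X.1.2) e.
have e3 := congr1 snd e; move: e1 e2 e3 => /= e1 e2 e3.
exists (dot a q / dot a p); move: ha; rewrite dotC => ha.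
suff h : scal (dot a p) q = scal (dot a q) p.
  by apply: pt_ext => /=; apply: (mulfI ha);
     [move/(congr1 (fun X => X.1.1)): h | move/(congr1 (fun X => X.1.2)): h | move/(congr1 snd): h];
     rewrite /= => ->; rewrite mulrA mulrCA mulfV // mulr1.
rewrite /scal /dot; apply: pt_ext => /=.
- transitivity ((a.1.1 * q.1.1 + a.1.2 * q.1.2 + a.2 * q.2) * p.1.1
    - a.1.2 * (p.1.1 * q.1.2 - p.1.2 * q.1.1) + a.2 * (p.2 * q.1.1 - p.1.1 * q.2)); first ring.
  by rewrite e2 e3; ring.
- transitivity ((a.1.1 * q.1.1 + a.1.2 * q.1.2 + a.2 * q.2) * p.1.2
    + a.1.1 * (p.1.1 * q.1.2 - p.1.2 * q.1.1) - a.2 * (p.1.2 * q.2 - p.2 * q.1.2)); first ring.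
  by rewrite e1 e3; ring.
- transitivity ((a.1.1 * q.1.1 + a.1.2 * q.1.2 + a.2 * q.2) * p.2
    - a.1.1 * (p.2 * q.1.1 - p.1.1 * q.2) + a.1.2 * (p.1.2 * q.2 - p.2 * q.1.2)); first ring.
  by rewrite e1 e2; ring.
Qed.

(** Cramer's rule. *)
Lemma cmb_basis (a b c P : pt) : det3 a b c != 0 ->
  P = cmb a b c (det3 P b c / det3 a b c) (det3 a P c / det3 a b c) (det3 a b P / det3 a b c).
Proof.
move=> h.
have key x y z w u v t : det3 a b c * t = x * u + y * v + z * w ->
    t = x / det3 a b c * u + y / det3 a b c * v + z / det3 a b c * w.
  by move=> e; apply: (mulfI h); rewrite e; move: h; set d := det3 a b c => h; field.
by apply: pt_ext; rewrite /=; apply: key; rewrite /det3 /dot /=; ring.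
Qed.

Lemma line_param p q P : cross p q != null K -> dot (cross p q) P = 0 ->
  exists u v, P = seg p q u v.
Proof.
move=> h e; have [a ha] := null_dot h; rewrite dot_cross in ha; rewrite dot_cross in e.
exists (det3 P q a / det3 p q a), (det3 p P a / det3 p q a).
by rewrite [LHS](cmb_basis _ ha) e mul0r; apply: pt_ext => /=; ring.
Qed.

(** By Lagrange's formula, [cross (cross p q) l] is a combination of p and q with coefficients
    [dot l q] and [dot l p] up to sign. *)
Lemma line_through p q l : cross p q != null K -> dot l p = 0 -> dot l q = 0 ->
  exists k, l = scal k (cross p q).
Proof.
move=> h lp lq; apply: cross_null => //.
have -> : cross (cross p q) l = seg p q (- dot l q) (dot l p).
  by apply: pt_ext; rewrite /dot /=; ring.
by rewrite lp lq oppr0; apply: pt_ext => /=; ring.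
Qed.

Lemma cross_scal (k k' : K) p : cross (scal k p) (scal k' p) = null K.
Proof. by apply: pt_ext => /=; ring. Qed.

Lemma cross_lines p q l m : cross p q != null K -> dot l p = 0 -> dot l q = 0 ->
  dot m p = 0 -> dot m q = 0 -> cross l m = null K.
Proof.
move=> h lp lq mp mq; have [k ->] := line_through h lp lq.
by have [k' ->] := line_through h mp mq; rewrite cross_scal.
Qed.

Lemma form_scal d G k p : form d G -> G (scal k p) = k ^+ d * G p.
Proof. by case: p => [[x y] z] h; exact: form_homog. Qed.

Lemma form_null d G : form d.+1 G -> G (null K) = 0.
Proof.
move=> h; have -> : null K = scal 0 (null K) by apply: pt_ext => /=; ring.
by rewrite (form_scal _ _ h) exprS !mul0r.
Qed.

Lemma scal_seg k p q u v : scal k (seg p q u v) = seg p q (k * u) (k * v).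
Proof. by apply: pt_ext => /=; ring. Qed.

(** Finitely many parameters may be missing. Homogeneity reaches every point except the multiples of
    q; for these the line is read from q, where only the parameter 0 is not yet known. *)
Lemma line_dense d G p q (xs : seq K) : form d G ->
  (forall s, s \notin xs -> G (seg p q 1 s) = 0) -> forall u v, G (seg p q u v) = 0.
Proof.
move=> hG h0.
have h s : G (seg p q 1 s) = 0.
  have [r _ hr] := form_poly p q hG.
  by rewrite hr (@poly_dense r xs) ?horner0 // => s' /h0; rewrite hr.
have h1 u v : u != 0 -> G (seg p q u v) = 0.
  move=> u0; have -> : seg p q u v = scal u (seg p q 1 (v / u)).
    by rewrite scal_seg mulr1 mulrCA mulfV // mulr1.
  by rewrite (form_scal _ _ hG) h mulr0.
move=> u v; have [->|u0] := eqVneq u 0; last exact: h1.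
have [r _ hr] := form_poly (scal v q) p hG.
have -> : seg p q 0 v = seg (scal v q) p 1 0 by apply: pt_ext => /=; ring.
rewrite hr (@poly_dense r [:: 0]) ?horner0 // => s; rewrite inE => s0; rewrite -hr.
have -> : seg (scal v q) p 1 s = seg p q s v by apply: pt_ext => /=; ring.
exact: h1.
Qed.

Lemma line_dense_on d G l (b c : pt) (k : K) (xs : seq K) : l != null K -> form d G ->
  k != 0 -> cross b c = scal k l -> (forall s, s \notin xs -> G (seg b c 1 s) = 0) ->
  forall P, dot l P = 0 -> G P = 0.
Proof.
move=> l0 hG k0 e h P hP; have [||u [v ->]] := @line_param b c P.
- by rewrite e scal_eq0.
- by rewrite e dotC dot_scal dotC hP mulr0.
- exact: (line_dense hG h).
Qed.

(** In a basis (a, b, c) with b and c on the line, the part of the form free of the first coordinate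
    is its restriction to the line, hence zero, and the first coordinate is proportional to
    [dot l]. *)
Lemma form_div d G l : form d.+1 G -> l != null K -> (forall P, dot l P = 0 -> G P = 0) ->
  exists2 H, form d H & forall P, G P = dot l P * H P.
Proof.
move=> hG l0 h; have [b [c [k k0 e]]] := line_basis l0; have [a ha] := null_dot l0.
have [G1 [B [h1 h2 h3]]] := form_basis a b c hG.
have B0 y z : B y z = 0.
  have := h3 0 y z; rewrite mul0r add0r /= => <-; apply: h.
  have := dot_crossl b c; have := dot_crossr b c; rewrite e => ec eb.
  apply: (mulfI k0); rewrite mulr0.
  transitivity (y * dot (scal k l) b + z * dot (scal k l) c); last by rewrite eb ec; ring.
  by rewrite /dot /=; ring.
have d0 : det3 a b c != 0.
  by rewrite /det3 e dot_scal dotC mulf_neq0.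
have detP P : det3 P b c = k * dot l P by rewrite /det3 e dot_scal dotC.
(* [la], [lb], [lc] are the dual basis, which expresses the quotient in the original coordinates. *)
pose lb : pt := (let X := cross c a in scal (det3 a b c)^-1 X).
pose lc : pt := (let X := cross a b in scal (det3 a b c)^-1 X).
pose la : pt := scal (det3 a b c)^-1 (cross b c).
exists (fun P => (k / det3 a b c) * G1 (dot la P, dot lb P, dot lc P)).
  exact/form_scale/form_comp.
move=> P; have -> : (dot la P, dot lb P, dot lc P) =
  (det3 P b c / det3 a b c, det3 a P c / det3 a b c, det3 a b P / det3 a b c).
  by congr (_, _, _); rewrite [LHS]dotC dot_scal mulrC /det3 /dot /=; congr (_ * _); ring.
rewrite {1}(cmb_basis P d0); have := h3 (det3 P b c / det3 a b c) (det3 a P c / det3 a b c) (det3 a b P / det3 a b c).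
by rewrite /= => ->; rewrite B0 addr0 detP; ring.
Qed.

End Points.

(** * Counting by fibres and by roots *)

Section Counting.
Variables (K : fieldType) (T : eqType).

Lemma size_le_fibres (f : T -> K) (xs : seq T) (ys : seq K) k :
  {in xs, forall x, f x \in ys} ->
  {in ys, forall y, count (fun x => f x == y) xs <= k}%N ->
  (size xs <= k * size ys)%N.
Proof.
elim: ys xs => [|y ys IH] xs h1 h2.
  by case: xs h1 {h2} => [|x xs] // /(_ x); rewrite inE eqxx => /(_ isT).
rewrite -(count_predC (fun x => f x == y)) mulnS leq_add //.
  exact/h2/mem_head.
rewrite -size_filter; apply: IH => [x | z hz].
  by rewrite mem_filter /= => /andP[/negbTE h /h1]; rewrite inE h.
apply: leq_trans (h2 z _); last by rewrite inE hz orbT.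
by rewrite count_filter; apply: sub_count => x /= /andP[].
Qed.

Lemma size_lt_roots (f : T -> K) (xs : seq T) (g : {poly K}) : g != 0 -> uniq xs ->
  {in xs &, injective f} -> {in xs, forall x, g.[f x] = 0} -> (size xs < size g)%N.
Proof.
move=> g0 u inj h; rewrite -(size_map f); apply: max_poly_roots => //.
  by apply/allP => _ /mapP[x hx ->]; apply/eqP/h.
by rewrite map_inj_in_uniq.
Qed.

End Counting.

Section PolySize.
Variable K : fieldType.
Implicit Types f g : {poly K}.

Lemma size_mul_le f g m n : (size f <= m.+1)%N -> (size g <= n.+1)%N -> (size (f * g)%R <= (m + n).+1)%N.
Proof. by move=> hf hg; have := size_polyMleq f g; lia. Qed.

Lemma size_add_le f g n : (size f <= n)%N -> (size g <= n)%N -> (size (f + g)%R <= n)%N.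
Proof. by move=> hf hg; have := size_polyD f g; lia. Qed.

Lemma coef_mul_top f g m n : (size f <= m.+1)%N -> (size g <= n.+1)%N ->
  (f * g)`_(m + n) = f`_m * g`_n.
Proof.
move=> hf hg; have hm : (m < (m + n).+1)%N by lia.
rewrite coefM (bigD1 (Ordinal hm)) //= addKn big1 ?addr0 // => i ne.
have [lt|ge] := ltnP i m.
  by rewrite [g`__]nth_default ?mulr0 //; apply: leq_trans hg _; lia.
rewrite [f`__]nth_default ?mul0r //; apply: leq_trans hf _.
have : (i : nat) != m by apply: contraNneq ne => e; apply/eqP/val_inj.
by lia.
Qed.

End PolySize.

(** * Monoid surfaces in plane terms *)

Section Monoid.
Variable K : fieldType.
Hypothesis charK : [pchar K] =i pred0.
Local Notation pt := (pt K).
Implicit Types (p q r l m P Q X : pt) (x y z s t u v : K).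
Variables F3 F4 : pt -> K.
Hypotheses (form3 : form 3 F3) (form4 : form 4 F4).

Definition base_pt (p : pt) := [/\ p != null K, F3 p = 0 & F4 p = 0].

(** When F4 = [dot a] F3 on l, the graph t = - [dot a] P over l lies on the surface t F3 + F4 =
    0. *)
Definition lifts (l : pt) :=
  l != null K /\ exists a, forall P, dot l P = 0 -> F4 P = dot a P * F3 P.

(** Order at least 2 at p, tested along each line through p. *)
Definition order2 (G : pt -> K) (p : pt) :=
  forall Q, exists r : {poly K}, forall s, G (seg p Q 1 s) = s ^+ 2 * r.[s].

Hypothesis transv : forall p, base_pt p ->
  forall t, ~ order2 (fun P => t * F3 P + F4 P) p.

Lemma dual_basis (p q r : pt) u v w : det3 p q r != 0 ->
  exists a, [/\ dot a p = u, dot a q = v & dot a r = w].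
Proof.
move=> h; exists (scal (det3 p q r)^-1 (cmb (cross q r) (cross r p) (cross p q) u v w)).
split; apply: (mulfI h); rewrite [dot _ _]dotC dot_scal mulVKf //;
  by rewrite /det3 /dot /=; ring.
Qed.

Lemma cubic_all0 (a b c d : K) : (forall z, a * z ^+ 3 + b * z ^+ 2 + c * z + d = 0) ->
  [/\ a = 0, b = 0, c = 0 & d = 0].
Proof.
move=> h; pose r : {poly K} := Poly [:: d; c; b; a].
have r0 : r = 0.
  apply: (poly_dense charK (xs := [::])) => s _; rewrite horner_Poly /= -[RHS](h s); ring.
have co i : r`_i = [:: d; c; b; a]`_i by rewrite coef_Poly.
by split; [have := co 3%N | have := co 2%N | have := co 1%N | have := co 0%N];
   rewrite r0 coef0.
Qed.

(* Coordinates centred at a base point where the cubic is smooth, with r on the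
   tangent. *)
Definition tangent_frame (p q r : pt) := det3 p q r != 0 /\
  exists (c3 c4 c5 c6 c7 c8 c9 : K), forall x y z,
  F3 (cmb p q r x y z) = x ^+ 2 * y
    + x * (c3 * y ^+ 2 + c4 * y * z + c5 * z ^+ 2)
    + (c6 * y ^+ 3 + c7 * y ^+ 2 * z + c8 * y * z ^+ 2 + c9 * z ^+ 3).

Lemma frame_coef3 p q r : exists c0 c1 c2 c3 c4 c5 c6 c7 c8 c9, forall x y z,
  F3 (cmb p q r x y z) = c0 * x ^+ 3 + x ^+ 2 * (c1 * y + c2 * z)
    + x * (c3 * y ^+ 2 + c4 * y * z + c5 * z ^+ 2)
    + (c6 * y ^+ 3 + c7 * y ^+ 2 * z + c8 * y * z ^+ 2 + c9 * z ^+ 3).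
Proof. exact: (form3_coef (form_basis p q r form3)). Qed.

Lemma frame_coef4 p q r : exists c0 c1 c2 c3 c4 c5 c6 c7 c8 c9, exists d0 d1 d2 d3 d4, forall x y z,
  F4 (cmb p q r x y z) = c0 * x ^+ 4 + x ^+ 3 * (c1 * y + c2 * z)
    + x ^+ 2 * (c3 * y ^+ 2 + c4 * y * z + c5 * z ^+ 2)
    + x * (c6 * y ^+ 3 + c7 * y ^+ 2 * z + c8 * y * z ^+ 2 + c9 * z ^+ 3)
    + (d0 * y ^+ 4 + d1 * y ^+ 3 * z + d2 * y ^+ 2 * z ^+ 2 + d3 * y * z ^+ 3 + d4 * z ^+ 4).
Proof. exact: (form4_coef (form_basis p q r form4)). Qed.

Lemma pt_basis p : p != null K -> exists q r, det3 p q r != 0.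
Proof.
move=> p0; have [l hl] := null_dot p0; have l0 : l != null K.
  by apply: contraNneq hl => ->; apply/eqP; rewrite /dot /=; ring.
have [q [r [k k0 e]]] := line_basis l0; exists q, r.
by rewrite /det3 e dot_scal mulf_neq0.
Qed.

Lemma cmb_e1 p q r : cmb p q r 1 0 0 = p.
Proof. by apply: pt_ext => /=; ring. Qed.

(** (t c1 + b1, t c2 + b2) is the linear part of t F3 + F4 at p; where it vanishes, p has order 2
    for this t. *)
Lemma frame_transversal p q r c0 c1 c2 c3 c4 c5 c6 c7 c8 c9
    b0 b1 b2 b3 b4 b5 b6 b7 b8 b9 d0 d1 d2 d3 d4 :
  det3 p q r != 0 -> base_pt p ->
  (forall x y z, F3 (cmb p q r x y z) = c0 * x ^+ 3 + x ^+ 2 * (c1 * y + c2 * z)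
    + x * (c3 * y ^+ 2 + c4 * y * z + c5 * z ^+ 2)
    + (c6 * y ^+ 3 + c7 * y ^+ 2 * z + c8 * y * z ^+ 2 + c9 * z ^+ 3)) ->
  (forall x y z, F4 (cmb p q r x y z) = b0 * x ^+ 4 + x ^+ 3 * (b1 * y + b2 * z)
    + x ^+ 2 * (b3 * y ^+ 2 + b4 * y * z + b5 * z ^+ 2)
    + x * (b6 * y ^+ 3 + b7 * y ^+ 2 * z + b8 * y * z ^+ 2 + b9 * z ^+ 3)
    + (d0 * y ^+ 4 + d1 * y ^+ 3 * z + d2 * y ^+ 2 * z ^+ 2 + d3 * y * z ^+ 3 + d4 * z ^+ 4)) ->
  [/\ c0 = 0, b0 = 0 & forall t, ~ (t * c1 + b1 = 0 /\ t * c2 + b2 = 0)].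
Proof.
move=> det0 bp h3 h4; have [_ z3 z4] := bp.
have hc0 : c0 = 0 by have := h3 1 0 0; rewrite cmb_e1 z3 => ->; ring.
have hb0 : b0 = 0 by have := h4 1 0 0; rewrite cmb_e1 z4 => ->; ring.
split=> // t [e1 e2]; apply: (transv bp (t := t)) => Q.
rewrite (cmb_basis Q det0); set x := _ / _; set y := _ / _; set z := _ / _.
pose X : {poly K} := 1 + x%:P * 'X.
(* The linear parts of t F3 and F4 come with X^2 and X^3, where X = 1 + x s, so they cancel only up
   to X - 1 = x s; this is the first term. *)
exists (x%:P * (b1 * y + b2 * z)%:P * X ^+ 2
  + t%:P * (X * (c3 * y ^+ 2 + c4 * y * z + c5 * z ^+ 2)%:P
           + 'X * (c6 * y ^+ 3 + c7 * y ^+ 2 * z + c8 * y * z ^+ 2 + c9 * z ^+ 3)%:P)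
  + X ^+ 2 * (b3 * y ^+ 2 + b4 * y * z + b5 * z ^+ 2)%:P
  + X * 'X * (b6 * y ^+ 3 + b7 * y ^+ 2 * z + b8 * y * z ^+ 2 + b9 * z ^+ 3)%:P
  + 'X ^+ 2 * (d0 * y ^+ 4 + d1 * y ^+ 3 * z + d2 * y ^+ 2 * z ^+ 2 + d3 * y * z ^+ 3 + d4 * z ^+ 4)%:P) => s.
have -> : seg p (cmb p q r x y z) 1 s = cmb p q r (1 + x * s) (s * y) (s * z).
  by apply: pt_ext => /=; ring.
rewrite h3 h4 hc0 hb0 !(hornerE, horner_exp) /=.
have -> : b1 = - (t * c1) by apply/eqP; rewrite -addr_eq0 addrC e1.
have -> : b2 = - (t * c2) by apply/eqP; rewrite -addr_eq0 addrC e2.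
by ring.
Qed.

(** If the linear part (c1, c2) of F3 at p is nonzero, a change of basis makes it the second
    coordinate; the new third vector spans its kernel and so lies on the tangent. *)
Lemma smooth_or_nodal p : base_pt p ->
  order2 F3 p \/ exists q r, tangent_frame p q r.
Proof.
move=> bp; have [p0 z3 _] := bp; have [q [r det0]] := pt_basis p0.
have [c0 [c1 [c2 [c3 [c4 [c5 [c6 [c7 [c8 [c9 h3]]]]]]]]]] := frame_coef3 p q r.
have hc0 : c0 = 0 by have := h3 1 0 0; rewrite cmb_e1 z3 => ->; ring.
have [[e1 e2]|ne] : (c1 = 0 /\ c2 = 0) \/ (c1 != 0) || (c2 != 0).
- by have [->|] := eqVneq c1 0; have [->|] := eqVneq c2 0; auto.
- left=> Q; rewrite (cmb_basis Q det0); set x := _ / _; set y := _ / _; set z := _ / _.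
  pose X : {poly K} := 1 + x%:P * 'X.
  exists (X * (c3 * y ^+ 2 + c4 * y * z + c5 * z ^+ 2)%:P
     + 'X * (c6 * y ^+ 3 + c7 * y ^+ 2 * z + c8 * y * z ^+ 2 + c9 * z ^+ 3)%:P) => s.
  have -> : seg p (cmb p q r x y z) 1 s = cmb p q r (1 + x * s) (s * y) (s * z).
    by apply: pt_ext => /=; ring.
  by rewrite h3 hc0 e1 e2 !(hornerE, horner_exp) /=; ring.
have [u [v huv]] : exists u v, c1 * u + c2 * v = 1.
  have [c1z|c1nz] := eqVneq c1 0.
    by rewrite c1z eqxx /= in ne; exists 0, c2^-1; rewrite mulfV // mulr0 add0r.
  by exists c1^-1, 0; rewrite mulfV // mulr0 addr0.
right; exists (cmb p q r 0 u v), (cmb p q r 0 (- c2) c1); split.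
  apply: contraNneq det0; have -> : det3 p (cmb p q r 0 u v) (cmb p q r 0 (- c2) c1) =
    (c1 * u + c2 * v) * det3 p q r by rewrite /det3 /dot /=; ring.
  by rewrite huv mul1r => ->.
have e x y z : F3 (cmb p (cmb p q r 0 u v) (cmb p q r 0 (- c2) c1) x y z) =
   F3 (cmb p q r x (u * y - c2 * z) (v * y + c1 * z)).
  by congr F3; apply: pt_ext => /=; ring.
(* The coefficients after the substitution y -> u y - c2 z, z -> v y + c1 z. *)
exists (c3 * u ^+ 2 + c4 * u * v + c5 * v ^+ 2),
  (- 2%:R * c3 * u * c2 + c4 * (u * c1 - v * c2) + 2%:R * c5 * v * c1),
  (c3 * c2 ^+ 2 - c4 * c2 * c1 + c5 * c1 ^+ 2),
  (c6 * u ^+ 3 + c7 * u ^+ 2 * v + c8 * u * v ^+ 2 + c9 * v ^+ 3),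
  (- 3%:R * c6 * u ^+ 2 * c2 + c7 * (u ^+ 2 * c1 - 2%:R * u * c2 * v)
     + c8 * (2%:R * u * v * c1 - c2 * v ^+ 2) + 3%:R * c9 * v ^+ 2 * c1),
  (3%:R * c6 * u * c2 ^+ 2 + c7 * (c2 ^+ 2 * v - 2%:R * u * c2 * c1)
     + c8 * (u * c1 ^+ 2 - 2%:R * c2 * v * c1) + 3%:R * c9 * v * c1 ^+ 2),
  (- c6 * c2 ^+ 3 + c7 * c2 ^+ 2 * c1 - c8 * c2 * c1 ^+ 2 + c9 * c1 ^+ 3) => x y z.
rewrite e h3 hc0.
transitivity (x ^+ 2 * ((c1 * u + c2 * v) * y)
    + x * (c3 * (u * y - c2 * z) ^+ 2 + c4 * (u * y - c2 * z) * (v * y + c1 * z)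
           + c5 * (v * y + c1 * z) ^+ 2)
    + (c6 * (u * y - c2 * z) ^+ 3 + c7 * (u * y - c2 * z) ^+ 2 * (v * y + c1 * z)
       + c8 * (u * y - c2 * z) * (v * y + c1 * z) ^+ 2 + c9 * (v * y + c1 * z) ^+ 3)).
  by ring.
by rewrite huv; ring.
Qed.

End Monoid.

(** Points and lines are known up to a scalar, so [ps] and [ls] are complete lists of
    representatives. Their finiteness is itself an argument: a family of pairwise non-proportional
    base points or lifting lines indexed by almost all of [K] is contradictory. *)
Record monoid_config (K : fieldType) (F3 F4 : pt K -> K) (ps ls : seq (pt K)) : Prop := MonoidConfig {
  cubic_form : form 3 F3;
  cubic_neq0 : exists P, F3 P != 0;
  quartic_form : form 4 F4;
  transversal : forall p, base_pt F3 F4 p -> forall t, ~ order2 (fun P => t * F3 P + F4 P) p;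
  ps_uniq : uniq ps;
  ps_base : {in ps, forall p, base_pt F3 F4 p};
  ps_inj : {in ps &, forall p q, cross p q = null K -> p = q};
  ps_all : forall p, base_pt F3 F4 p -> exists2 q, q \in ps & cross p q = null K;
  ls_uniq : uniq ls;
  ls_lift : {in ls, forall l, lifts F3 F4 l};
  ls_inj : {in ls &, forall l m, cross l m = null K -> l = m};
  ls_all : forall l, lifts F3 F4 l -> exists2 m, m \in ls & cross l m = null K
}.

(** * The pencil of lines through a base point *)

Section Pencil.
Variable K : fieldType.
Let hE := (@hornerD K, @hornerN K, @hornerM K, @hornerC K, @hornerX K).

Hypothesis charK : [pchar K] =i pred0.
Local Notation pt := (pt K).
Implicit Types (p q r l m P Q X : pt) (x y z s t u v : K).
Variables F3 F4 : pt -> K.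
Variables ps ls : seq pt.
Hypothesis H : monoid_config F3 F4 ps ls.

(* With F3 = z^2 + A2 z + A3 on the line joining p to q + s r, the remainder of
   F4 modulo F3 is U z + V. *)
Lemma pencil p q r : base_pt F3 F4 p -> tangent_frame F3 p q r ->
  exists A2 A3 B1 B2 U V C : {poly K},
  [/\ forall z s, F3 (cmb p q r z 1 s) = z ^+ 2 + A2.[s] * z + A3.[s],
      forall z s, F4 (cmb p q r z 1 s) =
        (B1.[s] * z + B2.[s]) * (z ^+ 2 + A2.[s] * z + A3.[s]) + (U.[s] * z + V.[s]),
      [/\ size A2 <= 3, size A3 <= 4, size U <= 6 & size V <= 7]%N,
      [/\ C != 0, (size C <= 4)%N & forall x, F4 (cmb p q r x 0 1) = C.[x]] &
      (U = 0 /\ V = 0) \/ exists W : {poly K},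
        [/\ W != 0, (size W <= 6)%N & forall s, U.[s] = 0 -> V.[s] = 0 -> W.[s] = 0]]
  /\ forall l, lifts F3 F4 l -> dot l p = 0 -> dot l r != 0.
Proof.
move=> bp [det0 [c3 [c4 [c5 [c6 [c7 [c8 [c9 h3]]]]]]]].
have [b0 [b1 [b2 [b3 [b4 [b5 [b6 [b7 [b8 [b9 [d0 [d1 [d2 [d3 [d4 h4]]]]]]]]]]]]]]] :=
  frame_coef4 (quartic_form H) p q r.
have h3' x y z : F3 (cmb p q r x y z) = 0 * x ^+ 3 + x ^+ 2 * (1 * y + 0 * z)
    + x * (c3 * y ^+ 2 + c4 * y * z + c5 * z ^+ 2)
    + (c6 * y ^+ 3 + c7 * y ^+ 2 * z + c8 * y * z ^+ 2 + c9 * z ^+ 3).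
  by rewrite h3; ring.
have [_ hb0 tr] := frame_transversal (transversal H) det0 bp h3' h4.
(* Transversality with t = - b1: the tangent direction r of F3 is not tangent to F4. *)
have hb2 : b2 != 0.
  by apply/eqP => e; apply: (tr (- b1)); rewrite mulr1 mulr0 add0r addNr.
have sz1 (a b : K) : (size (a%:P + b%:P * 'X : {poly K})%R <= 2)%N.
  apply: size_add_le; first exact: leq_trans (size_polyC_leq1 _) _.
  by apply: (@size_mul_le _ _ _ 0 1); rewrite ?size_polyC_leq1 ?size_polyX.
have szS (a : K) (f : {poly K}) n : (size f <= n.+1)%N -> (size (a%:P + 'X * f : {poly K})%R <= n.+2)%N.
  move=> hf; apply: size_add_le; first exact: leq_trans (size_polyC_leq1 _) _.
  by apply: (@size_mul_le _ _ _ 1 n); rewrite ?size_polyX.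
pose A2 : {poly K} := c3%:P + 'X * (c4%:P + c5%:P * 'X).
pose A3 : {poly K} := c6%:P + 'X * (c7%:P + 'X * (c8%:P + c9%:P * 'X)).
pose B1 : {poly K} := b1%:P + b2%:P * 'X.
pose B2 : {poly K} := b3%:P + 'X * (b4%:P + b5%:P * 'X).
pose B3 : {poly K} := b6%:P + 'X * (b7%:P + 'X * (b8%:P + b9%:P * 'X)).
pose B4 : {poly K} := d0%:P + 'X * (d1%:P + 'X * (d2%:P + 'X * (d3%:P + d4%:P * 'X))).
have sA2 : (size A2 <= 3)%N by apply: szS; apply: sz1.
have sA3 : (size A3 <= 4)%N by do 2 apply/szS; apply/sz1.
have sB1 : (size B1 <= 2)%N by apply: sz1.
have sB2 : (size B2 <= 3)%N by apply: szS; apply: sz1.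
have sB3 : (size B3 <= 4)%N by do 2 apply/szS; apply/sz1.
have sB4 : (size B4 <= 5)%N by do 3 apply/szS; apply/sz1.
have sA22B1 : (size (A2 * A2 * B1)%R <= 6)%N.
  by apply: (@size_mul_le _ _ _ 4 1) => //; apply: (@size_mul_le _ _ _ 2 2).
(* Division of B1 z^3 + B2 z^2 + B3 z + B4 by z^2 + A2 z + A3, with quotient B1 z + (B2 - A2 B1). *)
pose U := B3 - A3 * B1 - A2 * B2 + A2 * A2 * B1.
pose V := B4 - A3 * B2 + A3 * A2 * B1.
have sU : (size U <= 6)%N.
  rewrite /U; apply: size_add_le => //; apply: size_add_le; first apply: size_add_le.
  - exact: leq_trans sB3 _.
  - by rewrite size_polyN; apply: leq_trans (@size_mul_le _ _ _ 3 1 sA3 sB1) _.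
  - by rewrite size_polyN; apply: leq_trans (@size_mul_le _ _ _ 2 2 sA2 sB2) _.
have sV' (m : nat) : (size A2 <= m.+1)%N -> (1 <= m)%N -> (size V <= (m + 5))%N.
  move=> hm m1; rewrite /V; apply: size_add_le; first apply: size_add_le.
  - by apply: leq_trans sB4 _; lia.
  - by rewrite size_polyN; apply: leq_trans (@size_mul_le _ _ _ 3 2 sA3 sB2) _; lia.
  - by apply: leq_trans (@size_mul_le _ _ _ (3 + m) 1 (size_mul_le sA3 hm) sB1) _; lia.
exists (A2), A3, B1, (B2 - A2 * B1), U, V, (d4%:P + 'X * (b9%:P + 'X * (b5%:P + b2%:P * 'X))).
split; [split|] => //.
- by move=> z s; rewrite h3 /A2 /A3 !hE; ring.
- by move=> z s; rewrite h4 hb0 /U /V /A2 /A3 /B1 /B2 /B3 /B4 !hE; ring.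
- by split=> //; apply: (sV' 2).
- split; last by move=> x; rewrite h4 hb0 !hE; ring.
    apply: contra_neq hb2 => /(congr1 (fun f : {poly K} => f`_3)).
    by rewrite coef0 !(coefD, coefXM, coefC, coefCM, coefX) /= => <-; ring.
  by do 2 apply/szS; apply/sz1.
(* W is U if U is nonzero, and V otherwise. In the second case the size of V must drop from 7 to 6:
   the coefficient of degree 5 of U is c5^2 b2, so U = 0 forces c5 = 0 and A2 loses its quadratic
   term. *)
- have [U0|Un0] := eqVneq U 0; last by right; exists U.
  have [V0|Vn0] := eqVneq V 0; first by left.
  right; exists V; split=> //.
  have c50 : c5 = 0.
    have c5E : A2`_2 = c5 by rewrite /A2 !(coefD, coefXM, coefC, coefCM, coefX) /=; ring.
    have b2E : B1`_1 = b2 by rewrite /B1 !(coefD, coefXM, coefC, coefCM, coefX) /=; ring.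
    have top : (A2 * A2 * B1)`_(4 + 1) = c5 * c5 * b2.
      rewrite (@coef_mul_top _ _ _ 4 1) //; last by apply: (@size_mul_le _ _ _ 2 2).
      by rewrite (@coef_mul_top _ _ _ 2 2 sA2 sA2) c5E b2E.
    have : U`_5 = 0 by rewrite U0 coef0.
    have n3 : B3`_5 = 0 by rewrite nth_default //; exact: leq_trans sB3 _.
    have n31 : (A3 * B1)`_5 = 0.
      by rewrite nth_default //; apply: leq_trans (@size_mul_le _ _ _ 3 1 sA3 sB1) _.
    have n22 : (A2 * B2)`_5 = 0.
      by rewrite nth_default //; apply: leq_trans (@size_mul_le _ _ _ 2 2 sA2 sB2) _.
    have cE (X Y Z T : {poly K}) i : (X - Y - Z + T)`_i = X`_i - Y`_i - Z`_i + T`_i.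
      by rewrite !coefD !coefN.
    rewrite /U cE top n3 n31 n22 !oppr0 !add0r => /eqP.
    by rewrite !mulf_eq0 (negbTE hb2) orbF orbb => /eqP.
  by apply: (sV' 1%N) => //; rewrite /A2 c50 mul0r addr0; apply: szS; apply: size_polyC_leq1.
(* The tangent to the cubic at p does not lift: on it, with z = 1, F4 has the term b2 x^3 while F3
   has degree at most 1 in x. *)
move=> l [l0 [a ha]] lp; apply/eqP => lr.
suff : b2 = 0 by move/eqP: hb2.
have e x : b2 * x ^+ 3 + (b5 - dot a p * c5) * x ^+ 2
   + (b9 - dot a p * c9 - dot a r * c5) * x + (d4 - dot a r * c9) = 0.
  have := ha (cmb p q r x 0 1); rewrite dot_cmb lp lr !mulr0 !mul0r !addr0 => /(_ erefl).
  rewrite h3 h4 hb0 dot_cmb => /eqP; rewrite -subr_eq0 => /eqP <-; ring.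
by have [] := cubic_all0 charK e.
Qed.

(** Uniqueness of division by a monic quadratic polynomial in z. Conversely the quotient B1 z + B2
    prescribes the values of the multiplier at p and at q + s r. *)
Lemma pencil_lift p q r A2 A3 B1 B2 U V : base_pt F3 F4 p -> det3 p q r != 0 ->
  (forall z s, F3 (cmb p q r z 1 s) = z ^+ 2 + A2.[s] * z + A3.[s]) ->
  (forall z s, F4 (cmb p q r z 1 s) =
        (B1.[s] * z + B2.[s]) * (z ^+ 2 + A2.[s] * z + A3.[s]) + (U.[s] * z + V.[s])) ->
  forall l s, l != null K -> dot l p = 0 -> dot l q + s * dot l r = 0 ->
  lifts F3 F4 l <-> U.[s] = 0 /\ V.[s] = 0.
Proof.
move=> [_ p3 p4] det0 h3 h4 l s l0 lp lqr; split.
  move=> [_ [a ha]].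
  have e z : (B1.[s] - dot a p) * z ^+ 3 +
      (B2.[s] - (dot a q + s * dot a r) + (B1.[s] - dot a p) * A2.[s]) * z ^+ 2 +
      (U.[s] + (B2.[s] - (dot a q + s * dot a r)) * A2.[s] + (B1.[s] - dot a p) * A3.[s]) * z +
      (V.[s] + (B2.[s] - (dot a q + s * dot a r)) * A3.[s]) = 0.
    have := ha (cmb p q r z 1 s).
    rewrite dot_cmb lp mulr0 add0r mul1r => /(_ lqr).
    by rewrite h4 h3 dot_cmb => /eqP; rewrite -subr_eq0 => /eqP <-; ring.
  have [/eqP e1 /eqP e2 /eqP e3 /eqP e4] := cubic_all0 charK e.
  move: e1; rewrite subr_eq0 => /eqP e1; rewrite e1 subrr !mul0r addr0 in e2 e3.
  by move: e3 e4; rewrite (eqP e2) !mul0r !addr0 => /eqP -> /eqP ->.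
move=> [U0 V0]; split=> //.
have [a [ap aq ar]] := dual_basis B1.[s] B2.[s] 0 det0.
exists a => P lP.
have q0 : cross p (cmb p q r 0 1 s) != null K.
  apply: contra_neq det0 => e.
  have -> : det3 p q r = dot (cross p (cmb p q r 0 1 s)) r.
    by rewrite /det3 /dot /=; ring.
  by rewrite e /dot /=; ring.
have lX : dot l (cmb p q r 0 1 s) = 0 by rewrite dot_cmb mul0r add0r mul1r.
have [k l_prop] := line_through q0 lp lX.
have k0 : k != 0 by case: (@scal_neq0 _ k (cross p (cmb p q r 0 1 s))); rewrite -?l_prop.
have [||u [v ->]] := @line_param _ p (cmb p q r 0 1 s) P => //.
  by move: lP; rewrite l_prop dotC dot_scal dotC => /eqP; rewrite mulf_eq0 (negbTE k0) => /eqP.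
have eP : seg p (cmb p q r 0 1 s) u v = cmb p q r u v (v * s) by apply: pt_ext => /=; ring.
have form_eq (G : pt -> K) d : form d G -> v != 0 ->
    G (cmb p q r u v (v * s)) = v ^+ d * G (cmb p q r (u / v) 1 s).
  move=> hG v0; rewrite -(form_scal _ _ hG); congr G; apply: pt_ext => /=; field; exact: v0.
have [v0|v0] := eqVneq v 0.
  have -> : seg p (cmb p q r 0 1 s) u v = scal u p by rewrite v0; apply: pt_ext => /=; ring.
  by rewrite (form_scal _ _ (quartic_form H)) (form_scal _ _ (cubic_form H)) p3 p4 !mulr0.
rewrite eP (form_eq _ _ (quartic_form H)) // (form_eq _ _ (cubic_form H)) // h4 h3 U0 V0.
by rewrite dot_cmb ap aq ar; field.
Qed.

End Pencil.

(** * Bounds at a base point where the cubic is smooth *)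

Section Bounds.
Variable K : fieldType.
Hypothesis charK : [pchar K] =i pred0.
Local Notation pt := (pt K).
Implicit Types (p q r l m P Q X : pt) (x y z s t u v : K).
Variables F3 F4 : pt -> K.
Variables ps ls : seq pt.
Hypothesis H : monoid_config F3 F4 ps ls.

Lemma cross_frame p q r u v : det3 p q r != 0 -> (u != 0) || (v != 0) ->
  cross p (cmb p q r 0 u v) != null K.
Proof.
move=> det0; apply: contraL => /eqP e.
have /eqP : u * det3 p q r = 0.
  have -> : u * det3 p q r = dot (cross p (cmb p q r 0 u v)) r by rewrite /det3 /dot /=; ring.
  by rewrite e /dot /=; ring.
have /eqP : v * det3 p q r = 0.
  have -> : v * det3 p q r = - dot (cross p (cmb p q r 0 u v)) q by rewrite /det3 /dot /=; ring.
  by rewrite e /dot /=; ring.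
by rewrite !mulf_eq0 (negbTE det0) !orbF => -> ->.
Qed.

(** The slopes - [dot l q] / [dot l r] of the lines of [ls] are finitely many, and a line of the
    pencil with another slope is proportional to none of them. *)
Lemma lines_finite p q r : det3 p q r != 0 ->
  ~ (forall s, lifts F3 F4 (cross p (cmb p q r 0 1 s))).
Proof.
move=> det0 h.
have [s /negP[]] := poly_avoid charK [seq - dot l q / dot l r | l <- ls] (oner_neq0 {poly K}).
have [l0 _] := h s; set l := cross _ _ in l0.
have lp : dot l p = 0 by apply: dot_crossl.
have lX : dot l (cmb p q r 0 1 s) = 0 by apply: dot_crossr.
rewrite dot_cmb mul0r add0r mul1r in lX.
have lr : dot l r != 0.
  by have -> : dot l r = det3 p q r by rewrite /l /det3 /dot /=; ring.
have [m mls e] := ls_all H (h s).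
have [k mE] := cross_null l0 e; have [m0 _] := ls_lift H mls.
have k0 : k != 0 by case: (@scal_neq0 _ k l); rewrite -?mE.
apply/mapP; exists m => //.
have mr : dot m r != 0 by rewrite mE dotC dot_scal dotC mulf_neq0.
have : dot m q + s * dot m r = 0.
  by rewrite mE !(dotC (scal k l)) !dot_scal !(dotC _ l) mulrCA -mulrDr lX mulr0.
by move=> /eqP; rewrite addr_eq0 => /eqP ->; rewrite opprK mulfK.
Qed.

Lemma pencil_not0 p q r A2 A3 B1 B2 U V : base_pt F3 F4 p -> det3 p q r != 0 ->
  (forall z s, F3 (cmb p q r z 1 s) = z ^+ 2 + A2.[s] * z + A3.[s]) ->
  (forall z s, F4 (cmb p q r z 1 s) =
        (B1.[s] * z + B2.[s]) * (z ^+ 2 + A2.[s] * z + A3.[s]) + (U.[s] * z + V.[s])) ->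
  ~ (U = 0 /\ V = 0).
Proof.
move=> bp det0 h3 h4 [U0 V0]; apply: (lines_finite det0) => s.
apply/(pencil_lift charK H bp det0 h3 h4 (s := s)); rewrite ?U0 ?V0 ?horner0 //.
- by apply: cross_frame; rewrite ?oner_eq0.
- exact: dot_crossl.
- by rewrite /dot /=; ring.
Qed.

(** As the tangent does not lift, every lifting line through p has a finite slope. Distinct lines
    have distinct slopes, and these are roots of W, of degree at most 5. *)
Lemma pencil_le5 p q r : base_pt F3 F4 p -> tangent_frame F3 p q r ->
  (count (fun l => dot l p == 0%R) ls <= 5)%N.
Proof.
move=> bp fr.
have [A2 [A3 [B1 [B2 [U [V [C [[h3 h4 [_ _ sU sV] _ UV] nr]]]]]]]] := pencil charK H bp fr.
have [det0 _] := fr; have lP := pencil_lift charK H bp det0 h3 h4.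
rewrite -size_filter; set ls' := filter _ _.
have in_ls' l : l \in ls' -> [/\ l \in ls, lifts F3 F4 l, dot l p = 0 & dot l r != 0].
  rewrite mem_filter => /andP[/eqP lp lin]; have hl := ls_lift H lin.
  by split=> //; exact: nr.
pose f l := - dot l q / dot l r.
have fE l : dot l r != 0 -> dot l q + f l * dot l r = 0.
  by move=> h; rewrite /f divfK // subrr.
have inj : {in ls' &, injective f}.
  move=> l m hl hm e; have [l1 l2 l3 l4] := in_ls' _ hl; have [m1 m2 m3 m4] := in_ls' _ hm.
  apply: (ls_inj H) => //.
  apply: (@cross_lines _ p (cmb p q r 0 1 (f l))) => //.
  - by apply: cross_frame; rewrite ?oner_eq0.
  - by rewrite dot_cmb mul0r add0r mul1r fE.
  - by rewrite dot_cmb mul0r add0r mul1r e fE.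
have roots l : l \in ls' -> U.[f l] = 0 /\ V.[f l] = 0.
  by move=> /in_ls' [_ hl lp lr]; apply/(lP l) => //; [case: hl | exact: fE].
case: UV => [/(pencil_not0 bp det0 h3 h4)|[W [W0 sW hW]]] //.
rewrite -ltnS; apply: leq_trans sW; apply: (size_lt_roots W0 _ inj).
  exact: filter_uniq (ls_uniq H).
by move=> l /roots[h1 h2]; exact: hW.
Qed.

(** 22 = 4 + 18. The tangent at p carries p and at most three zeros of C. Off it, the slope of a
    base point is a root of the norm N, of degree at most 13; a slope carries at most one base
    point, or two if it is one of the at most five common roots of U and V. So coarse a bound is
    enough, being confronted with at least 25 base points. *)
Lemma base_le22 p q r : base_pt F3 F4 p -> tangent_frame F3 p q r -> (size ps <= 22)%N.
Proof.
move=> bp fr.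
have [A2 [A3 [B1 [B2 [U [V [C [[h3 h4 [sA2 sA3 sU sV] [C0 sC hC] UV] nr]]]]]]]] := pencil charK H bp fr.
have [det0 _] := fr; have [p0 p3 p4] := bp.
pose cx P := det3 P q r / det3 p q r.
pose cy P := det3 p P r / det3 p q r.
pose cz P := det3 p q P / det3 p q r.
have cE P : P = cmb p q r (cx P) (cy P) (cz P) by exact: cmb_basis.
have sc k P : cmb p q r (k * cx P) (k * cy P) (k * cz P) = scal k P.
  by rewrite [in RHS](cE P); apply: pt_ext => /=; ring.
have inj2 P Q : P \in ps -> Q \in ps -> (exists k, Q = scal k P) -> P = Q.
  move=> hP hQ [k e]; apply: (ps_inj H) => //; rewrite e.
  by apply: pt_ext => /=; ring.
have base P : P \in ps -> base_pt F3 F4 P by exact: (ps_base H).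
pose on := [seq P <- ps | cy P == 0]; pose off := [seq P <- ps | cy P != 0].
have -> : size ps = (size on + size off)%N by rewrite !size_filter -(count_predC (fun P => cy P == 0) ps).
have son : (size on <= 4)%N.
  pose on' := [seq P <- on | cz P != 0].
  have : (size on' <= 3)%N.
    rewrite -ltnS; apply: leq_trans sC; apply: (@size_lt_roots _ _ (fun P => cx P / cz P)) => //.
    - by rewrite !filter_uniq // (ps_uniq H).
    - move=> P Q; rewrite !mem_filter => /and3P[Pz /eqP Py Pin] /and3P[Qz /eqP Qy Qin] e.
      apply: inj2 => //; exists (cz Q / cz P); rewrite -sc [LHS]cE Py Qy mulr0 mulfVK //.
      by congr cmb; rewrite mulrAC -mulrA e mulrC divfK.
    - move=> P; rewrite !mem_filter => /and3P[Pz /eqP Py /base[_ _]].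
      rewrite -hC => F4P.
      have -> : cmb p q r (cx P / cz P) 0 1 = scal (cz P)^-1 P.
        by rewrite -sc Py mulr0 mulVf // mulrC.
      by rewrite (form_scal _ _ (quartic_form H)) F4P mulr0.
  have -> : size on = (size on' + size [seq P <- on | cz P == 0%R])%N.
    rewrite -(count_predC (fun P => cz P != 0%R) on) -!size_filter.
    by congr (_ + size _)%N; apply: eq_filter => P /=; rewrite negbK.
  suff : (size [seq P <- on | cz P == 0%R] <= 1)%N by lia.
  have : uniq [seq P <- on | cz P == 0] by rewrite !filter_uniq // (ps_uniq H).
  case e : [seq P <- on | cz P == 0] => [|P [|Q s]] //=.
  have : Q \in [seq P <- on | cz P == 0] by rewrite e !inE eqxx orbT.
  have : P \in [seq P <- on | cz P == 0] by rewrite e !inE eqxx.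
  rewrite !mem_filter => /and3P[/eqP Pz /eqP Py Pin] /and3P[/eqP Qz /eqP Qy Qin].
  suff -> : P = Q by rewrite !inE eqxx.
  have tE X : cy X = 0 -> cz X = 0 -> X = scal (cx X) p.
    by move=> e1 e2; rewrite {1}(cE X) e1 e2; apply: pt_ext => /=; ring.
  by apply: (ps_inj H) => //; rewrite (tE P) // (tE Q) // cross_scal.
suff : (size off <= 18)%N by lia.
pose f P := cz P / cy P; pose g P := cx P / cy P.
have nE P : P \in off -> [/\ F3 (cmb p q r (g P) 1 (f P)) = 0 & F4 (cmb p q r (g P) 1 (f P)) = 0].
  rewrite mem_filter => /andP[Py /base[_ P3 P4]].
  have -> : cmb p q r (g P) 1 (f P) = scal (cy P)^-1 P.
    by rewrite -sc mulVf // /f /g ![_ / cy P]mulrC.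
  by rewrite (form_scal _ _ (quartic_form H)) (form_scal _ _ (cubic_form H)) P3 P4 !mulr0.
have quad P : P \in off -> (g P) ^+ 2 + A2.[f P] * g P + A3.[f P] = 0.
  by move=> /nE[e _]; rewrite -h3.
have lin P : P \in off -> U.[f P] * g P + V.[f P] = 0.
  by move=> hP; have [_] := nE _ hP; rewrite h4 quad // mulr0 add0r.
have inj P Q : P \in off -> Q \in off -> f P = f Q -> g P = g Q -> P = Q.
  rewrite !mem_filter => /andP[Py Pin] /andP[Qy Qin] ef eg.
  apply: inj2 => //; exists (cy Q / cy P); rewrite -sc [LHS]cE divfK //.
  by congr cmb; rewrite mulrAC -mulrA ?ef ?eg; [rewrite -/(g P) eg | rewrite -/(f P) ef];
     rewrite mulrC /f /g divfK.
pose N := V ^+ 2 - A2 * (U * V) + A3 * (U * U).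
have sN : (size N <= 14)%N.
  rewrite /N; apply: size_add_le; first apply: size_add_le.
  - by rewrite expr2; apply: leq_trans (@size_mul_le _ _ _ 6 6 sV sV) _.
  - by rewrite size_polyN; apply: (@size_mul_le _ _ _ 2 11) => //; apply: (@size_mul_le _ _ _ 5 6).
  - by apply: (@size_mul_le _ _ _ 3 10) => //; apply: (@size_mul_le _ _ _ 5 5).
have rootN P : P \in off -> N.[f P] = 0.
  move=> hP; rewrite /N !hornerE /=; have := quad _ hP.
  have -> : V.[f P] = - (U.[f P] * g P) by apply/eqP; rewrite -addr_eq0 addrC lin.
  move=> e; transitivity (U.[f P] ^+ 2 * ((g P) ^+ 2 + A2.[f P] * g P + A3.[f P])); first ring.
  by rewrite e mulr0.
have [W [W0 sW hW]] : exists W : {poly K},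
    [/\ W != 0, (size W <= 6)%N & forall s, U.[s] = 0 -> V.[s] = 0 -> W.[s] = 0].
  by case: UV => // /(pencil_not0 bp det0 h3 h4).
(* If N vanished identically, z = - V / U would give a base point on almost every line of the
   pencil. *)
have [N0|Nn0] := eqVneq N 0.
  have [U0|Un0] := eqVneq U 0.
    move: N0; rewrite /N U0 mul0r !mulr0 subr0 addr0 => /eqP.
    by rewrite expf_eq0 /= => /eqP V0; case: (pencil_not0 bp det0 h3 h4).
  have [s sn Us] := poly_avoid charK [seq cz P / cy P | P <- ps] Un0; case/negP: sn.
  set X := cmb p q r (- V.[s] / U.[s]) 1 s.
  have eX : F3 X = 0.
    rewrite h3; apply: (mulIf (expf_neq0 2 Us)); rewrite mul0r.
    have : N.[s] = 0 by rewrite N0 horner0.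
    by rewrite /N !hornerE /= => <-; field.
  have X0 : cross p X != null K.
    have -> : cross p X = cross p (cmb p q r 0 1 s) by apply: pt_ext => /=; ring.
    by apply: cross_frame; rewrite ?oner_eq0.
  have bX : base_pt F3 F4 X.
    split=> //; first by apply: contra_neq X0 => ->; apply: pt_ext => /=; ring.
    by move: eX; rewrite h3 h4 => ->; rewrite mulr0 add0r; field.
  have [Q Qin e] := ps_all H bX; have [Xn0 _ _] := bX.
  have [k Qk] := cross_null Xn0 e; have [Q0 _ _] := base _ Qin.
  have k0 : k != 0 by case: (@scal_neq0 _ k X); rewrite -?Qk.
  apply/mapP; exists Q => //.
  have -> : cy Q = k.
    by apply: (mulIf det0); rewrite /cy divfK // Qk /X /det3 /dot /=; ring.
  have -> : cz Q = k * s.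
    by apply: (mulIf det0); rewrite /cz divfK // Qk /X /det3 /dot /=; ring.
  by rewrite mulrAC mulfV // mul1r.
pose dbl P := (U.[f P] == 0) && (V.[f P] == 0).
pose D := undup (map f (filter dbl off)); pose E := map f (filter (predC dbl) off).
have subE (T : eqType) (a : pred T) (xs : seq T) : {subset filter a xs <= xs}.
  by move=> x; rewrite mem_filter => /andP[].
have inF a P : P \in filter a off -> a P /\ P \in off.
  by rewrite mem_filter => /andP[].
have uE : uniq E.
  rewrite map_inj_in_uniq ?filter_uniq // ?(ps_uniq H) // => P Q.
  move=> /inF[/= Pd Pin] /inF[_ Qin] e; apply: inj => //.
  have [u0|un0] := eqVneq U.[f P] 0.
    by move: Pd; rewrite /dbl u0 eqxx /= => /eqP[]; have := lin _ Pin; rewrite u0 mul0r add0r.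
  apply: (mulfI un0); apply: (addIr V.[f P]); rewrite lin // {2}e.
  by rewrite e lin.
have sDE : (size D + size E <= 13)%N.
  rewrite -size_cat -ltnS; apply: leq_trans sN; apply: max_poly_roots => //.
    by rewrite all_cat; apply/andP; split; apply/allP => x;
       rewrite ?mem_undup => /mapP[P /subE hP ->]; apply/eqP/rootN.
  rewrite cat_uniq undup_uniq uE andbT /=; apply/hasPn => _ /mapP[P hP ->].
  apply/negP; rewrite mem_undup => /mapP[Q].
  case/inF: hP => /= nd _ /inF[d _] e.
  by move: nd; rewrite /dbl e -/(dbl Q) d.
have sD : (size D <= 5)%N.
  rewrite -ltnS; apply: leq_trans sW; apply: max_poly_roots => //; last exact: undup_uniq.
  apply/allP => x; rewrite mem_undup => /mapP[P /inF[/andP[/eqP d1 /eqP d2] _] ->].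
  by apply/eqP/hW.
have s2 : (size (filter dbl off) <= 2 * size D)%N.
  apply: (@size_le_fibres _ _ f).
    by move=> P hP; rewrite mem_undup; apply: map_f.
  move=> s _; rewrite -size_filter -ltnS.
  pose R : {poly K} := A3.[s]%:P + 'X * (A2.[s]%:P + 'X).
  have sR : (size R <= 3)%N.
    apply: size_add_le; first exact: leq_trans (size_polyC_leq1 _) _.
    apply: (@size_mul_le _ _ _ 1 1); rewrite ?size_polyX //.
    by apply: size_add_le; rewrite ?size_polyX // (leq_trans (size_polyC_leq1 _)).
  have R0 : R != 0.
    apply/eqP => /(congr1 (fun h : {poly K} => h`_2)).
    rewrite coef0 !(coefD, coefXM, coefC, coefX) /= !add0r => /eqP.
    by rewrite oner_eq0.
  apply: leq_trans sR; apply: (@size_lt_roots _ _ g) => //.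
  - by rewrite !filter_uniq // (ps_uniq H).
  - move=> P Q; rewrite mem_filter => /andP[/eqP eP /inF[_ hP]].
    by rewrite mem_filter => /andP[/eqP eQ /inF[_ hQ]] e; apply: inj; rewrite ?eP ?eQ.
  - move=> P; rewrite mem_filter => /andP[/eqP eP /inF[_ hP]].
    by rewrite /R !hornerE -(quad _ hP) eP; ring.
have -> : size off = (size (filter dbl off) + size E)%N.
  by rewrite size_map -(count_predC dbl off) -!size_filter.
by lia.
Qed.

End Bounds.

(** * Lifting lines *)

Section Lines.
Variable K : fieldType.
Hypothesis charK : [pchar K] =i pred0.
Local Notation pt := (pt K).
Implicit Types (p q r l m n P Q X : pt) (x y z s t u v : K).

Lemma dot_segl a l u v P : dot (seg a l u v) P = u * dot a P + v * dot l P.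
Proof. by rewrite dotC dot_seg !(dotC P). Qed.

Lemma line_complete l X : l != null K -> X != null K -> dot l X = 0 ->
  exists2 Q, cross X Q != null K & dot l Q = 0.
Proof.
move=> l0 X0 lX; have [b [c [k k0 e]]] := line_basis l0.
have lb : dot l b = 0.
  by apply: (mulfI k0); rewrite mulr0 dotC -dot_scal -e dotC dot_crossl.
have lc : dot l c = 0.
  by apply: (mulfI k0); rewrite mulr0 dotC -dot_scal -e dotC dot_crossr.
have [eb|] := eqVneq (cross X b) (null K); last by exists b.
have [ec|] := eqVneq (cross X c) (null K); last by exists c.
have [kb hb] := cross_null X0 eb; have [kc hc] := cross_null X0 ec.
move: l0; rewrite -(scal_eq0 _ k0) -e hb hc cross_scal => /eqP; by [].
Qed.

Lemma on_line l X Q P : cross X Q != null K -> dot l X = 0 -> dot l Q = 0 -> l != null K ->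
  dot l P = 0 -> exists u v, P = seg X Q u v.
Proof.
move=> h lX lQ l0 lP; have [k lE] := line_through h lX lQ.
have k0 : k != 0 by case: (@scal_neq0 _ k (cross X Q)); rewrite -?lE.
apply: line_param => //; move: lP; rewrite lE dotC dot_scal dotC => /eqP.
by rewrite mulf_eq0 (negbTE k0) => /eqP.
Qed.

Lemma meet_neq0 l m Q : cross l m != null K -> dot l Q = 0 -> cross (cross l m) Q != null K ->
  dot m Q != 0.
Proof.
move=> h lQ; apply: contra_neq => mQ.
have [k ->] := line_through h (etrans (dotC _ _) lQ) (etrans (dotC _ _) mQ).
by apply: pt_ext => /=; ring.
Qed.

(** On a line, a nonzero linear form is determined up to a factor by its zero. *)
Lemma prop_on_line l m b : cross l m != null K -> dot b (cross l m) = 0 ->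
  exists k, forall P, dot l P = 0 -> dot b P = k * dot m P.
Proof.
move=> h bX.
have l0 : l != null K by apply: contra_neq h => ->; apply: pt_ext => /=; ring.
have lX : dot l (cross l m) = 0 by rewrite dotC dot_crossl.
have mX : dot m (cross l m) = 0 by rewrite dotC dot_crossr.
have [Q hQ lQ] := line_complete l0 h lX.
have mQ := meet_neq0 h lQ hQ.
exists (dot b Q / dot m Q) => P lP; have [u [v ->]] := on_line hQ lX lQ l0 lP.
by rewrite !dot_seg bX mX; field.
Qed.

(** With X the common point of l and m and Q another point of l, the form m is constant and nonzero
    along Q + s X; density reaches X itself. *)
Lemma line_cancel d G l m : form d G -> cross l m != null K ->
  (forall P, dot l P = 0 -> dot m P * G P = 0) -> forall P, dot l P = 0 -> G P = 0.
Proof.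
move=> hG h e P lP.
have l0 : l != null K by apply: contra_neq h => ->; apply: pt_ext => /=; ring.
have lX : dot l (cross l m) = 0 by rewrite dotC dot_crossl.
have mX : dot m (cross l m) = 0 by rewrite dotC dot_crossr.
have [Q hQ lQ] := line_complete l0 h lX.
have mQ := meet_neq0 h lQ hQ.
have hQ' : cross Q (cross l m) != null K by rewrite crossC_eq0.
have [u [v ->]] := on_line hQ' lQ lX l0 lP.
apply: (line_dense charK (xs := [::]) hG) => s _.
apply: (mulfI mQ); rewrite mulr0 -[RHS](e (seg Q (cross l m) 1 s)) dot_seg ?lQ ?lX ?mX.
  by rewrite mul1r mulr0 addr0.
by rewrite !mulr0 addr0.
Qed.

Lemma line_nonzero d G l : form d G -> l != null K -> ~ (forall P, dot l P = 0 -> G P = 0) ->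
  exists2 P, dot l P = 0 & G P != 0.
Proof.
move=> hG l0 nz; have [b [c [k k0 e]]] := line_basis l0.
have [r _ hr] := form_poly b c hG.
have [r0|rn0] := eqVneq r 0.
  case: nz => P; apply: (line_dense_on charK (xs := [::]) l0 hG k0 e) => s _.
  by rewrite hr r0 horner0.
have [s _ hs] := poly_avoid charK [::] rn0.
exists (seg b c 1 s); last by rewrite hr.
by apply: (mulfI k0); rewrite mulr0 dotC -dot_scal -e dotC dot_seg dot_crossl dot_crossr; ring.
Qed.

(** The point P0, where G is nonzero, is put at infinity, so that the affine parameter sees all
    zeros. *)
Lemma line_zeros d G l (xs : seq pt) P0 : form d.+1 G -> l != null K ->
  dot l P0 = 0 -> G P0 != 0 ->
  uniq xs -> {in xs, forall p, [/\ p != null K, dot l p = 0 & G p = 0]} ->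
  {in xs &, forall p q, cross p q = null K -> p = q} -> (size xs <= d.+1)%N.
Proof.
move=> hG l0 lP0 GP0 u hx inj.
have P00 : P0 != null K by apply: contraNneq GP0 => ->; apply/eqP/(form_null hG).
have [c hc' lc] := line_complete l0 P00 lP0.
have hc : cross c P0 != null K by rewrite crossC_eq0.
have [r sr hr] := form_poly c P0 hG.
have r0 : r != 0.
  apply: contraNneq GP0 => e.
  have -> : P0 = seg c P0 0 1 by apply: pt_ext => /=; ring.
  by apply/eqP/(line_dense charK (xs := [::]) hG) => s _; rewrite hr e horner0.
have [a ha] := null_dot hc.
have det0 : det3 c P0 a != 0 by rewrite -dot_cross.
have [phi [p1 p2 _]] := dual_basis 1 0 0 det0.
have [psi [q1 q2 _]] := dual_basis 0 1 0 det0.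
have main p : p \in xs -> dot phi p != 0 /\ p = scal (dot phi p) (seg c P0 1 (dot psi p / dot phi p)).
  move=> /hx[p0 lp Gp]; have [x [y e]] := on_line hc lc lP0 l0 lp.
  have ex : dot phi p = x by rewrite e dot_seg p1 p2; ring.
  have ey : dot psi p = y by rewrite e dot_seg q1 q2; ring.
  rewrite ex ey; have x0 : x != 0.
    apply: contraNneq GP0 => x0; have e' : p = scal y P0 by rewrite e x0; apply: pt_ext => /=; ring.
    have [y0 _] : y != 0 /\ P0 != null K by apply: scal_neq0; rewrite -e'.
    by move: Gp; rewrite e' (form_scal _ _ hG) => /eqP; rewrite mulf_eq0 expf_eq0 (negbTE y0).
  by split=> //; rewrite scal_seg mulr1 mulrCA mulfV // mulr1.
rewrite -ltnS; apply: leq_trans sr.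
apply: (@size_lt_roots _ _ (fun p => dot psi p / dot phi p)) => //.
  move=> p q hp hq /= e; apply: inj => //; have [_ ->] := main p hp; have [_ ->] := main q hq.
  by rewrite e cross_scal.
move=> p hp; have [k0 e] := main p hp; have [_ _] := hx p hp; rewrite {1}e (form_scal _ _ hG) hr.
by move=> /eqP; rewrite mulf_eq0 expf_eq0 (negbTE k0) /= => /eqP.
Qed.

Variables F3 F4 : pt -> K.
Variables ps ls : seq pt.
Hypothesis H : monoid_config F3 F4 ps ls.

Lemma line_avoid (s : seq pt) l : l != null K -> exists X,
  [/\ X != null K, dot l X = 0 & {in s, forall Q, Q != null K -> cross X Q != null K}].
Proof.
move=> l0; have [b [c [k k0 e]]] := line_basis l0.
have [a ha] : exists a, dot (cross b c) a != 0 by apply: null_dot; rewrite e scal_eq0.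
have det0 : det3 b c a != 0 by rewrite -dot_cross.
have [phi [p1 p2 _]] := dual_basis 1 0 0 det0.
have [psi [q1 q2 _]] := dual_basis 0 1 0 det0.
have [t /negP ht _] := poly_avoid charK [seq dot psi p / dot phi p | p <- s] (oner_neq0 {poly K}).
pose X := seg b c 1 t.
have eX : dot phi X = 1 by rewrite dot_seg p1 p2; ring.
have X0 : X != null K.
  by apply: contra_eq_neq eX => ->; rewrite eq_sym; apply: contra_neq (oner_neq0 K) => ->; rewrite /dot /=; ring.
exists X; split=> // [|Q Qin Q0].
  by apply: (mulfI k0); rewrite mulr0 dotC -dot_scal -e dotC dot_seg dot_crossl dot_crossr; ring.
apply/eqP => eQ; have [u uQ] := cross_null X0 eQ.
have u0 : u != 0 by case: (@scal_neq0 _ u X); rewrite -?uQ.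
apply: ht; apply/mapP; exists Q => //; rewrite uQ !dot_scal eX dot_seg q1 q2; field; exact: u0.
Qed.

Lemma base_finite l : l != null K -> ~ (forall P, dot l P = 0 -> F3 P = 0 /\ F4 P = 0).
Proof.
move=> l0 h; have [X [X0 lX avoid]] := line_avoid ps l0.
have [|Q Qin eQ] := ps_all H (_ : base_pt F3 F4 X); first by have [] := h _ lX.
by have [Q0 _ _] := ps_base H Qin; have := avoid Q Qin Q0; rewrite eQ eqxx.
Qed.

(** A lifting line inside the cubic would consist of base points. *)
Lemma lift_cubic_neq0 l : lifts F3 F4 l -> exists2 P, dot l P = 0 & F3 P != 0.
Proof.
move=> [l0 [a ha]]; apply: (line_nonzero (cubic_form H)) => // z3.
by apply: (base_finite l0) => P lP; rewrite ha // z3 // mulr0.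
Qed.

Lemma base_on_line_le3 l P : l != null K -> dot l P = 0 -> F3 P != 0 ->
  (count (fun p => dot l p == 0%R) ps <= 3)%N.
Proof.
move=> l0 lP hP; rewrite -size_filter.
apply: (line_zeros (cubic_form H) l0 lP hP).
- exact: filter_uniq (ps_uniq H).
- by move=> p; rewrite mem_filter => /andP[/eqP lp /(ps_base H)[p0 p3 _]].
- move=> p q; rewrite !mem_filter => /andP[_ hp] /andP[_ hq]; exact: (ps_inj H).
Qed.

(** Together with [base_meet], this makes [F3 (cross l m) != 0] the condition for two distinct
    lifting lines to share no base point. *)
Lemma meet_base l m : lifts F3 F4 l -> lifts F3 F4 m -> cross l m != null K ->
  F3 (cross l m) = 0 -> exists2 p, p \in ps & dot l p = 0 /\ dot m p = 0.
Proof.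
move=> [l0 [a ha]] _ X0 X3.
have X4 : F4 (cross l m) = 0 by rewrite ha ?X3 ?mulr0 // dotC dot_crossl.
have [//|p pin e] := ps_all H (_ : base_pt F3 F4 (cross l m)).
have [k pE] := cross_null X0 e; exists p => //.
by rewrite pE !dot_scal !(dotC _ (cross l m)) dot_crossl dot_crossr mulr0.
Qed.

Lemma base_meet l m p : p \in ps -> dot l p = 0 -> dot m p = 0 -> F3 (cross l m) = 0.
Proof.
move=> pin lp mp; have [p0 p3 _] := ps_base H pin.
have e : cross p (cross l m) = null K.
  have -> : cross p (cross l m) = seg l m (dot m p) (- dot l p).
    by apply: pt_ext; rewrite /dot /=; ring.
  by rewrite lp mp oppr0; apply: pt_ext => /=; ring.
by have [k ->] := cross_null p0 e; rewrite (form_scal _ _ (cubic_form H)) p3 mulr0.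
Qed.

Lemma disjoint_neq0 l m : F3 (cross l m) != 0 -> cross l m != null K.
Proof. by apply: contraNneq => ->; apply/eqP/(form_null (cubic_form H)). Qed.

(** Write F4 = a1 F3 + l1 G. At the common point of l1 and l2 the cubic is nonzero, so the
    multipliers of both lines agree there and differ on l2 by k l1. Cancelling l1 gives G = k F3 on
    l2. *)
Lemma residual_conic l1 l2 : lifts F3 F4 l1 -> lifts F3 F4 l2 -> F3 (cross l1 l2) != 0 ->
  exists a (q : pt -> K), form 2 q /\ forall P, F4 P = dot a P * F3 P + dot l1 P * dot l2 P * q P.
Proof.
move=> [l10 [a1 h1]] [l20 [a2 h2]] dis; have X0 := disjoint_neq0 dis.
have X0' : cross l2 l1 != null K by rewrite crossC_eq0.
have f3 := cubic_form H; have f4 := quartic_form H.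
have [P lP|G fG eG] := form_div (form_sub f4 (form_dot a1 f3)) l10.
  by rewrite h1 // subrr.
have eb : dot (seg a2 a1 1 (-1)) (cross l2 l1) = 0.
  apply: (mulIf dis); rewrite mul0r dot_segl.
  have e1 : dot l1 (cross l2 l1) = 0 by rewrite dotC dot_crossr.
  have e2 : dot l2 (cross l2 l1) = 0 by rewrite dotC dot_crossl.
  have := h2 _ e2; have := eG (cross l2 l1); rewrite e1 mul0r => /eqP.
  rewrite subr_eq0 => /eqP -> /eqP; rewrite -subr_eq0 => /eqP e.
  have e3 : F3 (cross l2 l1) = - F3 (cross l1 l2) by rewrite crossC (form_scal _ _ f3); ring.
  by move: e; rewrite e3 => e; rewrite -e; ring.
have [k hk] := prop_on_line X0' eb.
have fG' : form 3 (fun P => G P - k * F3 P) := form_sub fG (form_scale k f3).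
have [P lP|q fq eq] := form_div fG' l20.
  apply: (line_cancel fG' X0' _ lP) => R lR.
  have := hk R lR; rewrite dot_segl => e; have := eG R; rewrite h2 // => e'.
  transitivity (dot l1 R * G R - (k * dot l1 R) * F3 R); first ring.
  by rewrite -e -e'; ring.
exists (seg a1 l1 1 k), q; split=> // P.
have := eG P; have := eq P; rewrite dot_segl => e e'.
have -> : F4 P = dot a1 P * F3 P + dot l1 P * G P by rewrite -e'; ring.
have -> : G P = k * F3 P + dot l2 P * q P by rewrite -e; ring.
by ring.
Qed.

(** The same comparison on l3 gives k F3 = l2 q there. At the common point of l2 and l3 this forces
    k = 0, so q vanishes on l3 and leaves a linear factor. *)
Lemma residual_line l1 l2 l3 : lifts F3 F4 l1 -> lifts F3 F4 l2 -> lifts F3 F4 l3 ->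
  F3 (cross l1 l2) != 0 -> F3 (cross l1 l3) != 0 -> F3 (cross l2 l3) != 0 ->
  exists a n, forall P, F4 P = dot a P * F3 P + dot l1 P * dot l2 P * dot l3 P * dot n P.
Proof.
move=> L1 L2 [l30 [a3 h3]] d12 d13 d23.
have f3 := cubic_form H.
have [a [q [fq eF]]] := residual_conic L1 L2 d12.
have X13 : cross l3 l1 != null K by rewrite crossC_eq0 disjoint_neq0.
have X23 : cross l3 l2 != null K by rewrite crossC_eq0 disjoint_neq0.
have n13 : F3 (cross l3 l1) != 0 by rewrite crossC (form_scal _ _ f3) mulf_neq0 // expf_neq0 // oppr_eq0 oner_eq0.
have n23 : F3 (cross l3 l2) != 0 by rewrite crossC (form_scal _ _ f3) mulf_neq0 // expf_neq0 // oppr_eq0 oner_eq0.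
have on3 P : dot l3 P = 0 -> dot (seg a3 a 1 (-1)) P * F3 P = dot l1 P * dot l2 P * q P.
  move=> lP; have := eF P; rewrite h3 // dot_segl => e.
  by transitivity (dot a3 P * F3 P - dot a P * F3 P); [ring | rewrite e; ring].
have eb : dot (seg a3 a 1 (-1)) (cross l3 l1) = 0.
  apply: (mulIf n13); rewrite mul0r on3; last by rewrite dotC dot_crossl.
  by rewrite [dot l1 _]dotC dot_crossr !mul0r.
have [k hk] := prop_on_line X13 eb.
have fG : form 3 (fun P => k * F3 P - dot l2 P * q P) :=
  form_sub (form_scale k f3) (form_dot l2 fq).
have G0 P : dot l3 P = 0 -> k * F3 P - dot l2 P * q P = 0.
  apply: (line_cancel fG X13) => R lR; have := on3 R lR; rewrite hk // => e.
  by rewrite mulrBr !mulrA [_ * k]mulrC e subrr.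
have k0 : k = 0.
  apply: (mulIf n23); rewrite mul0r.
  have := G0 (cross l3 l2); rewrite [dot l2 _]dotC dot_crossr mul0r subr0; apply.
  by rewrite dotC dot_crossl.
have q0 : forall P, dot l3 P = 0 -> q P = 0.
  apply: (line_cancel fq X23) => R lR; have := G0 R lR.
  by rewrite k0 mul0r sub0r => /eqP; rewrite oppr_eq0 => /eqP.
have [N fN eN] := form_div fq l30 q0.
have [n hn] := form1_dot fN.
by exists a, n => P; rewrite eF eN hn; ring.
Qed.

Lemma order2_coef (a b c : K) (r : {poly K}) :
  (forall s, s * a + s ^+ 2 * b + s ^+ 3 * c = s ^+ 2 * r.[s]) -> a = 0.
Proof.
move=> h.
have /(congr1 (fun f : {poly K} => f`_1)) : a%:P * 'X + 'X^2 * (b%:P + c%:P * 'X) - 'X^2 * r = 0.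
  apply: (poly_dense charK (xs := [::])) => s _.
  by rewrite !(hornerE, horner_exp) /= -h; ring.
by rewrite coef0 !(coefD, coefN, coefXnM, coefCM, coefX) /= !addr0 mulr1 subr0.
Qed.

Lemma cmb_line p q r x y z s :
  seg p (cmb p q r x y z) 1 s = cmb p q r (1 + x * s) (s * y) (s * z).
Proof. by apply: pt_ext => /=; ring. Qed.

(** Transversality with t = 0 gives F4 a nonzero linear part at p. On a lifting line through p, F4
    inherits order 2 from F3, so this line is the tangent of F4. *)
Lemma nodal_line p l m : base_pt F3 F4 p -> order2 F3 p ->
  lifts F3 F4 l -> lifts F3 F4 m -> dot l p = 0 -> dot m p = 0 -> cross l m = null K.
Proof.
move=> bp o2 L M lp mp; have [p0 p3 p4] := bp; have [q [r det0]] := pt_basis p0.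
have [c0 [c1 [c2 [c3 [c4 [c5 [c6 [c7 [c8 [c9 h3]]]]]]]]]] := frame_coef3 (cubic_form H) p q r.
have [b0 [b1 [b2 [b3 [b4 [b5 [b6 [b7 [b8 [b9 [d0 [d1 [d2 [d3 [d4 h4]]]]]]]]]]]]]]] :=
  frame_coef4 (quartic_form H) p q r.
have [hc0 hb0 tr] := frame_transversal (transversal H) det0 bp h3 h4.
have hc1 : c1 = 0.
  have [t ht] := o2 (cmb p q r 0 1 0); apply: (@order2_coef c1 c3 c6 t) => s.
  by rewrite -ht cmb_line h3 hc0; ring.
have hc2 : c2 = 0.
  have [t ht] := o2 (cmb p q r 0 0 1); apply: (@order2_coef c2 c5 c9 t) => s.
  by rewrite -ht cmb_line h3 hc0; ring.
have b12 : (b2 != 0) || (- b1 != 0).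
  rewrite oppr_eq0 -negb_and; apply/negP => /andP[/eqP e2 /eqP e1]; apply: (tr 0).
  by rewrite !mul0r !add0r.
suff key n : lifts F3 F4 n -> dot n p = 0 -> dot n (cmb p q r 0 b2 (- b1)) = 0.
  by apply: (cross_lines (cross_frame det0 b12)); rewrite ?key.
move=> [n0 [a ha]] np; rewrite dot_cmb.
(* (0, y, z) is the point of n on the line q r. *)
pose y := - dot n r; pose z := dot n q.
have e s : s * (b1 * y + b2 * z) + s ^+ 2 * (b3 * y ^+ 2 + b4 * y * z + b5 * z ^+ 2)
   + s ^+ 3 * (b6 * y ^+ 3 + b7 * y ^+ 2 * z + b8 * y * z ^+ 2 + b9 * z ^+ 3) =
   s ^+ 2 * ((dot a p)%:P * ((c3 * y ^+ 2 + c4 * y * z + c5 * z ^+ 2)%:P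
          + 'X * (c6 * y ^+ 3 + c7 * y ^+ 2 * z + c8 * y * z ^+ 2 + c9 * z ^+ 3)%:P)
      + 'X * (dot a (cmb p q r 0 y z))%:P * ((c3 * y ^+ 2 + c4 * y * z + c5 * z ^+ 2)%:P
          + 'X * (c6 * y ^+ 3 + c7 * y ^+ 2 * z + c8 * y * z ^+ 2 + c9 * z ^+ 3)%:P)
      - 'X ^+ 2 * (d0 * y ^+ 4 + d1 * y ^+ 3 * z + d2 * y ^+ 2 * z ^+ 2 + d3 * y * z ^+ 3 + d4 * z ^+ 4)%:P).[s].
  have := ha (seg p (cmb p q r 0 y z) 1 s).
  rewrite [dot n _]dot_seg np dot_cmb mulr0 add0r mul0r add0r.
  have -> : s * (y * dot n q + z * dot n r) = 0 by rewrite /y /z; ring.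
  move=> /(_ erefl); rewrite dot_seg cmb_line h3 h4 hc0 hb0 hc1 hc2 => /eqP.
  rewrite -subr_eq0 => /eqP e'; rewrite !(hornerE, horner_exp) /=; apply/eqP; rewrite -subr_eq0.
  by apply/eqP; rewrite -[RHS]e'; ring.
have := order2_coef e; rewrite /y /z => e0.
by rewrite np -[RHS]e0; ring.
Qed.

(** At a smooth point of the cubic a double root makes l the tangent, which does not lift. *)
Lemma double_root_nodal p l Q (r : {poly K}) : base_pt F3 F4 p -> lifts F3 F4 l ->
  dot l p = 0 -> dot l Q = 0 -> cross p Q != null K ->
  (forall s, F3 (seg p Q 1 s) = s ^+ 2 * r.[s]) -> order2 F3 p.
Proof.
move=> bp L lp lQ pQ hr; have [//|[q [t fr]]] := smooth_or_nodal (cubic_form H) bp.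
have [A2 [A3 [B1 [B2 [U [V [C [_ nr]]]]]]]] := pencil charK H bp fr.
have lt := nr l L lp; case: fr => det0 [c3 [c4 [c5 [c6 [c7 [c8 [c9 h3]]]]]]].
move: lQ pQ hr; rewrite (cmb_basis Q det0); set x := _ / _; set y := _ / _; set z := _ / _.
move=> lQ pQ hr; suff y0 : y = 0.
  move: lQ; rewrite dot_cmb lp y0 mulr0 mul0r !add0r => /eqP.
  rewrite mulf_eq0 (negbTE lt) orbF => /eqP z0; move: pQ; rewrite y0 z0 => /eqP[].
  by apply: pt_ext => /=; ring.
pose X : {poly K} := 1 + x%:P * 'X.
apply: (@order2_coef y 0 0 (r - (x%:P * (1 + X) * y%:P
    + X * (c3 * y ^+ 2 + c4 * y * z + c5 * z ^+ 2)%:P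
    + 'X * (c6 * y ^+ 3 + c7 * y ^+ 2 * z + c8 * y * z ^+ 2 + c9 * z ^+ 3)%:P))) => s.
by rewrite hornerD mulrDr -hr cmb_line h3 hornerN !(hornerE, horner_exp) /=; ring.
Qed.

End Lines.

(** * Conics, nodes and the Fano plane *)

Section Conics.
Variable K : fieldType.
Let hE := (@hornerD K, @hornerN K, @hornerM K, @hornerC K, @hornerX K).
Hypothesis charK : [pchar K] =i pred0.
Local Notation pt := (pt K).
Implicit Types (p l m n P Q X : pt) (x y z s t u v : K).
Variables F3 F4 : pt -> K.
Variables ps ls : seq pt.
Hypothesis H : monoid_config F3 F4 ps ls.

Lemma exists_frame : exists p q r : pt, det3 p q r != 0.
Proof.
exists (1, 0, 0), (0, 1, 0), (0, 0, 1).
have -> : det3 (1, 0, 0) (0, 1, 0) (0, 0, 1) = 1 :> K by rewrite /det3 /dot /=; ring.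
exact: oner_neq0.
Qed.

Lemma not_multiple a : ~ (forall P, F4 P = dot a P * F3 P).
Proof.
move=> h; have [p [q [r det0]]] := exists_frame.
apply: (lines_finite charK H det0) => s; split; last by exists a.
by apply: (cross_frame det0); rewrite oner_eq0.
Qed.

(** A line contained in both C and the cubic would consist of base points. *)
Lemma seq_base_le3 l (C : pt -> K) : l != null K ->
  (forall P, F3 P = 0 -> C P = 0 -> F4 P = 0) -> (forall P, dot l P = 0 -> C P = 0) ->
  (count (fun p => dot l p == 0%R) ps <= 3)%N.
Proof.
move=> l0 hC lC.
have [P lP P3] : exists2 P, dot l P = 0 & F3 P != 0.
  apply: (line_nonzero charK (cubic_form H) l0) => z3.
  by apply: (base_finite charK H l0) => P lP; split; [exact: z3 | apply: hC; auto].
exact: (base_on_line_le3 charK H l0 lP).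
Qed.

Lemma conic_with_line_le6 (C : pt -> K) l : form 2 C -> (exists P, C P != 0) -> l != null K ->
  (forall P, F3 P = 0 -> C P = 0 -> F4 P = 0) -> (forall P, dot l P = 0 -> C P = 0) ->
  (count (fun p => C p == 0%R) ps <= 6)%N.
Proof.
move=> fC [P0 hP0] l0 hC lC; have [N fN eN] := form_div fC l0 lC.
have [n hn] := form1_dot fN.
have n0 : n != null K.
  by apply: contraNneq hP0 => e; rewrite eN hn e; apply/eqP; rewrite /dot /=; ring.
have c1 := seq_base_le3 l0 hC lC.
have c2 : (count (fun p => dot n p == 0%R) ps <= 3)%N.
  by apply: (seq_base_le3 n0 hC) => P nP; rewrite eN hn nP mulr0.
apply: leq_trans (leq_add c1 c2).
rewrite -count_predUI; apply: leq_trans (leq_addr _ _).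
by apply: sub_count => p /=; rewrite eN hn mulf_eq0.
Qed.

(** A case of Bezout's theorem over [K]. A conic containing a line is a pair of lines with at most
    three base points each. Otherwise seven base points on it are projected from one of them: F3
    becomes a polynomial of degree at most 5 in the slope, one of the six intersections being the
    centre, and has six roots. It then vanishes identically and the conic consists of base
    points. *)
Lemma conic_le6 (C : pt -> K) : form 2 C -> (exists P, C P != 0) ->
  (forall P, F3 P = 0 -> C P = 0 -> F4 P = 0) ->
  (count (fun p => C p == 0%R) ps <= 6)%N.
Proof.
move=> fC Cn0 hC; rewrite leqNgt; apply/negP => gt6.
have noline l : l != null K -> ~ (forall P, dot l P = 0 -> C P = 0).
  by move=> l0 lC; have := conic_with_line_le6 fC Cn0 l0 hC lC; rewrite leqNgt gt6.
rewrite -size_filter in gt6; set xs := filter _ _ in gt6.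
have inxs p : p \in xs -> [/\ p \in ps, p != null K, F3 p = 0 & C p = 0].
  by rewrite mem_filter => /andP[/eqP Cp hp]; have [p0 p3 _] := ps_base H hp.
have [p pxs] : exists p, p \in xs.
  by case: (xs) gt6 => // p xs' _; exists p; rewrite mem_head.
have [pin p0 p3 pC] := inxs p pxs; have [q [r det0]] := pt_basis p0.
have [c0 [c1 [c2 [c3 [c4 [c5 hc]]]]]] := form2_coef (form_basis p q r fC).
have c00 : c0 = 0 by have := hc 1 0 0; rewrite /= cmb_e1 pC => ->; ring.
have hC' x y z : C (cmb p q r x y z) = x * (c1 * y + c2 * z)
    + (c3 * y ^+ 2 + c4 * y * z + c5 * z ^+ 2).
  by have := hc x y z; rewrite c00 /= => ->; ring.
have line_in_conic u v : (u != 0) || (v != 0) -> c1 * u + c2 * v = 0 ->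
    c3 * u ^+ 2 + c4 * u * v + c5 * v ^+ 2 = 0 -> False.
  move=> uv e1 e2; have l0 := cross_frame det0 uv.
  apply: (noline _ l0) => P hP; have [x [y ->]] := line_param l0 hP.
  have -> : seg p (cmb p q r 0 u v) x y = cmb p q r x (y * u) (y * v) by apply: pt_ext => /=; ring.
  rewrite hC'; transitivity (x * y * (c1 * u + c2 * v) +
     y ^+ 2 * (c3 * u ^+ 2 + c4 * u * v + c5 * v ^+ 2)); first ring.
  by rewrite e1 e2; ring.
pose cx P := det3 P q r / det3 p q r.
pose cy P := det3 p P r / det3 p q r.
pose cz P := det3 p q P / det3 p q r.
have cE P : P = cmb p q r (cx P) (cy P) (cz P) by exact: cmb_basis.
have sc k P : cmb p q r (k * cx P) (k * cy P) (k * cz P) = scal k P.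
  by rewrite [in RHS](cE P); apply: pt_ext => /=; ring.
have conic P : P \in xs -> cx P * (c1 * cy P + c2 * cz P) +
    (c3 * cy P ^+ 2 + c4 * cy P * cz P + c5 * cz P ^+ 2) = 0.
  by move=> /inxs[_ _ _]; rewrite {1}(cE P) => e; rewrite -hC'.
have yz P : P \in xs -> P != p -> (cy P != 0) || (cz P != 0).
  move=> Pxs; rewrite -negb_and; apply: contra => /andP[/eqP y0 /eqP z0].
  have [Pin P0 _ _] := inxs _ Pxs.
  apply/eqP/(ps_inj H) => //; rewrite (cE P) y0 z0.
  have -> : cmb p q r (cx P) 0 0 = scal (cx P) p by apply: pt_ext => /=; ring.
  by apply: pt_ext => /=; ring.
(* T = 0 is the tangent to the conic at p, which carries no other point of [xs]. *)
pose T P := c1 * cy P + c2 * cz P.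
have Tn0 P : P \in xs -> P != p -> T P != 0.
  move=> Pxs Pp; apply/eqP => e; apply: (line_in_conic _ _ (yz P Pxs Pp) e).
  by rewrite -[RHS](conic P Pxs) -/(T P) e mulr0 add0r.
pose xs' := [seq P <- xs | P != p].
have s' : (6 <= size xs')%N.
  have u : uniq xs by rewrite filter_uniq // (ps_uniq H).
  have := count_predC (fun P => P == p) xs; rewrite (count_uniq_mem _ u) pxs -size_filter => e.
  by move: gt6; rewrite -e add1n ltnS.
have inxs' P : P \in xs' -> P \in xs /\ P != p by rewrite mem_filter => /andP[].
have c12 : (c1 != 0) || (c2 != 0).
  rewrite -negb_and; apply/negP => /andP[/eqP e1 /eqP e2].
  case: (xs') s' inxs' => // P ? _ /(_ P (mem_head _ _))[Pxs Pp].
  by have := Tn0 P Pxs Pp; rewrite /T e1 e2 !mul0r addr0 eqxx.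
have [d3 [d4 [d5 [d6 [d7 [d8 [d9 [e0 [e1 [e2 h3]]]]]]]]]] := frame_coef3 (cubic_form H) p q r.
have d30 : d3 = 0 by have := h3 1 0 0; rewrite /= cmb_e1 p3 => ->; ring.
(* The conic is parametrized by the lines through p, the tangent being at infinity. *)
have [u [v huv]] : exists u v, c1 * u + c2 * v = 1.
  have [c1z|c1nz] := eqVneq c1 0.
    by rewrite c1z eqxx /= in c12; exists 0, c2^-1; rewrite mulfV // mulr0 add0r.
  by exists c1^-1, 0; rewrite mulfV // mulr0 addr0.
pose Y : {poly K} := u%:P - c2%:P * 'X; pose Z : {poly K} := v%:P + c1%:P * 'X.
have sY : (size Y <= 2)%N.
  apply: size_add_le; first exact: leq_trans (size_polyC_leq1 _) _.
  by rewrite size_polyN; apply: (@size_mul_le _ _ _ 0 1); rewrite ?size_polyC_leq1 ?size_polyX.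
have sZ : (size Z <= 2)%N.
  apply: size_add_le; first exact: leq_trans (size_polyC_leq1 _) _.
  by apply: (@size_mul_le _ _ _ 0 1); rewrite ?size_polyC_leq1 ?size_polyX.
have sC (k : K) (f : {poly K}) (n : nat) : (size f <= n.+1)%N -> (size (k%:P * f)%R <= n.+1)%N.
  by move=> hf; apply: (@size_mul_le _ _ _ 0 n) => //; apply: size_polyC_leq1.
have sM (f g : {poly K}) (i j : nat) := @size_mul_le _ f g i j.
pose X : {poly K} := - (c3%:P * (Y * Y) + c4%:P * (Y * Z) + c5%:P * (Z * Z)).
have sX : (size X <= 3)%N.
  rewrite size_polyN; apply: size_add_le; first apply: size_add_le; apply: sC.
  - exact: (sM _ _ 1 1).
  - exact: (sM _ _ 1 1).
  - exact: (sM _ _ 1 1).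
pose G : {poly K} := X * X * (d4%:P * Y + d5%:P * Z)
  + X * (d6%:P * (Y * Y) + d7%:P * (Y * Z) + d8%:P * (Z * Z))
  + (d9%:P * (Y * (Y * Y)) + e0%:P * (Y * (Y * Z)) + e1%:P * (Y * (Z * Z)) + e2%:P * (Z * (Z * Z))).
have sG : (size G <= 6)%N.
  rewrite /G; apply: size_add_le; first apply: size_add_le.
  - apply: (sM _ _ 4 1); first exact: (sM _ _ 2 2).
    by apply: size_add_le; apply: sC.
  - apply: (@leq_trans 5) => //; apply: (sM _ _ 2 2) => //.
    by do 2?[apply: size_add_le]; apply: sC; apply: (sM _ _ 1 1).
  - apply: (@leq_trans 4) => //.
    by do 3?[apply: size_add_le]; apply: sC; apply: (sM _ _ 1 2) => //; apply: (sM _ _ 1 1).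
pose pr s := cmb p q r X.[s] Y.[s] Z.[s].
have YZ1 s : c1 * Y.[s] + c2 * Z.[s] = 1.
  by rewrite /Y /Z !hE -huv; ring.
have prC s : C (pr s) = 0.
  transitivity (X.[s] * (c1 * Y.[s] + c2 * Z.[s]) + (c3 * Y.[s] ^+ 2 + c4 * Y.[s] * Z.[s] + c5 * Z.[s] ^+ 2)).
    by rewrite hC'; ring.
  by rewrite YZ1 /X; generalize Y Z => Y' Z'; rewrite !hE; ring.
have pr3 s : F3 (pr s) = G.[s].
  rewrite [LHS]h3 d30 /G; generalize X Y Z => X' Y' Z'; rewrite !(hornerD, hornerM, hornerC); ring.
pose f P := (u * cz P - v * cy P) / T P.
have fE P : P \in xs' -> pr (f P) = scal (T P)^-1 P.
  move=> /inxs'[Pxs Pp]; have T0 := Tn0 P Pxs Pp; rewrite -sc.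
  have eY : Y.[f P] = (T P)^-1 * cy P.
    apply: (mulfI T0); rewrite mulVKf // /Y !hE /f.
    transitivity (u * T P - c2 * (u * cz P - v * cy P)); first by move: (T P) T0 => t t0; field.
    by rewrite /T; transitivity ((c1 * u + c2 * v) * cy P); [ring | rewrite huv mul1r].
  have eZ : Z.[f P] = (T P)^-1 * cz P.
    apply: (mulfI T0); rewrite mulVKf // /Z !hE /f.
    transitivity (v * T P + c1 * (u * cz P - v * cy P)); first by move: (T P) T0 => t t0; field.
    by rewrite /T; transitivity ((c1 * u + c2 * v) * cz P); [ring | rewrite huv mul1r].
  have eX : X.[f P] = (T P)^-1 * cx P.
    transitivity (- (c3 * Y.[f P] ^+ 2 + c4 * Y.[f P] * Z.[f P] + c5 * Z.[f P] ^+ 2)).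
      by rewrite /X; generalize Y Z => Y' Z'; rewrite !hE; ring.
    rewrite eY eZ; apply: (mulfI (expf_neq0 2 T0)).
    have := conic P Pxs; rewrite -/(T P) => e.
    transitivity (- (c3 * cy P ^+ 2 + c4 * cy P * cz P + c5 * cz P ^+ 2)); first by move: (T P) T0 => t t0; field.
    by transitivity (cx P * T P); [by apply/esym/eqP; rewrite -addr_eq0 e | move: (T P) T0 => t t0; field].
  by rewrite /pr eX eY eZ.
have [G0|Gn0] := eqVneq G 0; last first.
  have : (size xs' < size G)%N.
    apply: (size_lt_roots (f := f) Gn0).
    - by rewrite !filter_uniq // (ps_uniq H).
    - move=> P Q hP hQ e; have [Pxs Pp] := inxs' _ hP; have [Qxs Qp] := inxs' _ hQ.
      have [Pin _ _ _] := inxs _ Pxs; have [Qin _ _ _] := inxs _ Qxs.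
      apply: (ps_inj H) => //.
      have eP := fE P hP; have eQ := fE Q hQ; rewrite e eQ in eP.
      have -> : P = scal (T P) (scal (T Q)^-1 Q).
        by rewrite eP; apply: pt_ext; rewrite /= mulVKf // Tn0.
      by apply: pt_ext => /=; ring.
    - move=> P hP; have [/inxs[_ _ P3 _] _] := inxs' _ hP.
      by rewrite -pr3 fE // (form_scal _ _ (cubic_form H)) P3 mulr0.
  by move=> lt; have := leq_trans lt sG; rewrite ltnS leqNgt s'.
have cyE x y z : cy (cmb p q r x y z) = y.
  by apply: (mulIf det0); rewrite /cy divfK // /det3 /dot /=; ring.
have czE x y z : cz (cmb p q r x y z) = z.
  by apply: (mulIf det0); rewrite /cz divfK // /det3 /dot /=; ring.
have TE s : T (pr s) = 1 by rewrite /T cyE czE YZ1.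
have Tscal k P : T (scal k P) = k * T P.
  by rewrite -sc /T cyE czE; ring.
have [s] := poly_avoid charK [seq (u * cz P - v * cy P) / T P | P <- ps] (oner_neq0 {poly K}).
have z3 : F3 (pr s) = 0 by rewrite pr3 G0 horner0.
have n0 : pr s != null K.
  apply: contra_eq_neq (TE s) => ->; have -> : null K = scal 0 p by apply: pt_ext => /=; ring.
  by rewrite Tscal mul0r eq_sym oner_neq0.
have [//|Q Qin e] := ps_all H (_ : base_pt F3 F4 (pr s)).
  by split=> //; apply: hC.
have [k kE] := cross_null n0 e; have [Q0 _ _] := ps_base H Qin.
have k0 : k != 0 by case: (@scal_neq0 _ k (pr s)); rewrite -?kE.
move=> /negP sn _; apply: sn; apply/mapP; exists Q => //.
rewrite kE Tscal TE -sc cyE czE /pr cyE czE.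
apply: (mulIf k0); rewrite mulr1 divfK // /Y /Z !hE.
by transitivity (k * ((c1 * u + c2 * v) * s)); [rewrite huv; ring | ring].
Qed.

(** The base points lie on l1, on l2 or on the residual conic, which carry at most 3, 3 and 6 of
    them. *)
Lemma disjoint_pair_le12 l1 l2 : lifts F3 F4 l1 -> lifts F3 F4 l2 -> F3 (cross l1 l2) != 0 ->
  (size ps <= 12)%N.
Proof.
move=> L1 L2 d; have [a [C [fC eF]]] := residual_conic charK H L1 L2 d.
have [P1 lP1 hP1] := lift_cubic_neq0 charK H L1.
have [P2 lP2 hP2] := lift_cubic_neq0 charK H L2.
have [l10 _] := L1; have [l20 _] := L2.
have c1 := base_on_line_le3 charK H l10 lP1 hP1.
have c2 := base_on_line_le3 charK H l20 lP2 hP2.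
have c3 : (count (fun p => C p == 0%R) ps <= 6)%N.
  apply: conic_le6 => //; last by move=> P e3 eC; rewrite eF e3 eC !mulr0 addr0.
  have [P hP] : exists P, C P <> 0.
    apply: not_all_ex_not => C0; apply: (@not_multiple a) => P.
    by rewrite eF C0 mulr0 addr0.
  by exists P; apply/eqP.
apply: leq_trans (leq_add (leq_add c1 c2) c3); rewrite -(count_predT ps).
rewrite -(count_predUI (fun p => dot l1 p == 0)).
apply: leq_trans (leq_add (leq_addr _ _) (leqnn _)); rewrite -count_predUI.
apply: leq_trans (leq_addr _ _); apply/eq_leq/eq_in_count => p pin /=.
have [_ e3 e4] := ps_base H pin.
by have := eF p; rewrite e3 e4 mulr0 add0r => /esym/eqP; rewrite !mulf_eq0 => ->.
Qed.

Lemma order2_coef3 (p q r : pt) c0 c1 c2 c3 c4 c5 c6 c7 c8 c9 : F3 p = 0 -> order2 F3 p ->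
  (forall x y z, F3 (cmb p q r x y z) = c0 * x ^+ 3 + x ^+ 2 * (c1 * y + c2 * z)
    + x * (c3 * y ^+ 2 + c4 * y * z + c5 * z ^+ 2)
    + (c6 * y ^+ 3 + c7 * y ^+ 2 * z + c8 * y * z ^+ 2 + c9 * z ^+ 3)) ->
  [/\ c0 = 0, c1 = 0 & c2 = 0].
Proof.
move=> p3 o2 h3.
have hc0 : c0 = 0 by have := h3 1 0 0; rewrite cmb_e1 p3 => ->; ring.
split=> //.
- have [t ht] := o2 (cmb p q r 0 1 0); apply: (order2_coef charK (b := c3) (c := c6) (r := t)) => s.
  by rewrite -ht cmb_line h3 hc0; ring.
- have [t ht] := o2 (cmb p q r 0 0 1); apply: (order2_coef charK (b := c5) (c := c9) (r := t)) => s.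
  by rewrite -ht cmb_line h3 hc0; ring.
Qed.

Lemma cmb_perm (p q r : pt) x y z : cmb p q r x y z = cmb q r p y z x.
Proof. by apply: pt_ext => /=; ring. Qed.

(** A cubic form on a line has four coefficients, and each of the two double roots kills two of
    them. *)
Lemma nodal_chord p p' : p \in ps -> p' \in ps -> p != p' -> order2 F3 p -> order2 F3 p' ->
  cross p p' != null K /\ forall P, dot (cross p p') P = 0 -> F3 P = 0.
Proof.
move=> pin p'in ne o o'.
have X0 : cross p p' != null K by apply: contra_neq ne; exact: (ps_inj H).
split=> // P lP; have [x [y ->]] := line_param X0 lP.
have [p0 p3 _] := ps_base H pin; have [p'0 p'3 _] := ps_base H p'in.
have [r hr] := null_dot X0; rewrite dot_cross in hr.
have [c0 [c1 [c2 [c3 [c4 [c5 [c6 [c7 [c8 [c9 h3]]]]]]]]]] := frame_coef3 (cubic_form H) p p' r.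
have [e0 e1 e2] := order2_coef3 p3 o h3.
have h3' u v w : F3 (cmb p' r p u v w) = c6 * u ^+ 3 + u ^+ 2 * (c7 * v + c3 * w)
    + u * (c8 * v ^+ 2 + c4 * v * w + c1 * w ^+ 2)
    + (c9 * v ^+ 3 + c5 * v ^+ 2 * w + c2 * v * w ^+ 2 + c0 * w ^+ 3).
  by rewrite -cmb_perm h3; ring.
have [e6 _ e3] := order2_coef3 p'3 o' h3'.
have -> : seg p p' x y = cmb p p' r x y 0 by apply: pt_ext => /=; ring.
by rewrite h3 e0 e1 e6 e3; ring.
Qed.

(* Otherwise F3 = 0 would be a triangle with a node at every base point, so that the
   base points would be its three vertices. *)
Lemma exists_smooth : (5 <= size ps)%N -> exists2 p, p \in ps & ~ order2 F3 p.
Proof.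
move=> s5; apply: NNPP => nex.
have nod p : p \in ps -> order2 F3 p.
  by move=> hp; apply: NNPP => n2; apply: nex; exists p.
have [p1 [p2 [p1in p2in ne12]]] : exists p1 p2, [/\ p1 \in ps, p2 \in ps & p1 != p2].
  case: (ps) (ps_uniq H) s5 => [|p1 [|p2 ps']] // /andP[n12 _] _; exists p1, p2.
  by rewrite !inE !eqxx orbT; split=> //; apply: contraNneq n12 => ->; rewrite mem_head.
have [X0 l3] := nodal_chord p1in p2in ne12 (nod _ p1in) (nod _ p2in).
set l := cross p1 p2 in X0 l3.
have [P lP P4] : exists2 P, dot l P = 0 & F4 P != 0.
  apply: (line_nonzero charK (quartic_form H) X0) => z4.
  by apply: (base_finite charK H X0) => P lP; split; [exact: l3 | exact: z4].
have lt4 : (count (fun p => dot l p == 0%R) ps <= 4)%N.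
  rewrite -size_filter; apply: (line_zeros charK (quartic_form H) X0 lP P4).
  - exact: filter_uniq (ps_uniq H).
  - by move=> p; rewrite mem_filter => /andP[/eqP lp /(ps_base H)[p0 _ p4]].
  - by move=> p q; rewrite !mem_filter => /andP[_ hp] /andP[_ hq]; exact: (ps_inj H).
have [p3 p3in lp3] : exists2 p3, p3 \in ps & dot l p3 != 0.
  have : ~~ all (fun p => dot l p == 0) ps.
    by rewrite all_count; apply: contraTneq s5 => <-; rewrite -ltnNge ltnS.
  by case/allPn => p hp h; exists p.
have det0 : det3 p1 p2 p3 != 0 by rewrite -dot_cross.
have [_ z1 _] := ps_base H p1in; have [_ z2 _] := ps_base H p2in; have [_ z3 _] := ps_base H p3in.
have [c0 [c1 [c2 [c3 [c4 [c5 [c6 [c7 [c8 [c9 h3]]]]]]]]]] := frame_coef3 (cubic_form H) p1 p2 p3.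
have [e0 e1 e2] := order2_coef3 z1 (nod _ p1in) h3.
have h3' u v w : F3 (cmb p2 p3 p1 u v w) = c6 * u ^+ 3 + u ^+ 2 * (c7 * v + c3 * w)
    + u * (c8 * v ^+ 2 + c4 * v * w + c1 * w ^+ 2)
    + (c9 * v ^+ 3 + c5 * v ^+ 2 * w + c2 * v * w ^+ 2 + c0 * w ^+ 3).
  by rewrite -cmb_perm h3; ring.
have [e6 e7 e3] := order2_coef3 z2 (nod _ p2in) h3'.
have h3'' u v w : F3 (cmb p3 p1 p2 u v w) = c9 * u ^+ 3 + u ^+ 2 * (c5 * v + c8 * w)
    + u * (c2 * v ^+ 2 + c4 * v * w + c7 * w ^+ 2)
    + (c0 * v ^+ 3 + c1 * v ^+ 2 * w + c3 * v * w ^+ 2 + c6 * w ^+ 3).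
  by rewrite cmb_perm h3; ring.
have [e9 e5 e8] := order2_coef3 z3 (nod _ p3in) h3''.
have hxyz x y z : F3 (cmb p1 p2 p3 x y z) = c4 * (x * y * z).
  by rewrite h3 e0 e1 e2 e3 e5 e6 e7 e8 e9; ring.
have c40 : c4 != 0.
  have [Q] := cubic_neq0 H; rewrite (cmb_basis Q det0) hxyz.
  by apply: contraNneq => ->; rewrite mul0r.
have [p4 p4in /and3P[n1 n2 n3]] : exists2 p4, p4 \in ps & [&& p4 != p1, p4 != p2 & p4 != p3].
  have : has (predC (mem [:: p1; p2; p3])) ps.
    rewrite has_predC; apply: contraL s5 => /allP sub; rewrite -ltnNge ltnS.
    exact: leq_trans (uniq_leq_size (ps_uniq H) sub) _.
  by case/hasP => p hp /=; rewrite !inE !negb_or => h; exists p.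
have [x [y [z e]]] : exists x y z, p4 = cmb p1 p2 p3 x y z.
  by eexists; eexists; eexists; exact: cmb_basis.
have o4 := nod _ p4in.
(* The gradient of x y z vanishes at p4, so two of its coordinates are zero and p4 is a vertex. *)
have D u v w : c4 * (u * y * z + v * x * z + w * x * y) = 0.
  have [t ht] := o4 (cmb p1 p2 p3 u v w).
  have [_ z4 _] := ps_base H p4in; rewrite e hxyz in z4.
  apply: (order2_coef charK (b := c4 * (u * v * z + u * w * y + v * w * x)) (c := c4 * (u * v * w)) (r := t)) => s.
  rewrite -ht e.
  have -> : seg (cmb p1 p2 p3 x y z) (cmb p1 p2 p3 u v w) 1 s = cmb p1 p2 p3 (x + s * u) (y + s * v) (z + s * w).
    by apply: pt_ext => /=; ring.
  by rewrite hxyz; transitivity (c4 * (x * y * z) + s * (c4 * (u * y * z + v * x * z + w * x * y)) +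
     s ^+ 2 * (c4 * (u * v * z + u * w * y + v * w * x)) + s ^+ 3 * (c4 * (u * v * w)));
     [rewrite z4 add0r | ring].
have prop k a : a \in ps -> p4 = scal k a -> p4 = a.
  by move=> ain ea; apply: (ps_inj H) => //; rewrite ea; apply: pt_ext => /=; ring.
have /eqP := D 1 0 0; have /eqP := D 0 1 0; have /eqP := D 0 0 1.
rewrite !mul0r !mul1r !addr0 !add0r !mulf_eq0 (negbTE c40) /=.
have [x0|xn0] := eqVneq x 0.
  have [y0|yn0] := eqVneq y 0.
    move=> _ _ _; move/eqP: n3; apply; apply: (prop z) => //.
    by rewrite e x0 y0; apply: pt_ext => /=; ring.
  move=> _ _ /= /eqP z0; move/eqP: n2; apply; apply: (prop y) => //.
  by rewrite e x0 z0; apply: pt_ext => /=; ring.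
move=> /= /eqP y0 /eqP z0' _; move/eqP: n1; apply; apply: (prop x) => //.
by rewrite e y0 z0'; apply: pt_ext => /=; ring.
Qed.

(* By Ceva and Menelaus the product of three ratios would be both 1 and -1. *)
Lemma no_fano (P Q R A B C G : pt) (a b c dP dQ dR d : pt) :
  det3 P Q R != 0 -> a != null K -> b != null K -> c != null K ->
  dP != null K -> dQ != null K -> dR != null K -> d != null K -> G != null K ->
  cross P A != null K -> cross Q A != null K -> cross P B != null K ->
  cross R B != null K -> cross Q C != null K -> cross R C != null K ->
  dot a P = 0 -> dot a Q = 0 -> dot a A = 0 ->
  dot b P = 0 -> dot b R = 0 -> dot b B = 0 ->
  dot c Q = 0 -> dot c R = 0 -> dot c C = 0 ->
  dot dP P = 0 -> dot dP C = 0 -> dot dP G = 0 ->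
  dot dQ Q = 0 -> dot dQ B = 0 -> dot dQ G = 0 ->
  dot dR R = 0 -> dot dR A = 0 -> dot dR G = 0 ->
  dot d A = 0 -> dot d B = 0 -> dot d C = 0 -> False.
Proof.
move=> det0 a0 b0 c0 dP0 dQ0 dR0 d0 G0 PA QA PB RB QC RC aP aQ aA bP bR bB cQ cR cC.
move=> dPP dPC dPG dQQ dQB dQG dRR dRA dRG dA dB dC.
have coll (l X Y Z : pt) : l != null K -> dot l X = 0 -> dot l Y = 0 -> dot l Z = 0 -> det3 X Y Z = 0.
  move=> l0 X0 Y0 Z0; have [u hu] := null_dot l0; rewrite dotC in hu.
  apply/eqP; apply: contraNT hu => dn; rewrite (cmb_basis u dn).
  by rewrite dotC dot_cmb X0 Y0 Z0 !mulr0 !addr0.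
have PQ : cross P Q != null K.
  by apply: contraNneq det0 => e; rewrite -dot_cross e; apply/eqP; rewrite /dot /=; ring.
have PR : cross P R != null K.
  apply: contraNneq det0 => e; have -> : det3 P Q R = - dot (cross P R) Q by rewrite /det3 /dot /=; ring.
  by rewrite e; apply/eqP; rewrite /dot /=; ring.
have QR : cross Q R != null K.
  by apply: contraNneq det0 => e; rewrite /det3 e; apply/eqP; rewrite /dot /=; ring.
have [a1 [a2 eA]] := on_line PQ aP aQ a0 aA.
have [b1 [b2 eB]] := on_line PR bP bR b0 bB.
have [c1 [c2 eC]] := on_line QR cQ cR c0 cC.
have [x [y [z eG]]] : exists x y z, G = cmb P Q R x y z.
  by eexists; eexists; eexists; exact: cmb_basis.
have segE (X Y : pt) u v : cross X (seg X Y u v) != null K -> v != 0.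
  by apply: contra_neq => ->; apply: pt_ext => /=; ring.
have segE' (X Y : pt) u v : cross Y (seg X Y u v) != null K -> u != 0.
  by apply: contra_neq => ->; apply: pt_ext => /=; ring.
rewrite eA in PA QA; rewrite eB in PB RB; rewrite eC in QC RC.
have a2n := segE _ _ _ _ PA; have a1n := segE' _ _ _ _ QA.
have b2n := segE _ _ _ _ PB; have b1n := segE' _ _ _ _ RB.
have c2n := segE _ _ _ _ QC; have c1n := segE' _ _ _ _ RC.
have f1 : c1 * z = c2 * y.
  have := coll _ _ _ _ dP0 dPP dPC dPG; rewrite eC eG => e.
  apply: (mulfI det0); apply/eqP; rewrite -subr_eq0; apply/eqP; rewrite -[RHS]e.
  by rewrite /det3 /dot /=; ring.
have f2 : b1 * z = b2 * x.
  have := coll _ _ _ _ dQ0 dQQ dQB dQG; rewrite eB eG => e.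
  apply: (mulfI det0); apply/eqP; rewrite -subr_eq0; apply/eqP; rewrite -[RHS]oppr0 -e.
  by rewrite /det3 /dot /=; ring.
have f3 : a1 * y = a2 * x.
  have := coll _ _ _ _ dR0 dRR dRA dRG; rewrite eA eG => e.
  apply: (mulfI det0); apply/eqP; rewrite -subr_eq0; apply/eqP; rewrite -[RHS]e.
  by rewrite /det3 /dot /=; ring.
have f4 : a1 * b2 * c1 + a2 * b1 * c2 = 0.
  have := coll _ _ _ _ d0 dA dB dC; rewrite eA eB eC => e.
  apply: (mulfI det0); rewrite mulr0 -[RHS]oppr0 -e.
  by rewrite /det3 /dot /=; ring.
have z0 : z != 0.
  apply: contra_neq G0 => z0; rewrite z0 mulr0 in f1; rewrite z0 mulr0 in f2; rewrite eG z0.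
  have /eqP := esym f1; have /eqP := esym f2.
  rewrite !mulf_eq0 (negbTE b2n) (negbTE c2n) /= => /eqP -> /eqP ->.
  by apply: pt_ext => /=; ring.
have two : (2%:R : K) != 0 by rewrite ((pcharf0P K).1 charK).
have e : a1 * b2 * c1 * z = a2 * b1 * c2 * z.
  transitivity (b2 * (a1 * (c1 * z))); first ring.
  rewrite f1; transitivity (c2 * b2 * (a1 * y)); first ring.
  by rewrite f3; transitivity (a2 * c2 * (b2 * x)); [ring | rewrite -f2; ring].
have : 2%:R * (a1 * b2 * c1) * z = 0.
  transitivity (a1 * b2 * c1 * z + a1 * b2 * c1 * z); first ring.
  by rewrite {2}e -mulrDl f4 mul0r.
by apply/eqP; rewrite !mulf_neq0.
Qed.

End Conics.

(** * Counting incidences *)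

Section Incidence.
Variables (L P : finType) (inc : L -> P -> bool).
Local Open Scope nat_scope.

Definition meet l m := [exists p, inc l p && inc m p].
Definition pts l := [set p | inc l p].
Definition lns p := [set l | inc l p].

Hypothesis two : forall l m p q, inc l p -> inc l q -> inc m p -> inc m q -> p != q -> l = m.
Hypothesis pts_le3 : forall l, #|pts l| <= 3.
Hypothesis lns_le5 : forall p, #|lns p| <= 5.
(** A Fano plane: the triangle p q r with sides a, b, c, the third points x, y, z of the sides, the
    lines dp, dq, dr from the vertices through w, and the line d of the third points. *)
Hypothesis fano : forall p q r x y z w a b c dp dq dr d,
  q != r -> ~~ inc c p -> [/\ x != p, x != q, y != p, y != r & (z != q) && (z != r)] ->
  [/\ inc a p, inc a q & inc a x] -> [/\ inc b p, inc b r & inc b y] ->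
  [/\ inc c q, inc c r & inc c z] -> [/\ inc dp p, inc dp z & inc dp w] ->
  [/\ inc dq q, inc dq y & inc dq w] -> [/\ inc dr r, inc dr x & inc dr w] ->
  [/\ inc d x, inc d y & inc d z] -> False.

Lemma third_point l p q x y : inc l p -> inc l q -> p != q -> inc l x -> inc l y ->
  x != p -> x != q -> y != p -> y != q -> x = y.
Proof.
move=> lp lq pq lx ly xp xq yp yq; apply/eqP; apply: contraT => xy.
have sub : [:: p; q; x; y] \subset pts l.
  by apply/subsetP => z; rewrite !inE => /or4P[] /eqP ->.
have /card_uniqP u : uniq [:: p; q; x; y].
  by rewrite /= !inE !negb_or pq xy !(eq_sym p) !(eq_sym q) xp yp xq yq.
by have := leq_trans (subset_leq_card sub) (pts_le3 l); rewrite u.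
Qed.

Lemma vertex_line p q r a b c d : inc a p -> inc a q -> inc b p -> inc b r -> inc c q -> inc c r ->
  ~~ inc c p -> inc d p -> d != a -> d != b -> meet d c ->
  exists z, [/\ inc c z, inc d z, z != q & z != r].
Proof.
move=> ap aq bp br cq cr cp dp da db /existsP[z /andP[dz cz]]; exists z; split=> //.
  apply: contra_neq da => e; apply: (two dp dz ap); rewrite e ?aq //.
  by rewrite e in dz cz; apply: contraNneq cp => ->.
apply: contra_neq db => e; apply: (two dp dz bp); rewrite e ?br //.
by rewrite e in dz cz; apply: contraNneq cp => ->.
Qed.

(** The opposite side has at most one point besides q and r, and both lines must pass through it. *)
Lemma vertex_line_uniq p q r a b c d d' : inc a p -> inc a q -> inc b p -> inc b r ->
  inc c q -> inc c r -> q != r -> ~~ inc c p -> inc d p -> d != a -> d != b -> meet d c ->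
  inc d' p -> d' != a -> d' != b -> meet d' c -> d = d'.
Proof.
move=> ap aq bp br cq cr qr cp dp da db dc dp' da' db' dc'.
have [z [cz dz zq zr]] := vertex_line ap aq bp br cq cr cp dp da db dc.
have [z' [cz' dz' zq' zr']] := vertex_line ap aq bp br cq cr cp dp' da' db' dc'.
have e := third_point cq cr qr cz cz' zq zr zq' zr'; rewrite -e in dz'.
by apply: (two dp dz dp' dz'); apply: contraNneq cp => ->.
Qed.

Lemma four_ones (i j k n : nat) : i <= 1 -> j <= 1 -> k <= 1 -> n <= 1 -> 4 <= i + j + k + n ->
  [/\ 0 < i, 0 < j, 0 < k & 0 < n].
Proof. by move=> *; split; lia. Qed.

(** Seven such lines are not concurrent, so three of them form a triangle. Each of the others passes
    through a vertex and the third point of the opposite side, or through the third points of all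
    sides: at most one line of each of these four kinds, so all four occur. Every line from a vertex
    has room for one more point only, hence the three of them are concurrent and a Fano plane
    appears. *)
Lemma meeting_le6 (X : {set L}) : {in X &, forall l m, l != m -> meet l m} -> #|X| <= 6.
Proof.
move=> hX; rewrite leqNgt; apply/negP => X7.
have [a aX] : exists a, a \in X by apply/set0Pn; rewrite -card_gt0; lia.
have [b /setD1P[ba bX]] : exists b, b \in X :\ a.
  by apply/set0Pn; rewrite -card_gt0; move: X7; rewrite (cardsD1 a) aX; lia.
have [p /andP[ap bp]] : exists p, inc a p && inc b p by apply/existsP/hX; rewrite // eq_sym.
have [c /setDP[cX]] : exists c, c \in X :\: lns p.
  apply/set0Pn; rewrite -card_gt0 cardsD; have := lns_le5 p.
  by have := subset_leq_card (subsetIr X (lns p)); lia.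
rewrite inE => cp.
have ca : c != a by apply: contraNneq cp => ->.
have cb : c != b by apply: contraNneq cp => ->.
have [q /andP[cq aq]] : exists q, inc c q && inc a q by apply/existsP/hX.
have [r /andP[cr br]] : exists r, inc c r && inc b r by apply/existsP/hX.
have pq : p != q by apply: contraNneq cp => ->.
have pr : p != r by apply: contraNneq cp => ->.
have qr : q != r.
  apply: contra_neq ba => e; rewrite -e in br; exact: (two bp br ap aq).
have br' : ~~ inc b q.
  by apply/negP => bq; move/eqP: ba; apply; apply: (two bp bq ap aq).
have ar' : ~~ inc a r.
  by apply/negP => ar; move/eqP: ba; apply; apply: (two bp br ap ar).
pose Y := X :\ a :\ b :\ c.
have Y4 : 4 <= #|Y|.
  by move: X7; rewrite (cardsD1 a) aX (cardsD1 b) in_setD1 ba bX (cardsD1 c) !in_setD1 cb ca cX.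
have inY d : d \in Y -> [/\ d != a, d != b & d != c] /\ [/\ meet d a, meet d b & meet d c].
  by rewrite /Y !in_setD1 => /and4P[dc db da dX]; split; split=> //; apply: hX.
have mY : {in Y &, forall d d', d != d' -> meet d d'}.
  by move=> d d'; rewrite /Y !in_setD1 => /and4P[_ _ _ dX] /and4P[_ _ _ dX']; apply: hX.
move: Y Y4 inY mY => Y Y4 inY mY.
pose Yp := [set d in Y | inc d p]; pose Yq := [set d in Y | inc d q]; pose Yr := [set d in Y | inc d r].
pose Y0 := [set d in Y | [&& ~~ inc d p, ~~ inc d q & ~~ inc d r]].
have cover : Y \subset Yp :|: Yq :|: Yr :|: Y0.
  by apply/subsetP => d dY; rewrite !inE dY /=; case: (inc d p) (inc d q) (inc d r) => [] [] [].
have cp1 : #|Yp| <= 1.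
  apply/card_le1_eqP => d d'; rewrite !inE => /andP[/inY[[da db _] [_ _ dc]] dp].
  move=> /andP[/inY[[da' db' _] [_ _ dc']] dp'].
  exact: (vertex_line_uniq ap aq bp br cq cr qr cp).
have cq1 : #|Yq| <= 1.
  apply/card_le1_eqP => d d'; rewrite !inE => /andP[/inY[[da _ dc] [_ db _]] dp].
  move=> /andP[/inY[[da' _ dc'] [_ db' _]] dp'].
  exact: (vertex_line_uniq aq ap cq cr bp br pr br').
have cr1 : #|Yr| <= 1.
  apply/card_le1_eqP => d d'; rewrite !inE => /andP[/inY[[_ db dc] [da _ _]] dp].
  move=> /andP[/inY[[_ db' dc'] [da' _ _]] dp'].
  exact: (vertex_line_uniq br bp cr cq ap aq pq ar').
have y0 d : d \in Y0 -> exists x y z, [/\ inc a x, inc d x, x != p & x != q] /\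
   [/\ inc b y, inc d y, y != p & y != r] /\ [/\ inc c z, inc d z, z != q & z != r].
  rewrite inE => /andP[/inY[_ [/existsP[x /andP[dx ax]] /existsP[y /andP[dy by_]] /existsP[z /andP[dz cz]]]]].
  move=> /and3P[dp dq dr]; exists x, y, z.
  by split; [|split]; split=> //; [move: dp | move: dq | move: dp | move: dr | move: dq | move: dr];
     apply: contraNneq => <-.
have c01 : #|Y0| <= 1.
  apply/card_le1_eqP => d d' /y0[x [y [z [[ax dx xp xq] [[by_ dy yp yr] _]]]]].
  move=> /y0[x' [y' [z' [[ax' dx' xp' xq'] [[by' dy' yp' yr'] _]]]]].
  have ex := third_point ap aq pq ax ax' xp xq xp' xq'.
  have ey := third_point bp br pr by_ by' yp yr yp' yr'.
  rewrite -ex in dx'; rewrite -ey in dy'; apply: (two dx' dy' dx dy).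
  apply: contra_neq ba => e; rewrite -e in by_; apply: (two bp by_ ap ax).
  by rewrite eq_sym.
have sum4 : 4 <= #|Yp| + #|Yq| + #|Yr| + #|Y0|.
  apply: leq_trans Y4 _; apply: leq_trans (subset_leq_card cover) _.
  by do 3?[apply: leq_trans (leq_card_setU _ _) _; rewrite leq_add2r].
have [] := four_ones cp1 cq1 cr1 c01 sum4; rewrite !card_gt0.
move=> /set0Pn[dp] + /set0Pn[dq] + /set0Pn[dr] + /set0Pn[d].
move=> pYp qYq rYr /y0[x0 [y0' [z0 [[ax0 dx0 x0p x0q] [[by0 dy0 y0p y0r] [cz0 dz0 z0q z0r]]]]]].
move: rYr qYq pYp.
rewrite !inE => /andP[rY rr] /andP[qY qq] /andP[pY pp].
have [[ra rb rc] [mra _ _]] := inY _ rY; have [[qa qb qc] [_ mqb _]] := inY _ qY.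
have [[pa pb _] [_ _ mpc]] := inY _ pY.
have [z [cz pz zq zr]] := vertex_line ap aq bp br cq cr cp pp pa pb mpc.
have [y [by_ qy yp yr]] := vertex_line aq ap cq cr bp br br' qq qa qc mqb.
have [x [ax rx xr xq]] := vertex_line br bp cr cq ap aq ar' rr rb rc mra.
have ez := third_point cq cr qr cz cz0 zq zr z0q z0r.
have ey := third_point bp br pr by_ by0 yp yr y0p y0r.
have ex := third_point ap aq pq ax ax0 xr xq x0p x0q.
rewrite -ex in dx0; rewrite -ey in dy0; rewrite -ez in dz0.
have npq : dp != dq.
  by apply: contra_neq qa => e; rewrite -e in qq qy *; exact: (two pp qq ap aq).
have npr : dp != dr.
  by apply: contra_neq rb => e; rewrite -e in rr rx *; exact: (two pp rr bp br).
have pz' : p != z by apply: contraNneq cp => ->.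
have [w /andP[pw qw]] : exists w, inc dp w && inc dq w by apply/existsP/mY.
have [w' /andP[pw' rw']] : exists w, inc dp w && inc dr w by apply/existsP/mY.
have ww' : w = w'.
  apply: (third_point pp pz pz' pw pw').
  - by apply: contra_neq qa => e; rewrite e in qw; exact: (two qw qq ap aq).
  - apply: contra_neq qc => e; rewrite e in qw; apply: (two qq qw cq cz).
    by rewrite eq_sym.
  - by apply: contra_neq rb => e; rewrite e in rw'; exact: (two rw' rr bp br).
  - apply: contra_neq rc => e; rewrite e in rw'; apply: (two rr rw' cr cz).
    by rewrite eq_sym.
rewrite -ww' in rw'.
by apply: (@fano p q r x y z w a b c dp dq dr d) => //; split=> //; rewrite zq zr.
Qed.

Lemma double_count : \sum_l #|pts l| = \sum_p #|lns p|.
Proof.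
transitivity (\sum_l \sum_p (inc l p : nat)).
  by apply: eq_bigr => l _; rewrite -sum1dep_card big_mkcond /=; apply: eq_bigr => p _; case: inc.
rewrite exchange_big; apply: eq_bigr => p _.
by rewrite -sum1dep_card [RHS]big_mkcond /=; apply: eq_bigr => l _; case: inc.
Qed.

(** Otherwise the lines disjoint from l meet pairwise, so they are at most 6, and at least 12 lines
    meet l. As l has at most 3 points with at most 4 further lines each, equality holds throughout:
    there are 19 lines of 3 points, every point is on 0 or 5 lines, and 5 would divide 57. *)
Lemma three_disjoint : 19 <= #|L| -> exists l1 l2 l3,
  [/\ l1 != l2, l1 != l3 & l2 != l3] /\ [/\ ~~ meet l1 l2, ~~ meet l1 l3 & ~~ meet l2 l3].
Proof.
move=> L19.
pose dis := [exists l1, exists l2, exists l3, [&& l1 != l2, l1 != l3, l2 != l3,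
  ~~ meet l1 l2, ~~ meet l1 l3 & ~~ meet l2 l3]].
have [|nodis] := boolP dis.
  by move=> /existsP[l1 /existsP[l2 /existsP[l3 /and5P[n1 n2 n3 d1 /andP[d2 d3]]]]]; exists l1, l2, l3.
exfalso.
pose M l := [set m | (m != l) && meet l m]; pose N l := [set m | (m != l) && ~~ meet l m].
have MN l : #|L| = (#|M l| + #|N l|).+1.
  rewrite -cardsT (cardsD1 l) inE -cardsUI add1n; congr _.+1.
  have -> : M l :&: N l = set0 by apply/setP => m; rewrite !inE; case: meet; rewrite ?andbF.
  rewrite cards0 addn0; apply: eq_card => m; rewrite !inE; case: meet; rewrite /= ?andbT ?andbF ?orbF //.
have N6 l : #|N l| <= 6.
  apply: meeting_le6 => m m'; rewrite !inE => /andP[n1 d1] /andP[n2 d2] n3.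
  apply: contraNT nodis => d3; apply/existsP; exists l; apply/existsP; exists m; apply/existsP; exists m'.
  by rewrite n3 d1 d2 d3 !(eq_sym l) n1 n2.
have M12 l : 12 <= #|M l| by have := MN l; have := N6 l; lia.
have Msum l : #|M l| <= \sum_(p in pts l) #|lns p :\ l|.
  have sub : M l \subset \bigcup_(p in pts l) (lns p :\ l).
    apply/subsetP => m; rewrite inE => /andP[n /existsP[p /andP[lp mp]]].
    by apply/bigcupP; exists p; rewrite !inE ?n.
  apply: leq_trans (subset_leq_card sub) _.
  elim/big_rec2: _ => [|p n A _ IH]; first by rewrite cards0.
  by apply: leq_trans (leq_card_setU _ _) _; rewrite leq_add2l.
have lnsD l p : p \in pts l -> #|lns p| = #|lns p :\ l|.+1.
  by rewrite inE => lp; rewrite (cardsD1 l) inE lp.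
have le4 l p : p \in pts l -> #|lns p :\ l| <= 4.
  by move=> h; have := lns_le5 p; rewrite (lnsD _ _ h).
have sum_le l (A : {set P}) : A \subset pts l -> \sum_(p in A) #|lns p :\ l| <= 4 * #|A|.
  move=> sub; rewrite mulnC -sum_nat_const; apply: leq_sum => p pA.
  exact: le4 (subsetP sub p pA).
have full l p : p \in pts l -> #|lns p| = 5.
  move=> h; have := Msum l; rewrite (bigD1 p) //= => hs.
  have := sum_le l (pts l :\ p) (subD1set _ _).
  under eq_bigl do rewrite in_setD1 andbC.
  have := pts_le3 l; rewrite (cardsD1 p) h (lnsD _ _ h).
  by have := le4 _ _ h; have := M12 l; lia.
have three l : #|pts l| = 3.
  by have := Msum l; have := sum_le l (pts l) (subxx _); have := pts_le3 l; have := M12 l; lia.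
have L19' : #|L| = 19.
  have [l _] : exists l : L, l \in [set: L] by apply/set0Pn; rewrite -card_gt0 cardsT; lia.
  have := MN l; have := N6 l; have := Msum l; have := sum_le l (pts l) (subxx _); rewrite three; lia.
have := double_count; rewrite (eq_bigr (fun=> 3)) => [|l _]; last exact: three.
have -> : \sum_(l : L) 3 = \sum_(l in [set: L]) 3 by apply: eq_bigl => l; rewrite inE.
rewrite sum_nat_const cardsT L19' => e57.
have : 5 %| \sum_p #|lns p|.
  apply: dvdn_sum => p _; have [->|/set0Pn[l hl]] := eqVneq (lns p) set0; first by rewrite cards0.
  have -> : #|lns p| = 5 by apply: (@full l); rewrite inE; rewrite inE in hl.
  by [].
by rewrite -e57.
Qed.

(** g i is the point set of the i-th covering line, and A charges each deficient line, one with at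
    most two points, to a covering line that is itself deficient. With b deficient lines, [#|P|] + b
    <= 12 and 3 ([#|L|] - b) <= 5 [#|P|]; the total 31 then leaves b = 0 and 12 points. *)
Lemma config_12_19 (g : 'I_4 -> {set P}) (A : L -> 'I_4 -> Prop) :
  #|L| + #|P| = 31 -> (forall p, exists i, p \in g i) -> (forall i, #|g i| <= 3) ->
  (forall l, #|pts l| <= 2 -> exists i, A l i) ->
  (forall l l' i, A l i -> A l' i -> #|pts l| <= 2 -> #|pts l'| <= 2 -> l = l') ->
  (forall l i, A l i -> #|pts l| <= 2 -> #|g i| <= 2) ->
  [/\ #|L| = 19, #|P| = 12 & forall l, #|pts l| = 3].
Proof.
move=> e31 cov g3 ex uq gle.
pose bad := [set l | #|pts l| <= 2]; pose I := [set i | #|g i| <= 2].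
have [f hf] : exists f : L -> 'I_4, forall l, l \in bad -> A l (f l).
  suff h l : exists i, l \in bad -> A l i.
    have [f hf] := fin_all_exists h; by exists f.
  rewrite inE; have [/ex[i hi]|_] := leqP #|pts l| 2; first by exists i.
  by exists ord0.
have bI : #|bad| <= #|I|.
  have inj : {in bad &, injective f}.
    move=> l l' hl hl' e; have al := hf _ hl; have al' := hf _ hl'; rewrite -e in al'.
    by move: (hl) (hl'); rewrite !inE => h h'; exact: (uq _ _ _ al al' h h').
  rewrite -(card_in_imset inj); apply: subset_leq_card; apply/subsetP => _ /imsetP[l hl ->].
  by rewrite inE; apply: (gle l); [exact: hf | move: hl; rewrite inE].
have P12 : #|P| + #|I| <= 12.
  have : #|P| <= \sum_i #|g i|.
    rewrite -cardsT; have sub : [set: P] \subset \bigcup_i g i.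
      by apply/subsetP => p _; have [i hi] := cov p; apply/bigcupP; exists i.
    apply: leq_trans (subset_leq_card sub) _.
    elim/big_rec2: _ => [|p n B _ IH]; first by rewrite cards0.
    by apply: leq_trans (leq_card_setU _ _) _; rewrite leq_add2l.
  have : \sum_i #|g i| + #|I| <= \sum_(i < 4) 3.
    rewrite -sum1dep_card [X in _ + X]big_mkcond /= -big_split /=.
    by apply: leq_sum => i _; have := g3 i; case: (leqP #|g i| 2) => /=; lia.
  by rewrite sum_nat_const card_ord; lia.
have cnt : 3 * (#|L| - #|bad|) <= 5 * #|P|.
  apply: (@leq_trans (\sum_l #|pts l|)).
    rewrite -cardsT -cardsDS ?subsetT // mulnC -sum_nat_const [X in _ <= X](bigID (mem (~: bad))) /=.
    apply: leq_trans _ (leq_addr _ _); rewrite setTD; apply: leq_sum => l.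
    by rewrite !inE -ltnNge.
  rewrite double_count mulnC -sum_nat_const; apply: leq_sum => p _; exact: lns_le5.
have b0 : #|bad| = 0 by have := max_card (mem bad); lia.
split; [lia | lia | move=> l; apply/eqP; rewrite eqn_leq pts_le3 ltnNge /=].
by apply/negP => h; have : l \in bad by [rewrite inE]; rewrite (cards0_eq b0) inE.
Qed.

End Incidence.

Lemma card_seq_sub_count (T : choiceType) (s : seq T) (a : pred T) : uniq s ->
  #|[set x : seq_sub s | a (val x)]| = count a s.
Proof.
move=> u; rewrite cardE -(size_map val) -size_filter; apply/perm_size/uniq_perm.
- by rewrite map_inj_uniq ?enum_uniq //; exact: val_inj.
- exact: filter_uniq.
move=> x; rewrite mem_filter; apply/mapP/andP => [[y]|[ax xs]].
  by rewrite mem_enum inE => ay ->; split=> //; exact: ssvalP.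
by exists (SeqSub xs); rewrite // mem_enum inE.
Qed.

(** * The incidence structure of the surface *)

Section Structure.
Variable K : fieldType.
Hypothesis charK : [pchar K] =i pred0.
Local Notation pt := (pt K).
Implicit Types (p l m P Q X : pt) (x y z s t u v : K).
Variables F3 F4 : pt -> K.
Variables ps ls : seq pt.
Hypothesis H : monoid_config F3 F4 ps ls.

Lemma count_ge3 p q r (l : pt) : uniq [:: p; q; r] -> {subset [:: p; q; r] <= ps} ->
  dot l p = 0 -> dot l q = 0 -> dot l r = 0 -> (3 <= count (fun p => dot l p == 0%R) ps)%N.
Proof.
move=> u sub lp lq lr; rewrite -size_filter; apply: (@uniq_leq_size _ [:: p; q; r]) => // x hx.
rewrite mem_filter sub // andbT; move: hx.
by rewrite !inE => /or3P[] /eqP ->; apply/eqP.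
Qed.

Lemma ls_eq l m p q : l \in ls -> m \in ls -> p \in ps -> q \in ps -> p != q ->
  dot l p = 0 -> dot l q = 0 -> dot m p = 0 -> dot m q = 0 -> l = m.
Proof.
move=> lin min pin qin pq lp lq mp mq; apply: (ls_inj H) => //.
apply: (@cross_lines _ p q) => //; apply: contra_neq pq; exact: (ps_inj H).
Qed.

Lemma lns_count_le5 p : p \in ps -> (count (fun l => dot l p == 0%R) ls <= 5)%N.
Proof.
move=> pin; have bp := ps_base H pin.
have [o2|[q [r fr]]] := smooth_or_nodal (cubic_form H) bp; last exact: (pencil_le5 charK H bp fr).
apply: (@leq_trans 1) => //; rewrite -size_filter.
have : uniq [seq l <- ls | dot l p == 0] by rewrite filter_uniq // (ls_uniq H).
case e : [seq l <- ls | dot l p == 0] => [|l [|m s]] //=.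
have : m \in [seq l <- ls | dot l p == 0] by rewrite e !inE eqxx orbT.
have : l \in [seq l <- ls | dot l p == 0] by rewrite e !inE eqxx.
rewrite !mem_filter => /andP[/eqP lp lin] /andP[/eqP mp min].
suff -> : l = m by rewrite inE eqxx.
apply: (ls_inj H) => //; apply: (nodal_line charK H bp o2) => //; exact: (ls_lift H).
Qed.

(** F3 has a double root at p on l, hence at most one other zero there. *)
Lemma nodal_on_line_le2 l P p : l != null K -> dot l P = 0 -> F3 P != 0 ->
  p \in ps -> order2 F3 p -> dot l p = 0 -> (count (fun q => dot l q == 0%R) ps <= 2)%N.
Proof.
move=> l0 lP P3 pin o2 lp; rewrite leqNgt; apply/negP => gt2.
rewrite -size_filter in gt2; set xs := filter _ _ in gt2.
have u : uniq xs by rewrite filter_uniq // (ps_uniq H).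
have pxs : p \in xs by rewrite mem_filter lp eqxx.
have inx q : q \in rem p xs -> [/\ q != p, q \in ps & dot l q = 0].
  by rewrite (mem_rem_uniq p u) inE mem_filter => /and3P[h /eqP lq qin].
have gt1 : (1 < size (rem p xs))%N by rewrite size_rem //; case: (size xs) gt2.
have := rem_uniq p u; case: (rem p xs) inx gt1 => [|q [|r s]] // inx _ ur.
have [qp qin lq] := inx q (mem_head _ _).
have [rp rin lr] : [/\ r != p, r \in ps & dot l r = 0] by apply: inx; rewrite !inE eqxx orbT.
have qr : q != r by move: ur => /= /andP[]; rewrite inE negb_or => /andP[].
have [p0 p3 _] := ps_base H pin; have [q0 q3 _] := ps_base H qin; have [r0 r3 _] := ps_base H rin.
have Xpq : cross p q != null K.
  by apply: contraNneq qp => e; rewrite (ps_inj H pin qin e).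
have [w hw] := null_dot Xpq; rewrite dot_cross in hw.
have [c0 [c1 [c2 [c3 [c4 [c5 [c6 [c7 [c8 [c9 h3]]]]]]]]]] := frame_coef3 (cubic_form H) p q w.
have [e0 e1 _] := order2_coef3 charK p3 o2 h3.
have e6 : c6 = 0.
  have := h3 0 1 0; have -> : cmb p q w 0 1 0 = q by apply: pt_ext => /=; ring.
  by rewrite q3 => ->; ring.
have hF x y : F3 (seg p q x y) = c3 * (x * y ^+ 2).
  have -> : seg p q x y = cmb p q w x y 0 by apply: pt_ext => /=; ring.
  by rewrite h3 e0 e1 e6; ring.
have [x [y e]] := on_line Xpq lp lq l0 lr.
have x0 : x != 0.
  apply: contraNneq qr => x0; apply/eqP/(ps_inj H) => //; rewrite e x0.
  by apply: pt_ext => /=; ring.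
have y0 : y != 0.
  apply: contraNneq rp => y0; apply/eqP/(ps_inj H) => //; rewrite e y0.
  by apply: pt_ext => /=; ring.
have c30 : c3 = 0.
  move: r3; rewrite e hF => /eqP; rewrite mulf_eq0 => /orP[/eqP //|].
  by rewrite mulf_eq0 expf_eq0 (negbTE x0) (negbTE y0).
have [x' [y' e']] := on_line Xpq lp lq l0 lP.
by move: P3; rewrite e' hF c30 mul0r eqxx.
Qed.

(** The zeros of the three factors on l are base points, so two of them coincide, and a double root
    of F3 on a lifting line is a point of order 2. *)
Lemma split_cubic l (g1 g2 g3 : pt) k : lifts F3 F4 l ->
  cross l g1 != null K -> cross l g2 != null K -> cross l g3 != null K ->
  (forall P, dot l P = 0 -> F3 P = k * (dot g1 P * dot g2 P * dot g3 P)) ->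
  (count (fun p => dot l p == 0%R) ps <= 2)%N ->
  exists2 p, p \in ps & order2 F3 p /\ dot l p = 0.
Proof.
move=> L n1 n2 n3 e le2; have [l0 [a ha]] := L.
have root g : cross l g != null K -> (forall P, dot l P = 0 -> dot g P = 0 -> F3 P = 0) ->
    exists2 p, p \in ps & dot l p = 0 /\ dot g p = 0.
  move=> n z; have lX : dot l (cross l g) = 0 by rewrite dotC dot_crossl.
  have gX : dot g (cross l g) = 0 by rewrite dotC dot_crossr.
  have X3 := z _ lX gX; have [|p pin ep] := ps_all H (_ : base_pt F3 F4 (cross l g)).
    by split=> //; rewrite ha // X3 mulr0.
  have [c pE] := cross_null n ep; exists p => //.
  by rewrite pE !dot_scal lX gX mulr0.
have dbl (h1 h2 h3 : pt) p : p \in ps -> dot l p = 0 -> dot h1 p = 0 -> dot h2 p = 0 ->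
    (forall P, dot l P = 0 -> F3 P = k * (dot h1 P * dot h2 P * dot h3 P)) ->
    exists2 p, p \in ps & order2 F3 p /\ dot l p = 0.
  move=> pin lp p1 p2 eF; exists p => //; split=> //.
  have bp := ps_base H pin; have [p0 _ _] := bp.
  have [Q pQ lQ] := line_complete l0 p0 lp.
  apply: (double_root_nodal charK H bp L lp lQ pQ
    (r := (k * dot h1 Q * dot h2 Q)%:P * ((dot h3 p)%:P + (dot h3 Q)%:P * 'X))) => s.
  rewrite eF; last by rewrite dot_seg lp lQ; ring.
  by rewrite !dot_seg p1 p2 !(hornerM, hornerD, hornerC, hornerX); ring.
have [p1 i1 [a1 b1]] : exists2 p, p \in ps & dot l p = 0 /\ dot g1 p = 0.
  by apply: root => // P lP gP; rewrite e // gP; ring.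
have [p2 i2 [a2 b2]] : exists2 p, p \in ps & dot l p = 0 /\ dot g2 p = 0.
  by apply: root => // P lP gP; rewrite e // gP; ring.
have [p3 i3 [a3 b3]] : exists2 p, p \in ps & dot l p = 0 /\ dot g3 p = 0.
  by apply: root => // P lP gP; rewrite e // gP; ring.
have [E|n12] := eqVneq p1 p2; first by rewrite -E in b2; exact: (dbl g1 g2 g3 p1).
have [E|n13] := eqVneq p1 p3.
  by rewrite -E in b3; apply: (dbl g1 g3 g2 p1) => // P lP; rewrite e //; ring.
have [E|n23] := eqVneq p2 p3.
  by rewrite -E in b3; apply: (dbl g2 g3 g1 p2) => // P lP; rewrite e //; ring.
have : (3 <= count (fun p => dot l p == 0%R) ps)%N.
  apply: (@count_ge3 p1 p2 p3) => //; first by rewrite /= !inE negb_or n12 n13 n23.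
  by move=> x; rewrite !inE => /or3P[] /eqP ->.
by rewrite ltnNge le2.
Qed.

(** One of the four factors vanishes where b does. Cancelling both leaves F3 as a product of three
    linear forms over [K]; this stands in for algebraic closure. *)
Lemma split_line l (g1 g2 g3 g4 b : pt) : lifts F3 F4 l ->
  cross l g1 != null K -> cross l g2 != null K -> cross l g3 != null K -> cross l g4 != null K ->
  (forall P, dot l P = 0 -> dot b P * F3 P = dot g1 P * dot g2 P * dot g3 P * dot g4 P) ->
  (count (fun p => dot l p == 0%R) ps <= 2)%N ->
  exists2 p, p \in ps & order2 F3 p /\ dot l p = 0.
Proof.
move=> L n1 n2 n3 n4 e le2; have [l0 _] := L.
have X0 : cross l b != null K.
  apply/eqP => eX; have [c bE] := cross_null l0 eX.
  have z P : dot l P = 0 -> dot g1 P * (dot g2 P * (dot g3 P * dot g4 P)) = 0.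
    move=> lP; transitivity (dot b P * F3 P); first by rewrite e //; ring.
    by rewrite bE dotC dot_scal dotC lP mulr0 mul0r.
  have f1 := form_lin g4; have f2 := form_dot g3 f1; have f3 := form_dot g2 f2.
  have z1 := line_cancel charK f3 n1 z.
  have z2 := line_cancel charK f2 n2 z1.
  have z3 := line_cancel charK f1 n3 z2.
  have [Q hQ lQ] := line_complete l0 n4 (etrans (dotC _ _) (dot_crossl _ _)).
  by have := meet_neq0 n4 lQ hQ; rewrite z3 ?eqxx.
have lR : dot l (cross l b) = 0 by rewrite dotC dot_crossl.
have bR : dot b (cross l b) = 0 by rewrite dotC dot_crossr.
have main (h1 h2 h3 h4 : pt) : cross l h2 != null K -> cross l h3 != null K -> cross l h4 != null K ->
    dot h1 (cross l b) = 0 ->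
    (forall P, dot l P = 0 -> dot b P * F3 P = dot h1 P * dot h2 P * dot h3 P * dot h4 P) ->
    exists2 p, p \in ps & order2 F3 p /\ dot l p = 0.
  move=> m2 m3 m4 h1R eh; have [k hk] := prop_on_line X0 h1R.
  apply: (split_cubic (k := k) L m2 m3 m4) => // P lP; apply/eqP; rewrite -subr_eq0; apply/eqP.
  have fG : form 3 (fun P => F3 P - k * (dot h2 P * (dot h3 P * dot h4 P))) :=
    form_sub (cubic_form H) (form_scale k (form_dot h2 (form_dot h3 (form_lin h4)))).
  have := line_cancel charK fG X0 _ lP; rewrite !mulrA; apply=> R hR.
  by rewrite mulrBr eh // (hk R hR); ring.
have /eqP := e _ lR; rewrite bR mul0r eq_sym !mulf_eq0 -!orbA => /or4P[] /eqP h.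
- by apply: (main g1 g2 g3 g4).
- by apply: (main g2 g1 g3 g4) => // P lP; rewrite e //; ring.
- by apply: (main g3 g1 g2 g4) => // P lP; rewrite e //; ring.
- by apply: (main g4 g1 g2 g3) => // P lP; rewrite e //; ring.
Qed.

Local Notation L := (seq_sub ls).
Local Notation Pt := (seq_sub ps).
(** Base points and lifting lines become finite types, to which the abstract counting applies. *)
Definition inc (l : L) (p : Pt) := dot (val l) (val p) == 0.

Lemma inc_two (l m : L) (p q : Pt) : inc l p -> inc l q -> inc m p -> inc m q -> p != q -> l = m.
Proof.
move=> /eqP lp /eqP lq /eqP mp /eqP mq pq; apply: val_inj.
by apply: (ls_eq (ssvalP l) (ssvalP m) (ssvalP p) (ssvalP q)); rewrite ?val_eqE.
Qed.

Lemma card_pts (l : L) : #|pts inc l| = count (fun p => dot (val l) p == 0%R) ps.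
Proof. exact: (card_seq_sub_count _ (ps_uniq H)). Qed.

Lemma card_lns (p : Pt) : #|lns inc p| = count (fun l => dot l (val p) == 0%R) ls.
Proof. exact: (card_seq_sub_count (fun l => dot l (val p) == 0%R) (ls_uniq H)). Qed.

Lemma inc_le3 (l : L) : (#|pts inc l| <= 3)%N.
Proof.
have [P lP P3] := lift_cubic_neq0 charK H (ls_lift H (ssvalP l)).
have [l0 _] := ls_lift H (ssvalP l).
by rewrite card_pts; exact: (base_on_line_le3 charK H l0 lP).
Qed.

Lemma inc_le5 (p : Pt) : (#|lns inc p| <= 5)%N.
Proof. by rewrite card_lns; apply/lns_count_le5/ssvalP. Qed.

Lemma inc_fano (p q r x y z w : Pt) (a b c dp dq dr d : L) :
  q != r -> ~~ inc c p -> [/\ x != p, x != q, y != p, y != r & (z != q) && (z != r)] ->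
  [/\ inc a p, inc a q & inc a x] -> [/\ inc b p, inc b r & inc b y] ->
  [/\ inc c q, inc c r & inc c z] -> [/\ inc dp p, inc dp z & inc dp w] ->
  [/\ inc dq q, inc dq y & inc dq w] -> [/\ inc dr r, inc dr x & inc dr w] ->
  [/\ inc d x, inc d y & inc d z] -> False.
Proof.
move=> qr cp [xp xq yp yr /andP[zq zr]] [/eqP ap /eqP aq /eqP ax] [/eqP bp /eqP br /eqP by_].
move=> [/eqP cq /eqP cr /eqP cz] [/eqP pp /eqP pz /eqP pw] [/eqP qq /eqP qy /eqP qw].
move=> [/eqP rr /eqP rx /eqP rw] [/eqP dx /eqP dy /eqP dz].
have nl (l : L) : val l != null K by have [] := ls_lift H (ssvalP l).
have nX (u v : Pt) : v != u -> cross (val u) (val v) != null K.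
  move=> ne; apply: contraNneq ne => e.
  by apply/eqP/val_inj/esym/(ps_inj H (ssvalP u) (ssvalP v)).
have [w0 _ _] := ps_base H (ssvalP w).
have det0 : det3 (val p) (val q) (val r) != 0.
  apply: contra cp => /eqP e; rewrite /inc.
  have X0 : cross (val q) (val r) != null K by apply: nX; rewrite eq_sym.
  have [k ->] := line_through X0 cq cr.
  by rewrite dotC dot_scal -/(det3 _ _ _) e mulr0.
exact: (no_fano charK det0 (nl a) (nl b) (nl c) (nl dp) (nl dq) (nl dr) (nl d) w0
  (nX _ _ xp) (nX _ _ xq) (nX _ _ yp) (nX _ _ yr) (nX _ _ zq) (nX _ _ zr)).
Qed.

Lemma not_meet_disjoint (l m : L) : l != m -> ~~ meet inc l m -> F3 (cross (val l) (val m)) != 0.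
Proof.
move=> ne; apply: contra => /eqP e.
have X0 : cross (val l) (val m) != null K.
  by apply: contraNneq ne => h; apply/eqP/val_inj/(ls_inj H (ssvalP l) (ssvalP m)).
have [p pin [lp mp]] := meet_base H (ls_lift H (ssvalP l)) (ls_lift H (ssvalP m)) X0 e.
by apply/existsP; exists (SeqSub pin); rewrite /inc /= lp mp eqxx.
Qed.

Hypothesis total : (size ps + size ls = 31)%N.

(** With fewer lines there are more than 12 base points, so no two lifting lines are disjoint. They
    are then at most 6, which leaves at least 25 base points, more than the 22 allowed by a base
    point where the cubic is smooth. *)
Lemma ls_ge19 : (19 <= size ls)%N.
Proof.
rewrite leqNgt; apply/negP; rewrite ltnS => le18.
have [|nod] := boolP [exists l : L, exists m : L, (l != m) && ~~ meet inc l m].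
  move=> /existsP[l /existsP[m /andP[ne nm]]].
  have := disjoint_pair_le12 charK H (ls_lift H (ssvalP l)) (ls_lift H (ssvalP m)) (not_meet_disjoint ne nm).
  by lia.
have : (size ls <= 6)%N.
  rewrite -(card_seq_sub (ls_uniq H)) -cardsT.
  apply: (meeting_le6 inc_two inc_le3 inc_le5 inc_fano) => l m _ _ ne.
  apply: contraNT nod => nm; apply/existsP; exists l; apply/existsP; exists m.
  by rewrite ne.
have [p pin ns] : exists2 p, p \in ps & ~ order2 F3 p by apply: (exists_smooth charK H); lia.
have [//|[q [r fr]]] := smooth_or_nodal (cubic_form H) (ps_base H pin).
by have := base_le22 charK H (ps_base H pin) fr; lia.
Qed.

Lemma four_lines : exists l1 l2 l3 l4 : pt,
  [/\ l1 \in ls, l2 \in ls, l3 \in ls & l4 \in ls] /\ [/\ size ls = 19, size ps = 12,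
    forall l, l \in ls -> count (fun p => dot l p == 0%R) ps = 3 &
    forall p, p \in ps -> has (fun l => dot l p == 0%R) [:: l1; l2; l3; l4]]%N.
Proof.
have L19 : (19 <= #|{: L}|)%N by rewrite (card_seq_sub (ls_uniq H)) ls_ge19.
have [l1 [l2 [l3 [[n12 n13 n23] [m12 m13 m23]]]]] := three_disjoint inc_two inc_le3 inc_le5 inc_fano L19.
have lf (l : L) := ls_lift H (ssvalP l).
have [a [n eF]] := residual_line charK H (lf l1) (lf l2) (lf l3)
  (not_meet_disjoint n12 m12) (not_meet_disjoint n13 m13) (not_meet_disjoint n23 m23).
have n0 : n != null K.
  apply/eqP => n0; apply: (@not_multiple _ charK _ _ _ _ H a) => P; rewrite eF n0.
  by rewrite [dot (null K) _](_ : _ = 0) ?mulr0 ?addr0 // /dot /=; ring.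
have nl : lifts F3 F4 n by split=> //; exists a => P nP; rewrite eF nP mulr0 addr0.
have [l4 l4in e4] := ls_all H nl.
have [k4 E4] := cross_null n0 e4.
have k40 : k4 != 0 by case: (@scal_neq0 _ k4 n) => //; rewrite -E4; case: (ls_lift H l4in).
pose g := tnth [tuple val l1; val l2; val l3; l4].
have gin i : g i \in ls.
  have : g i \in [tuple val l1; val l2; val l3; l4] by exact: mem_tnth.
  by rewrite !inE => /or4P[] /eqP -> //; exact: ssvalP.
have cov p : p \in ps -> has (fun l => dot l p == 0) [:: val l1; val l2; val l3; l4].
  move=> pin; have [_ p3 p4] := ps_base H pin; have := eF p.
  rewrite p3 p4 mulr0 add0r => /esym/eqP; rewrite !mulf_eq0 -!orbA /= orbF => h.
  suff -> : (dot l4 p == 0) = (dot n p == 0) by [].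
  by rewrite E4 dotC dot_scal dotC mulf_eq0 (negbTE k40).
(* A line is charged to itself when it is one of the four, or to one of them sharing with it a base
   point where F3 has order 2. Such a point is on one lifting line only, which makes the charge
   injective. *)
pose A (l : L) i := cross (val l) (g i) = null K \/
  exists2 p, p \in ps & [/\ order2 F3 p, dot (val l) p = 0 & dot (g i) p = 0].
have gc i : #|[set p : Pt | dot (g i) (val p) == 0]| = count (fun p => dot (g i) p == 0%R) ps.
  exact: (card_seq_sub_count (fun p => dot (g i) p == 0%R) (ps_uniq H)).
have [||||||LE PE three] := @config_12_19 L Pt inc inc_le3 inc_le5 (fun i => [set p : Pt | dot (g i) (val p) == 0]) A.
- by rewrite !card_seq_sub ?(ps_uniq H) ?(ls_uniq H) // addnC.
- move=> p; have /hasP[l lin lp] := cov _ (ssvalP p).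
  have lin' : l \in [tuple val l1; val l2; val l3; l4] by [].
  by have [i e] := tnthP _ _ lin'; exists i; rewrite inE /g -e.
- move=> i; rewrite gc; have [P lP P3] := lift_cubic_neq0 charK H (ls_lift H (gin i)).
  by have [g0 _] := ls_lift H (gin i); exact: (base_on_line_le3 charK H g0 lP).
- move=> l; rewrite card_pts => bad.
  have [|nprop] := boolP [exists i, cross (val l) (g i) == null K].
    by case/existsP => i /eqP e; exists i; left.
  have np i : cross (val l) (g i) != null K by apply: contra nprop => e; apply/existsP; exists i.
  have [_ [b hb]] := lf l.
  (* Compares the two expressions of F4 on l, by its own multiplier b and by the four lines; k4
     passes from n to its representative l4. *)
  have e P : dot (val l) P = 0 -> dot (scal k4 (seg b a 1 (-1))) P * F3 P =
      dot (val l1) P * dot (val l2) P * dot (val l3) P * dot l4 P.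
    move=> lP; rewrite dotC dot_scal dotC dot_segl E4 (dotC (scal k4 n)) dot_scal (dotC P).
    have := eF P; rewrite hb // => e; rewrite mulrCA.
    transitivity (k4 * (dot b P * F3 P - dot a P * F3 P)); first ring.
    by rewrite e; ring.
  have := np (@Ordinal 4 0 isT); have := np (@Ordinal 4 1 isT).
  have := np (@Ordinal 4 2 isT); have := np (@Ordinal 4 3 isT).
  rewrite /g !(tnth_nth (null K)) /= => h4 h3 h2 h1.
  have [p pin [o2 lp]] := split_line (lf l) h1 h2 h3 h4 e bad.
  have /hasP[m min /eqP mp] := cov _ pin.
  have min' : m \in [tuple val l1; val l2; val l3; l4] by [].
  by have [i ei] := tnthP _ _ min'; exists i; right; exists p; rewrite // /g -ei.
- have nd (l l' : L) i : cross (val l) (g i) = null K -> A l' i -> l = l'.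
    move=> e [e'|[p pin [o2 l'p gp]]]; apply: val_inj.
      exact: (etrans (ls_inj H (ssvalP l) (gin i) e) (esym (ls_inj H (ssvalP l') (gin i) e'))).
    apply: (etrans (ls_inj H (ssvalP l) (gin i) e)); apply: (ls_inj H (gin i) (ssvalP l')).
    exact: (nodal_line charK H (ps_base H pin) o2 (ls_lift H (gin i)) (lf l')).
  move=> l l' i [e|[p pin [o2 lp gp]]] A' _ _; first exact: (nd _ _ i).
  case: (A') => [e|[p' p'in [o2' l'p' gp']]].
    by apply/esym/(nd _ _ i e); right; exists p.
  have [epp|npp] := eqVneq p p'.
    rewrite -epp in l'p'; apply/val_inj/(ls_inj H (ssvalP l) (ssvalP l')).
    exact: (nodal_line charK H (ps_base H pin) o2 (lf l) (lf l')).
  have [X0 z3] := nodal_chord charK H pin p'in npp o2 o2'.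
  have [P gP P3] := lift_cubic_neq0 charK H (ls_lift H (gin i)).
  have [g0 _] := ls_lift H (gin i).
  have [c gE] := line_through X0 gp gp'.
  case/eqP: P3; apply: z3; move: gP g0; rewrite gE dotC dot_scal dotC => /eqP.
  rewrite mulf_eq0 => /orP[/eqP c0|/eqP //].
  by rewrite c0 => /scal_neq0[]; rewrite eqxx.
- move=> l i hA; rewrite card_pts gc => bad.
  case: hA => [e|[p pin [o2 lp gp]]].
    by rewrite -(ls_inj H (ssvalP l) (gin i) e).
  have [P gP P3] := lift_cubic_neq0 charK H (ls_lift H (gin i)).
  have [g0 _] := ls_lift H (gin i).
  exact: (nodal_on_line_le2 g0 gP P3 pin o2 gp).
exists (val l1), (val l2), (val l3), l4; split.
  by split=> //; exact: ssvalP.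
rewrite (card_seq_sub (ls_uniq H)) in LE; rewrite (card_seq_sub (ps_uniq H)) in PE.
by split=> // l lin; have := three (SeqSub lin); rewrite card_pts.
Qed.

End Structure.

(** * The incidence table *)

Section Search.
Local Open Scope nat_scope.

(* Twelve points are numbered 0..11.  A table stores at (i, j) the third point of
   the line joining i and j, 12 if there is no such line, 13 if it is unknown. *)
Definition table := seq (seq nat).
Definition get (s : table) i j := nth 13 (nth [::] s i) j.
Definition put (s : table) i j v := set_nth [::] s i (set_nth 13 (nth [::] s i) j v).

Definition state := (table * seq (seq nat))%type.

(** Continuation-passing: k runs on the completed table, and a contradictory entry closes the branch
    with [true]. *)
Definition set2 (t : table) i j v (k : table -> bool) : bool :=
  let w := get t i j in
  if w == 13 then k (put (put t i j v) j i v) else if w == v then k t else true.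

Definition assign (s : state) i j v (k : state -> bool) : bool :=
  if v == 12 then set2 s.1 i j 12 (fun t => k (t, s.2))
  else if [|| v == i, v == j | i == j] then true
  else set2 s.1 i j v (fun t => set2 t i v j (fun t => set2 t j v i
        (fun t => k (t, [:: i; j; v] :: s.2)))).

Definition perms3 := [:: [:: 0; 1; 2]; [:: 0; 2; 1]; [:: 1; 0; 2]; [:: 1; 2; 0]; [:: 2; 0; 1]; [:: 2; 1; 0]].

(** The closure rule for l and m with their points matched by o. It yields nothing unless the three
    third points are known and distinct, nor when their line is already recorded. *)
Definition grid_thirds (t : table) (l m : seq nat) (o : seq nat) : option (nat * nat * nat) :=
  let r1 := get t (nth 0 l 0) (nth 0 m (nth 0 o 0)) in
  if 12 <= r1 then None else
  let r2 := get t (nth 0 l 1) (nth 0 m (nth 0 o 1)) in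
  if (12 <= r2) || (r1 == r2) then None else
  let r3 := get t (nth 0 l 2) (nth 0 m (nth 0 o 2)) in
  if [|| 12 <= r3, r1 == r3 | r2 == r3] then None else
  if get t r1 r2 == r3 then None else Some (r1, r2, r3).

Fixpoint first_some (A B : Type) (f : A -> option B) (s : seq A) : option B :=
  if s is x :: s' then (if f x is Some y then Some y else first_some f s') else None.

Fixpoint find_grid (t : table) (ls : seq (seq nat)) : option (nat * nat * nat) :=
  if ls is l :: ls' then
    match first_some (fun m => if has (fun x => x \in m) l then None
                               else first_some (grid_thirds t l m) perms3) ls' with
    | Some r => Some r
    | None => find_grid t ls'
    end
  else None.

Definition unlinked (t : table) i := count (fun j => get t i j == 12) (iota 0 12).

(** A point on d lines is joined to 2 d others and misses 11 - 2 d, an odd number. The degrees add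
    up to 57, so these numbers add up to 132 - 114 = 18. Known gaps are therefore rounded up to odd
    numbers before summing. *)
Definition too_sparse (t : table) :=
  18 < foldr (fun i n => (unlinked t i + ~~ odd (unlinked t i)) + n) 0 (iota 0 12).

Definition candidates (t : table) i j :=
  [seq v <- iota 0 12 | [&& v != i, v != j, get t i v == 13 & get t j v == 13]].

(** Branching on the pair with the fewest possible third points keeps the search small; the initial
    13 exceeds every count of candidates. Soundness only uses that the two points are distinct. *)
Definition pick_pair (t : table) : option (nat * nat) :=
  let best := foldr (fun ij acc => if ij.1 < ij.2 then
      if get t ij.1 ij.2 == 13 then
        let c := size (candidates t ij.1 ij.2) in
        if c < acc.1 then (c, Some ij) else acc else acc else acc)
    (13, None) [seq (i, j) | i <- iota 0 12, j <- iota 0 12] in best.2.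

Definition model_lines := [:: (0,1,2); (0,4,5); (0,6,7); (0,9,10); (1,3,4); (1,6,9); (1,7,8);
  (1,10,11); (2,3,5); (2,6,8); (2,7,10); (2,9,11); (3,6,10); (3,7,9); (3,8,11); (4,6,11);
  (4,8,9); (5,7,11); (5,8,10)].

(* The tables that survive the search are these relabellings of [model_lines]. *)
Definition labellings :=
  [:: [:: 9; 0; 5; 8; 10; 11; 1; 3; 6; 2; 4; 7];
      [:: 9; 0; 5; 8; 10; 11; 4; 6; 3; 7; 1; 2];
      [:: 9; 0; 5; 8; 10; 11; 3; 7; 4; 6; 2; 1];
      [:: 1; 0; 2; 4; 7; 11; 3; 10; 8; 6; 5; 9];
      [:: 2; 0; 1; 7; 4; 11; 3; 8; 10; 6; 9; 5];
      [:: 5; 0; 9; 10; 8; 11; 3; 4; 7; 6; 1; 2];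
      [:: 9; 0; 5; 8; 10; 11; 1; 4; 7; 2; 3; 6];
      [:: 9; 0; 5; 8; 10; 11; 3; 7; 4; 6; 1; 2];
      [:: 9; 0; 5; 8; 10; 11; 4; 6; 3; 7; 2; 1];
      [:: 1; 0; 2; 3; 6; 11; 4; 10; 8; 7; 5; 9];
      [:: 2; 0; 1; 6; 3; 11; 4; 8; 10; 7; 9; 5];
      [:: 5; 0; 9; 10; 8; 11; 4; 3; 6; 7; 1; 2];
      [:: 2; 0; 1; 4; 7; 11; 3; 10; 8; 6; 5; 9];
      [:: 2; 0; 1; 3; 6; 11; 4; 10; 8; 7; 5; 9];
      [:: 1; 0; 2; 7; 4; 11; 3; 8; 10; 6; 9; 5];
      [:: 5; 0; 9; 10; 8; 11; 3; 4; 7; 6; 2; 1];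
      [:: 1; 0; 2; 6; 3; 11; 4; 8; 10; 7; 9; 5];
      [:: 5; 0; 9; 10; 8; 11; 4; 3; 6; 7; 2; 1] ].

Definition is_model (t : table) :=
  has (fun o => all (fun abc => (nth 0 o abc.2 < 12) &&
    (get t (nth 0 o abc.1.1) (nth 0 o abc.1.2) == nth 0 o abc.2))
    model_lines) labellings.

(** A line forced by a grid is entered without branching. Exhausted fuel counts as failure, so
    [true] certifies the whole case analysis. *)
Fixpoint search n (s : state) : bool :=
  if n is n'.+1 then
    if too_sparse s.1 then true else
    match find_grid s.1 s.2 with
    | Some (i, j, v) => assign s i j v (search n')
    | None =>
      match pick_pair s.1 with
      | Some (i, j) => all (fun v => assign s i j v (search n')) (iota 0 13)
      | None => is_model s.1
      end
    end
  else false.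

(* The first four lines partition the points; up to relabelling, the others are lines
   through 0, and 0 and 11 are not joined. *)
Definition start_lines := [:: (0,1,2); (3,4,5); (6,7,8); (9,10,11); (0,3,6); (0,4,7); (0,5,9); (0,8,10)].

Definition start n : bool :=
  foldr (fun abc k s => assign s abc.1.1 abc.1.2 abc.2 k)
    (fun s => assign s 0 11 12 (search n)) start_lines (nseq 12 (nseq 12 13), [::]).

Variable th : nat -> nat -> nat.
Hypothesis th_sym : forall i j, i < 12 -> j < 12 -> i != j -> th i j = th j i.
Hypothesis th_le : forall i j, th i j <= 12.
Hypothesis th_third : forall i j, i < 12 -> j < 12 -> i != j -> th i j < 12 ->
  [/\ th i j != i, th i j != j & th i (th i j) = j].
Hypothesis th_grid : forall a1 a2 a3 b1 b2 b3,
  all (ltn^~ 12) ([:: a1; a2; a3] ++ [:: b1; b2; b3]) -> uniq ([:: a1; a2; a3] ++ [:: b1; b2; b3]) ->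
  th a1 a2 = a3 -> th b1 b2 = b3 -> th a1 b1 < 12 -> th a2 b2 < 12 -> th a3 b3 < 12 ->
  uniq [:: th a1 b1; th a2 b2; th a3 b3] -> th (th a1 b1) (th a2 b2) = th a3 b3.
Definition unlinked_in i := count (fun j => (j != i) && (th i j == 12)) (iota 0 12).
Hypothesis th_odd : forall i, i < 12 -> odd (unlinked_in i).
Hypothesis th_sum : sumn (map unlinked_in (iota 0 12)) = 18.

(** A known entry also certifies that its indices are two distinct points. *)
Definition sound_table (t : table) := forall i j, get t i j = 13 \/
  [/\ i < 12, j < 12, i != j & get t i j = th i j].

Definition sound_line (l : seq nat) := exists a b c,
  [/\ l = [:: a; b; c], [/\ a < 12, b < 12 & c < 12], uniq [:: a; b; c] & th a b = c].

Definition sound (s : state) := sound_table s.1 /\ {in s.2, forall l, sound_line l}.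

Definition modelled := exists2 o, o \in labellings &
  forall abc, abc \in model_lines -> th (nth 0 o abc.1.1) (nth 0 o abc.1.2) = nth 0 o abc.2.

Lemma get_put t i j v i' j' :
  get (put t i j v) i' j' = if (i' == i) && (j' == j) then v else get t i' j'.
Proof.
rewrite /get /put nth_set_nth /=; case: eqP => [->|_] //=.
by rewrite nth_set_nth /=; case: eqP.
Qed.

Lemma set2_sound t i j v k : sound_table t -> i < 12 -> j < 12 -> i != j -> th i j = v ->
  set2 t i j v k -> exists2 t', sound_table t' & k t'.
Proof.
move=> st i12 j12 ij e; rewrite /set2; case: eqP => [_|w13].
  move=> kt; eexists; last exact: kt.
  move=> a b; rewrite !get_put; case: andP => [[/eqP-> /eqP->]|_].
    by right; split; rewrite // 1?eq_sym // th_sym // 1?eq_sym // e.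
  by case: andP => [[/eqP-> /eqP->]|_]; [right; split | apply: st].
case: eqP => [_ kt|wv]; first by exists t.
by case: (st i j) => // [[_ _ _ h]]; case: wv; rewrite h.
Qed.

Lemma assign_sound s i j v k : sound s -> i < 12 -> j < 12 -> i != j -> th i j = v ->
  assign s i j v k -> exists2 s', sound s' & k s'.
Proof.
case: s => t ls [st sl] i12 j12 ij e; rewrite /assign /=; case: (eqVneq v 12) => [v12|v12].
  rewrite v12 in e; move=> /(set2_sound st i12 j12 ij e) [t' st' kt'].
  by exists (t', ls).
have lt : th i j < 12 by rewrite ltn_neqAle th_le e v12.
have [vi vj iv] := th_third i12 j12 ij lt; rewrite e in vi vj iv lt.
rewrite (negbTE vi) (negbTE vj) (negbTE ij) /=.
have jv : th j v = i.
  by have [] := @th_third j i; rewrite // 1?eq_sym // -th_sym // e.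
move=> /(set2_sound st i12 j12 ij e) [t1 st1].
have iv' : i != v by rewrite eq_sym.
have jv' : j != v by rewrite eq_sym.
move=> /(set2_sound st1 i12 lt iv' iv) [t2 st2] /(set2_sound st2 j12 lt jv' jv) [t3 st3] kt.
exists (t3, [:: i; j; v] :: ls) => //; split=> // l; rewrite inE => /orP[/eqP ->|/sl //].
exists i, j, v; split=> //; rewrite /= !inE negb_or ij (eq_sym i v) vi (eq_sym j v) vj //.
Qed.

Lemma too_sparse_sound t : sound_table t -> ~~ too_sparse t.
Proof.
move=> st; rewrite /too_sparse -leqNgt -th_sum.
have le i : i < 12 -> unlinked t i + ~~ odd (unlinked t i) <= unlinked_in i.
  move=> i12; have le : unlinked t i <= unlinked_in i.
    apply: sub_count => j /= /eqP h; case: (st i j) => [|[_ _ ij e]]; first by rewrite h.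
    by rewrite eq_sym ij -e h.
  case: (boolP (odd _)) => o; rewrite ?addn0 // addn1 ltn_neqAle le andbT.
  by apply: contraNneq o => ->; exact: th_odd.
have : {in iota 0 12, forall i, unlinked t i + ~~ odd (unlinked t i) <= unlinked_in i}.
  by move=> i; rewrite mem_iota => /andP[_]; exact: le.
elim: (iota 0 12) => [|i s IH] //= h; apply: leq_add; first exact/h/mem_head.
by apply: IH => x xs; apply: h; rewrite inE xs orbT.
Qed.

Lemma first_some_in (A : eqType) B (f : A -> option B) s y : first_some f s = Some y ->
  exists2 x, x \in s & f x = Some y.
Proof.
elim: s => [|x s IH] //=; case e : (f x) => [z|].
  by move=> [<-]; exists x; rewrite ?mem_head.
by move=> /IH[x' h1 h2]; exists x'; rewrite // inE h1 orbT.
Qed.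

Lemma grid_thirds_sound t l m o r1 r2 r3 : sound_table t -> sound_line l -> sound_line m ->
  ~~ has (fun x => x \in m) l -> o \in perms3 -> grid_thirds t l m o = Some (r1, r2, r3) ->
  [/\ r1 < 12, r2 < 12, r1 != r2 & th r1 r2 = r3].
Proof.
move=> st [a1 [a2 [a3 [-> [a112 a212 a312] ua ea]]]] [b1 [b2 [b3 [-> [b112 b212 b312] ub eb]]]] dis ho.
(* Any reordering of a line is again a line for [th], so the six matchings are treated as one. *)
have [c1 [c2 [c3 [mo pc ec]]]] : exists c1 c2 c3, [/\
    [:: nth 0 [:: b1; b2; b3] (nth 0 o 0); nth 0 [:: b1; b2; b3] (nth 0 o 1);
        nth 0 [:: b1; b2; b3] (nth 0 o 2)] = [:: c1; c2; c3],
    perm_eq [:: c1; c2; c3] [:: b1; b2; b3] & th c1 c2 = c3].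
  move: ub; rewrite /= !inE negb_or => /and3P[/andP[b12 b13] b23 _].
  have [n1 n2 e13] := th_third b112 b212 b12 (eq_ind_r (fun x => x < 12) b312 eb).
  rewrite eb in n1 n2 e13.
  have b21 : b2 != b1 by rewrite eq_sym.
  have eb' : th b2 b1 = b3 by rewrite -th_sym.
  have [_ _ e23] := th_third b212 b112 b21 (eq_ind_r (fun x => x < 12) b312 eb').
  rewrite eb' in e23.
  have e31 : th b3 b1 = b2 by rewrite th_sym.
  have e32 : th b3 b2 = b1 by rewrite th_sym.
  move: ho; rewrite !inE => /or4P[|||/or3P[||]] /eqP -> /=; do 3 eexists; split=> //.
  - by apply/permP => x /=; lia.
  - by apply/permP => x /=; lia.
  - by apply/permP => x /=; lia.
  - by apply/permP => x /=; lia.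
  - by apply/permP => x /=; lia.
move: mo; rewrite /grid_thirds => -[-> -> ->].
have g12 i j : get t i j < 12 -> get t i j = th i j.
  by case: (st i j) => [->|[_ _ _ ->]].
case: leqP => // h1; case: leqP => //= h2; case: eqP => //= /eqP n12.
case: leqP => //= h3; case: eqP => //= /eqP n13; case: eqP => //= /eqP n23.
case: eqP => // _ [<- <- <-].
have e1 := g12 _ _ h1; have e2 := g12 _ _ h2; have e3 := g12 _ _ h3.
rewrite e1 e2 e3 in h1 h2 h3 n12 n13 n23 *; split=> //.
apply: th_grid => //.
- by rewrite all_cat (perm_all _ pc) /= a112 a212 a312 b112 b212 b312.
- rewrite cat_uniq ua (perm_uniq pc) ub andbT /=; move: dis; rewrite has_sym.
  by rewrite -(perm_has (mem [:: a1; a2; a3]) pc).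
- by rewrite /= !inE negb_or n12 n13 n23.
Qed.

Lemma find_grid_sound t ls r1 r2 r3 : sound (t, ls) -> find_grid t ls = Some (r1, r2, r3) ->
  [/\ r1 < 12, r2 < 12, r1 != r2 & th r1 r2 = r3].
Proof.
move=> [/= st]; elim: ls => [|l ls IH] //= sl.
case e : (first_some _ ls) => [r|].
  move=> [er]; rewrite er in e; have [m hm] := first_some_in e.
  case: (boolP (has (fun x => x \in m) l)) => // dis e'; have [o ho eo] := @first_some_in _ _ (grid_thirds t l m) perms3 _ e'.
  apply: (grid_thirds_sound st _ _ dis ho eo); apply: sl; rewrite ?mem_head //.
  by rewrite inE hm orbT.
by apply: IH => m hm; apply: sl; rewrite inE hm orbT.
Qed.

Lemma pick_pair_sound t i j : pick_pair t = Some (i, j) -> [/\ i < 12, j < 12 & i != j].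
Proof.
have sub : {subset [seq (i, j) | i <- iota 0 12, j <- iota 0 12] <= [pred ij | (ij.1 < 12) && (ij.2 < 12)]}.
  by move=> _ /allpairsP[[x y] [hx hy ->]]; move: hx hy; rewrite !mem_iota /= !inE /= => -> ->.
rewrite /pick_pair; elim: [seq (i, j) | i <- iota 0 12, j <- iota 0 12] sub => [|[a b] s IH] sub //=.
have IH' := IH (fun x hx => sub x (mem_behead (s := (a, b) :: s) hx)).
case: ifP => // ab; case: ifP => // _; case: ifP => // _ [<- <-].
by have /andP[? ?] := sub _ (mem_head _ _); rewrite (ltn_eqF ab).
Qed.

(** The run is followed along [th]: the value [th i j] is among those tried, and agreement with [th]
    prevents this branch from closing by contradiction, so it ends at a recognized table. *)
Lemma search_sound n s : sound s -> search n s -> modelled.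
Proof.
elim: n s => [|n IH] s // hs; rewrite /search -/search.
rewrite (negbTE (too_sparse_sound hs.1)).
case e : find_grid => [[[r1 r2] r3]|].
  have [h1 h2 h12 h3] : [/\ r1 < 12, r2 < 12, r1 != r2 & th r1 r2 = r3].
    by apply: find_grid_sound e; case: (s) hs.
  by move=> /(assign_sound hs h1 h2 h12 h3) [s' hs' /(IH _ hs')].
case e' : pick_pair => [[i j]|].
  have [i12 j12 ij] := pick_pair_sound e'.
  move=> /allP /(_ (th i j)); rewrite mem_iota /= add0n ltnS th_le => /(_ isT).
  by move=> /(assign_sound hs i12 j12 ij erefl) [s' hs' /(IH _ hs')].
move=> /hasP[o ho /allP h]; exists o => // abc /h /andP[lt /eqP eg].
case: (hs.1 (nth 0 o abc.1.1) (nth 0 o abc.1.2)) => [e13|[_ _ _ <- //]].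
by rewrite -eg e13 in lt.
Qed.

Lemma assign_lines_sound (abcs : seq (nat * nat * nat)) k s :
  (forall abc, abc \in abcs -> [/\ abc.1.1 < 12, abc.1.2 < 12, abc.1.1 != abc.1.2 & th abc.1.1 abc.1.2 = abc.2]) ->
  sound s -> foldr (fun abc k s => assign s abc.1.1 abc.1.2 abc.2 k) k abcs s ->
  exists2 s', sound s' & k s'.
Proof.
elim: abcs s => [|abc abcs IH] s h hs /=; first by exists s.
have [h1 h2 h3 h4] := h abc (mem_head _ _).
move=> /(assign_sound hs h1 h2 h3 h4) [s' hs' hk]; apply: (IH s') => // x hx.
by apply: h; rewrite inE hx orbT.
Qed.

Lemma start_sound n : (forall abc, abc \in start_lines -> th abc.1.1 abc.1.2 = abc.2) ->
  th 0 11 = 12 -> start n -> modelled.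
Proof.
move=> hl h11; rewrite /start => h.
have lines abc : abc \in start_lines ->
    [/\ abc.1.1 < 12, abc.1.2 < 12, abc.1.1 != abc.1.2 & th abc.1.1 abc.1.2 = abc.2].
  by move=> habc; split; rewrite ?hl //; move: abc habc; apply/allP.
have empty : sound (nseq 12 (nseq 12 13), [::]).
  split=> // i j; left; rewrite /get !nth_nseq; case: ltnP => _; last by case: j.
  by rewrite nth_nseq; case: ltnP.
have [s hs /assign_sound] := assign_lines_sound lines empty h.
by move=> /(_ hs isT isT isT h11) [s' hs' /(search_sound hs')].
Qed.

(** The case analysis by evaluation; no branch examined runs out of fuel. *)
Lemma search_succeeds : start 100.
Proof. by vm_compute. Qed.

End Search.

(** * Labelling the base points *)

Section Grid.
Variable K : fieldType.
Hypothesis charK : [pchar K] =i pred0.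
Local Notation pt := (pt K).
Implicit Types (p l m P Q X : pt) (x y z s t u v : K).
Variables F3 F4 : pt -> K.
Variables ps ls : seq pt.
Hypothesis H : monoid_config F3 F4 ps ls.

(** The zeros of F3 on l are p, q, r, where F4 vanishes too, so F4 is F3 times a linear form there.
    Its values at p and q are b1 / c1 and b6 / c3, and the zero at r gives c3 = - c1 x / y. *)
Lemma three_points_lift l P p q r : l != null K -> dot l P = 0 -> F3 P != 0 ->
  {subset [:: p; q; r] <= ps} -> uniq [:: p; q; r] ->
  dot l p = 0 -> dot l q = 0 -> dot l r = 0 -> lifts F3 F4 l.
Proof.
move=> l0 lP P3 sub u lp lq lr; split=> //.
have [pin qin rin] : [/\ p \in ps, q \in ps & r \in ps].
  by split; apply: sub; rewrite !inE eqxx ?orbT.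
have [p0 p3 p4] := ps_base H pin; have [q0 q3 q4] := ps_base H qin; have [r0 r3 r4] := ps_base H rin.
move: u; rewrite /= !inE negb_or => /and3P[/andP[pq pr] qr _].
have Xpq : cross p q != null K by apply: contraNneq pq => e; rewrite (ps_inj H pin qin e).
have [w hw] := null_dot Xpq; rewrite dot_cross in hw.
have [c0 [c1 [c2 [c3 [c4 [c5 [c6 [c7 [c8 [c9 h3]]]]]]]]]] := frame_coef3 (cubic_form H) p q w.
have [b0 [b1 [b2 [b3 [b4 [b5 [b6 [b7 [b8 [b9 [d0 [d1 [d2 [d3 [d4 h4]]]]]]]]]]]]]]] :=
  frame_coef4 (quartic_form H) p q w.
have e1 : cmb p q w 1 0 0 = p by apply: pt_ext => /=; ring.
have e2 : cmb p q w 0 1 0 = q by apply: pt_ext => /=; ring.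
have c00 : c0 = 0 by have := h3 1 0 0; rewrite e1 p3 => ->; ring.
have b00 : b0 = 0 by have := h4 1 0 0; rewrite e1 p4 => ->; ring.
have c60 : c6 = 0 by have := h3 0 1 0; rewrite e2 q3 => ->; ring.
have d00 : d0 = 0 by have := h4 0 1 0; rewrite e2 q4 => ->; ring.
have sE x y : seg p q x y = cmb p q w x y 0 by apply: pt_ext => /=; ring.
have F3E x y : F3 (seg p q x y) = x * y * (c1 * x + c3 * y).
  by rewrite sE h3 c00 c60; ring.
have F4E x y : F4 (seg p q x y) = x * y * (b1 * x ^+ 2 + b3 * x * y + b6 * y ^+ 2).
  by rewrite sE h4 b00 d00; ring.
have [x [y e]] := on_line Xpq lp lq l0 lr.
have x0 : x != 0.
  apply: contraNneq qr => x0; apply/eqP/(ps_inj H) => //; rewrite e x0.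
  by apply: pt_ext => /=; ring.
have y0 : y != 0.
  apply: contraNneq pr => y0; apply/eqP/(ps_inj H) => //; rewrite e y0.
  by apply: pt_ext => /=; ring.
have xy0 : x * y != 0 by rewrite mulf_neq0.
have c1x : c1 * x + c3 * y = 0.
  by move: r3; rewrite e F3E => /eqP; rewrite mulf_eq0 (negbTE xy0) => /eqP.
have b1x : b1 * x ^+ 2 + b3 * x * y + b6 * y ^+ 2 = 0.
  by move: r4; rewrite e F4E => /eqP; rewrite mulf_eq0 (negbTE xy0) => /eqP.
have c10 : c1 != 0.
  have [x' [y' e']] := on_line Xpq lp lq l0 lP.
  apply: contraNneq P3 => c10; rewrite e' F3E; move: c1x; rewrite c10 mul0r add0r => /eqP.
  by rewrite mulf_eq0 (negbTE y0) orbF => /eqP ->; rewrite !mul0r addr0 mulr0.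
have [a [ap aq _]] := dual_basis (b1 / c1) (- b6 * y / (c1 * x)) 0 hw.
exists a => Q lQ; have [u [v ->]] := on_line Xpq lp lq l0 lQ.
rewrite F3E F4E dot_seg ap aq.
have c3E : c3 = - (c1 * x) / y.
  by apply: (mulIf y0); rewrite divfK //; apply/eqP; rewrite -addr_eq0 addrC c1x.
have b3E : b3 = - (b1 * x ^+ 2 + b6 * y ^+ 2) / (x * y).
  apply: (mulIf xy0); rewrite divfK //; apply/eqP; rewrite -addr_eq0 -[X in _ == X]b1x.
  by apply/eqP; ring.
by rewrite c3E b3E; field; rewrite c10 x0 y0.
Qed.

(* A cubic through the six points of a 3 x 2 grid of lines is determined on the two
   columns, where it agrees up to a factor with the product of the rows. *)
Lemma grid_cubic (l1 l2 l3 m1 m2 a1 a2 a3 b1 b2 b3 : pt) :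
  {subset [:: l1; l2; l3; m1; m2] <= ls} -> F3 (cross m1 m2) != 0 ->
  {subset [:: a1; a2; a3; b1; b2; b3] <= ps} -> uniq [:: a1; a2; a3] -> uniq [:: b1; b2; b3] ->
  [/\ dot m1 a1 = 0, dot m1 a2 = 0 & dot m1 a3 = 0] ->
  [/\ dot m2 b1 = 0, dot m2 b2 = 0 & dot m2 b3 = 0] ->
  [/\ dot l1 a1 = 0, dot l2 a2 = 0 & dot l3 a3 = 0] ->
  [/\ dot l1 b1 = 0, dot l2 b2 = 0 & dot l3 b3 = 0] ->
  exists2 k, k != 0 & exists n, forall P,
    F3 P = k * (dot l1 P * dot l2 P * dot l3 P) + dot m1 P * dot m2 P * dot n P.
Proof.
move=> lsub dis psub ua ub [ma1 ma2 ma3] [mb1 mb2 mb3] [la1 la2 la3] [lb1 lb2 lb3].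
have f3 := cubic_form H.
have inl l : l \in [:: l1; l2; l3; m1; m2] -> l != null K.
  by move=> /lsub /(ls_lift H)[].
have [l10 l20 l30] : [/\ l1 != null K, l2 != null K & l3 != null K].
  by split; apply: inl; rewrite !inE eqxx ?orbT.
have [m10 m20] : m1 != null K /\ m2 != null K by split; apply: inl; rewrite !inE eqxx ?orbT.
have Xm := disjoint_neq0 H dis; set X := cross m1 m2 in dis Xm.
have mX1 : dot m1 X = 0 by rewrite dotC dot_crossl.
have mX2 : dot m2 X = 0 by rewrite dotC dot_crossr.
have X_np (a : pt) : a \in ps -> cross X a != null K.
  move=> ain; have [a0 a3' _] := ps_base H ain; apply: contraNneq dis => e.
  rewrite -/X; have e' : cross a X = null K by apply/eqP; rewrite crossC_eq0 e.
  by have [k ->] := cross_null a0 e'; rewrite (form_scal _ _ f3) a3' mulr0.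
have inps (x : pt) : x \in [:: a1; a2; a3; b1; b2; b3] -> x \in ps by exact: psub.
have lX (l a b : pt) : l != null K -> a \in ps -> b \in ps -> dot l a = 0 -> dot l b = 0 ->
    dot m1 a = 0 -> dot m2 b = 0 -> dot l X != 0.
  move=> l0 ain bin la lb ma mb; apply/eqP => lX.
  have e1 := cross_lines (X_np a ain) lX la mX1 ma.
  have e2 := cross_lines (X_np b bin) lX lb mX2 mb.
  have [k1 h1] := cross_null l0 e1; have [k2 h2] := cross_null l0 e2.
  by move: Xm; rewrite /X h1 h2 cross_scal eqxx.
have pin : [/\ a1 \in ps, a2 \in ps, a3 \in ps & [/\ b1 \in ps, b2 \in ps & b3 \in ps]].
  by split; [| | |split]; apply: inps; rewrite !inE eqxx ?orbT.
have [a1p a2p a3p [b1p b2p b3p]] := pin.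
have x1 := lX _ _ _ l10 a1p b1p la1 lb1 ma1 mb1.
have x2 := lX _ _ _ l20 a2p b2p la2 lb2 ma2 mb2.
have x3 := lX _ _ _ l30 a3p b3p la3 lb3 ma3 mb3.
(* This k makes F3 - k l1 l2 l3 vanish at the crossing X of the columns as well: four zeros on each
   column, too many for a cubic. *)
pose k := F3 X / (dot l1 X * dot l2 X * dot l3 X).
have k0 : k != 0 by rewrite /k mulf_neq0 // invr_eq0 !mulf_neq0.
pose G P := F3 P - k * (dot l1 P * (dot l2 P * dot l3 P)).
have fG : form 3 G := form_sub f3 (form_scale k (form_dot l1 (form_dot l2 (form_lin l3)))).
have GX : G X = 0 by rewrite /G /k; field; rewrite x1 x2 x3.
have Gp (l a : pt) : a \in ps -> dot l a = 0 -> l \in [:: l1; l2; l3] -> G a = 0.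
  move=> ain la hl; have [_ e _] := ps_base H ain; rewrite /G e.
  by move: hl; rewrite !inE => /or3P[] /eqP <-; rewrite la; ring.
have zero (m c1 c2 c3 : pt) : m != null K -> {subset [:: c1; c2; c3] <= ps} -> uniq [:: c1; c2; c3] ->
    dot m X = 0 -> dot m c1 = 0 -> dot m c2 = 0 -> dot m c3 = 0 ->
    G c1 = 0 -> G c2 = 0 -> G c3 = 0 -> forall P, dot m P = 0 -> G P = 0.
  move=> m0 csub uc mX mc1 mc2 mc3 G1 G2 G3 P mP; apply/eqP; apply: contraT => GP.
  have Xn a : a \in [:: c1; c2; c3] -> a != X.
    by move=> /csub /X_np; apply: contra_neq => ->; exact: crosspp.
  have : (size [:: X; c1; c2; c3] <= 3)%N.
    apply: (line_zeros charK fG m0 mP GP).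
    - rewrite /= in uc *; rewrite uc andbT !inE !negb_or !(eq_sym X).
      by rewrite !Xn // !inE eqxx ?orbT.
    - move=> a; rewrite inE => /orP[/eqP -> //|ha]; have [a0 _ _] := ps_base H (csub _ ha).
      by move: ha a0; rewrite !inE => /or3P[] /eqP -> a0; split.
    - move=> a b; rewrite 2!inE => /orP[/eqP ->|ha] /orP[/eqP ->|hb] //.
      + by move=> e; move: (X_np _ (csub _ hb)); rewrite e eqxx.
      + by move=> /eqP; rewrite crossC_eq0 => e; move: (X_np _ (csub _ ha)); rewrite e.
      + exact: (ps_inj H (csub _ ha) (csub _ hb)).
  by [].
have sa : {subset [:: a1; a2; a3] <= ps} by move=> x; rewrite !inE => /or3P[] /eqP ->.
have sb : {subset [:: b1; b2; b3] <= ps} by move=> x; rewrite !inE => /or3P[] /eqP ->.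
have in1 : l1 \in [:: l1; l2; l3] by rewrite !inE eqxx.
have in2 : l2 \in [:: l1; l2; l3] by rewrite !inE eqxx orbT.
have in3 : l3 \in [:: l1; l2; l3] by rewrite !inE eqxx !orbT.
have z1 := zero m1 a1 a2 a3 m10 sa ua mX1 ma1 ma2 ma3 (Gp _ _ a1p la1 in1) (Gp _ _ a2p la2 in2) (Gp _ _ a3p la3 in3).
have z2 := zero m2 b1 b2 b3 m20 sb ub mX2 mb1 mb2 mb3 (Gp _ _ b1p lb1 in1) (Gp _ _ b2p lb2 in2) (Gp _ _ b3p lb3 in3).
have [G1 fG1 eG1] := form_div fG m10 z1.
have Xm' : cross m2 m1 != null K by rewrite crossC_eq0.
have z3 : forall P, dot m2 P = 0 -> G1 P = 0.
  by apply: (line_cancel charK fG1 Xm') => P mP; rewrite -eG1 z2.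
have [G2 fG2 eG2] := form_div fG1 m20 z3.
have [n hn] := form1_dot fG2.
exists k => //; exists n => P; have := eG1 P; rewrite eG2 hn /G => e.
transitivity (k * (dot l1 P * (dot l2 P * dot l3 P)) + dot m1 P * (dot m2 P * dot n P)).
  by rewrite -e; ring.
by ring.
Qed.

(** The third points are on a row and off both columns, so F3 = k l1 l2 l3 + m1 m2 n puts them on n.
    Were n inside the cubic, it would be one of the rows, which are not. Having three base points, n
    lifts. *)
Lemma grid_closed (l1 l2 l3 m1 m2 a1 a2 a3 b1 b2 b3 r1 r2 r3 : pt) :
  {subset [:: l1; l2; l3; m1; m2] <= ls} -> F3 (cross m1 m2) != 0 ->
  {subset [:: a1; a2; a3; b1; b2; b3] <= ps} -> uniq [:: a1; a2; a3] -> uniq [:: b1; b2; b3] ->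
  [/\ dot m1 a1 = 0, dot m1 a2 = 0 & dot m1 a3 = 0] ->
  [/\ dot m2 b1 = 0, dot m2 b2 = 0 & dot m2 b3 = 0] ->
  [/\ dot l1 a1 = 0, dot l2 a2 = 0 & dot l3 a3 = 0] ->
  [/\ dot l1 b1 = 0, dot l2 b2 = 0 & dot l3 b3 = 0] ->
  [/\ dot l1 r1 = 0, dot l2 r2 = 0 & dot l3 r3 = 0] ->
  {subset [:: r1; r2; r3] <= ps} -> uniq [:: r1; r2; r3] ->
  [/\ r1 != a1, r2 != a2 & r3 != a3] -> [/\ r1 != b1, r2 != b2 & r3 != b3] ->
  exists2 n, n \in ls & [/\ dot n r1 = 0, dot n r2 = 0 & dot n r3 = 0].
Proof.
move=> lsub dis psub ua ub ma mb la lb [lr1 lr2 lr3] rsub ur [ra1 ra2 ra3] [rb1 rb2 rb3].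
have [k k0 [n eF]] := grid_cubic lsub dis psub ua ub ma mb la lb.
case: ma mb la lb => [ma1 ma2 ma3] [mb1 mb2 mb3] [la1 la2 la3] [lb1 lb2 lb3].
have nr (l r a b : pt) : l \in [:: l1; l2; l3] -> r \in ps -> a \in ps -> b \in ps -> r != a -> r != b ->
    dot l r = 0 -> dot l a = 0 -> dot l b = 0 -> dot m1 a = 0 -> dot m2 b = 0 -> dot n r = 0.
  move=> lin rin ain bin ra rb lr laa lbb maa mbb; have [_ r3' _] := ps_base H rin.
  have linls : l \in ls by apply: lsub; move: lin; rewrite !inE => /or3P[] ->; rewrite ?orbT.
  have m1in : m1 \in ls by apply: lsub; rewrite !inE eqxx !orbT.
  have m2in : m2 \in ls by apply: lsub; rewrite !inE eqxx !orbT.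
  have m1r : dot m1 r != 0.
    apply: contraNneq dis => mr; have lm := ls_eq H linls m1in rin ain ra lr laa mr maa.
    by rewrite lm in lbb; apply/eqP/(base_meet H bin lbb mbb).
  have m2r : dot m2 r != 0.
    apply: contraNneq dis => mr; have lm := ls_eq H linls m2in rin bin rb lr lbb mr mbb.
    by rewrite lm in laa; apply/eqP/(base_meet H ain maa laa).
  have := eF r; rewrite r3' => e; apply: (mulfI m1r); apply: (mulfI m2r); rewrite !mulr0 [RHS]e.
  by move: lin; rewrite !inE => /or3P[] /eqP le; rewrite -le lr; ring.
have rp (r : pt) : r \in [:: r1; r2; r3] -> r \in ps by exact: rsub.
have pp (x : pt) : x \in [:: a1; a2; a3; b1; b2; b3] -> x \in ps by exact: psub.
have nr1 : dot n r1 = 0 by apply: (nr l1 r1 a1 b1) => //; [|apply: rp|apply: pp|apply: pp]; rewrite !inE eqxx ?orbT.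
have nr2 : dot n r2 = 0 by apply: (nr l2 r2 a2 b2) => //; [|apply: rp|apply: pp|apply: pp]; rewrite !inE eqxx ?orbT.
have nr3 : dot n r3 = 0 by apply: (nr l3 r3 a3 b3) => //; [|apply: rp|apply: pp|apply: pp]; rewrite !inE eqxx ?orbT.
have inl l : l \in [:: l1; l2; l3] -> exists2 P, dot l P = 0 & F3 P != 0.
  move=> hl; apply: (lift_cubic_neq0 charK H); apply: (ls_lift H); apply: lsub.
  by move: hl; rewrite !inE => /or3P[] ->; rewrite ?orbT.
have n0 : n != null K.
  apply/eqP => n0; have [P lP] := inl l1 (mem_head _ _); rewrite eF n0 lP => /eqP[].
  by rewrite /dot /=; ring.
have [P nP P3] : exists2 P, dot n P = 0 & F3 P != 0.
  apply: (line_nonzero charK (cubic_form H) n0) => z.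
  have np l : l \in [:: l1; l2; l3] -> cross n l != null K.
    move=> hl; apply/eqP => e; have [c lE] := cross_null n0 e.
    have [P lP P3] := inl l hl; case/eqP: P3; apply: z.
    have c0 : c != 0.
      have linls : l \in ls by apply: lsub; move: hl; rewrite !inE => /or3P[] ->; rewrite ?orbT.
      by have [l0 _] := ls_lift H linls; case: (@scal_neq0 _ c n); rewrite -?lE.
    by move: lP; rewrite lE dotC dot_scal dotC => /eqP; rewrite mulf_eq0 (negbTE c0) => /eqP.
  have z' P : dot n P = 0 -> dot l1 P * (dot l2 P * dot l3 P) = 0.
    move=> nP; have := eF P; rewrite z // nP mulr0 addr0 => e.
    by apply: (mulfI k0); rewrite mulr0 [RHS]e; ring.
  have z1 := line_cancel charK (form_dot l2 (form_lin l3)) (np l1 (mem_head _ _)) z'.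
  have in2 : l2 \in [:: l1; l2; l3] by rewrite !inE eqxx orbT.
  have in3 : l3 \in [:: l1; l2; l3] by rewrite !inE eqxx !orbT.
  have z2 := line_cancel charK (form_lin l3) (np l2 in2) z1.
  have [Q hQ nQ] := line_complete n0 (np l3 in3) (etrans (dotC _ _) (dot_crossl _ _)).
  by have := meet_neq0 (np l3 in3) nQ hQ; rewrite z2 ?eqxx.
have nl := three_points_lift n0 nP P3 rsub ur nr1 nr2 nr3.
have [m min e] := ls_all H nl; have [c mE] := cross_null n0 e.
by exists m => //; rewrite mE !(dotC (scal c n)) !dot_scal !(dotC _ n) nr1 nr2 nr3 mulr0.
Qed.

End Grid.

Lemma count_has (T : eqType) (a : pred T) (s : seq T) : uniq s ->
  {in s &, forall x y, a x -> a y -> x = y} -> count a s = has a s.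
Proof.
elim: s => [|x s IH] //= /andP[xs us] h.
have h' : {in s &, forall x y, a x -> a y -> x = y}.
  by move=> y z ys zs; apply: h; rewrite inE (ys, zs) orbT.
rewrite (IH us h'); case ax : (a x) => //=.
suff -> : has a s = false by [].
apply/negP => /hasP[y ys ay]; move: xs.
by rewrite (h x y) ?mem_head // ?ys // inE ys orbT.
Qed.

(** * Degrees, and a labelling that starts the search *)

Section Labels.
Variable K : fieldType.
Hypothesis charK : [pchar K] =i pred0.
Local Notation pt := (pt K).
Implicit Types (p l m P Q X : pt).
Variables F3 F4 : pt -> K.
Variables ps ls : seq pt.
Hypothesis H : monoid_config F3 F4 ps ls.
Hypotheses (size_ls : size ls = 19%N) (size_ps : size ps = 12%N).
Hypothesis three : {in ls, forall l, count (fun p => dot l p == 0%R) ps = 3%N}.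

Definition tri (p q r : pt) := [&& p != q, p != r, q != r &
  has (fun l => [&& dot l p == 0, dot l q == 0 & dot l r == 0]) ls].
Definition on_pts l := [seq r <- ps | dot l r == 0].
Definition deg p := count (fun l => dot l p == 0%R) ls.
Definition covered p q := has (tri p q) ps.

Lemma triP p q r : tri p q r -> [/\ p != q, p != r & q != r] /\
  exists2 l, l \in ls & [/\ dot l p = 0, dot l q = 0 & dot l r = 0].
Proof.
case/and4P => pq pr qr /hasP[l lin /and3P[/eqP lp /eqP lq /eqP lr]].
by split=> //; exists l.
Qed.

Lemma triI p q r l : l \in ls -> dot l p = 0 -> dot l q = 0 -> dot l r = 0 ->
  p != q -> p != r -> q != r -> tri p q r.
Proof.
move=> lin lp lq lr pq pr qr; rewrite /tri pq pr qr /=; apply/hasP.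
by exists l => //; rewrite lp lq lr eqxx.
Qed.

Lemma triC p q r : tri p q r = tri q p r.
Proof.
rewrite /tri (eq_sym p q); case: (q != p) => //=.
rewrite [RHS]andbCA; congr (_ && (_ && _)); apply: eq_has => l.
by rewrite andbCA.
Qed.

Lemma triCr p q r : tri p q r = tri p r q.
Proof.
rewrite /tri (eq_sym q r) andbCA; congr (_ && (_ && (_ && _))); apply: eq_has => l.
by rewrite [in RHS](andbC (dot l r == 0)).
Qed.

Lemma mem_on l p : p \in on_pts l = (dot l p == 0) && (p \in ps).
Proof. by rewrite mem_filter. Qed.

Lemma size_on l : l \in ls -> size (on_pts l) = 3.
Proof. by move=> lin; rewrite size_filter three. Qed.

Lemma uniq_on l : uniq (on_pts l).
Proof. by rewrite filter_uniq // (ps_uniq H). Qed.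

Lemma on_perm l x : l \in ls -> x \in on_pts l -> exists y z, perm_eq (on_pts l) [:: x; y; z].
Proof.
move=> lin xl; have := perm_to_rem xl; have := size_rem xl; rewrite size_on //.
by case: (rem x _) => [|y [|z [|]]] // _ e; exists y, z.
Qed.

Lemma tri_uniq p q r r' : p \in ps -> q \in ps -> r \in ps -> r' \in ps ->
  tri p q r -> tri p q r' -> r = r'.
Proof.
move=> pin qin rin r'in /triP[[pq pr qr] [l lin [lp lq lr]]] /triP[[_ pr' qr'] [m min [mp mq mr]]].
have e := ls_eq H lin min pin qin pq lp lq mp mq; rewrite -e in mr.
apply/eqP; apply: contraT => rr'.
have : (size [:: p; q; r; r'] <= size (on_pts l))%N.
  apply: uniq_leq_size; first by rewrite /= !inE !negb_or pq pr pr' qr qr' rr'.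
  by move=> x; rewrite !inE mem_on => /or4P[] /eqP ->; rewrite ?lp ?lq ?lr ?mr eqxx.
by rewrite size_on.
Qed.

Lemma line_covered l p q : l \in ls -> p \in ps -> q \in ps -> p != q ->
  dot l p = 0 -> dot l q = 0 -> covered p q.
Proof.
move=> lin pin qin pq lp lq.
have pl : p \in on_pts l by rewrite mem_on lp eqxx.
have [y [z e]] := on_perm lin pl.
have u : uniq [:: p; y; z] by rewrite -(perm_uniq e) uniq_on.
have inl x : x \in [:: p; y; z] -> dot l x = 0 /\ x \in ps.
  by rewrite -(perm_mem e) mem_on => /andP[/eqP].
have [ly yin] : dot l y = 0 /\ y \in ps by apply: inl; rewrite !inE eqxx orbT.
have [lz zin] : dot l z = 0 /\ z \in ps by apply: inl; rewrite !inE eqxx !orbT.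
have : q \in [:: p; y; z] by rewrite -(perm_mem e) mem_on lq eqxx.
move: u; rewrite /= !inE negb_or (eq_sym q p) (negbTE pq) /= => /and3P[/andP[py pz] yz _].
by case/orP => /eqP qE; apply/hasP; [exists z | exists y] => //; rewrite qE;
   apply: (triI lin); rewrite // eq_sym.
Qed.

Lemma coveredP p q : p \in ps -> q \in ps -> covered p q =
  (q != p) && has (fun l => (dot l p == 0) && (dot l q == 0)) ls.
Proof.
move=> pin qin; apply/idP/andP => [/hasP[r rin /triP[[pq _ _] [l lin [lp lq _]]]]|[qp /hasP[l lin]]].
  by rewrite eq_sym; split=> //; apply/hasP; exists l; rewrite // lp lq eqxx.
by move=> /andP[/eqP lp /eqP lq]; apply: (line_covered lin) => //; rewrite eq_sym.
Qed.

(** Each line through p has two further points, and two such lines share only p. *)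
Lemma count_covered p : p \in ps -> count (covered p) ps = (2 * deg p)%N.
Proof.
move=> pin.
transitivity (\sum_(q <- ps | q != p) count (fun l => (dot l p == 0%R) && (dot l q == 0%R)) ls)%N.
  rewrite -sum1_count big_mkcond [RHS]big_mkcond /=; apply: eq_big_seq => q qin.
  rewrite coveredP //; case: (eqVneq q p) => //= qp; rewrite count_has ?(ls_uniq H) //.
    move=> l m lin min /andP[/eqP lp /eqP lq] /andP[/eqP mp /eqP mq].
    by apply: (ls_eq H lin min pin qin) => //; rewrite eq_sym.
transitivity (\sum_(l <- ls | dot l p == 0%R) \sum_(q <- ps | q != p) (dot l q == 0%R))%N.
  rewrite [RHS]big_mkcond /=.
  transitivity (\sum_(l <- ls) \sum_(q <- ps | q != p) ((dot l p == 0%R) && (dot l q == 0%R)))%N.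
    rewrite exchange_big; apply: eq_bigr => q _; rewrite -sum1_count big_mkcond.
    by apply: eq_bigr => l _; case: (_ && _).
  by apply: eq_bigr => l _; case: ifP => //= _; rewrite big1.
rewrite /deg -sum1_count big_distrr /= big_seq_cond [RHS]big_seq_cond.
apply: eq_bigr => l /andP[lin /eqP lp].
have pl : p \in on_pts l by rewrite mem_on lp eqxx.
have := three lin; rewrite -sum1_count big_mkcond (bigD1_seq p) ?(ps_uniq H) //= lp eqxx.
move=> /eqP; rewrite eqSS => /eqP h; rewrite muln1 -[RHS]h.
by apply: eq_bigr => q _; case: eqP.
Qed.

Lemma sum_deg : (\sum_(p <- ps) deg p = 57)%N.
Proof.
transitivity (\sum_(p <- ps) \sum_(l <- ls) (dot l p == 0%R))%N.
  by apply: eq_bigr => p _; rewrite /deg -sum1_count big_mkcond; apply: eq_bigr => l _; case: ifP.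
rewrite exchange_big; transitivity (\sum_(l <- ls) 3)%N.
  apply: eq_big_seq => l lin; rewrite -(three lin) -sum1_count [RHS]big_mkcond.
  by apply: eq_bigr => p _; case: ifP.
by rewrite big_const_seq count_predT size_ls.
Qed.

(** The average degree 57 / 12 exceeds 4. *)
Lemma exists_deg5 : exists2 p, p \in ps & deg p = 5%N.
Proof.
have [/hasP[p pin /eqP e]|no] := boolP (has (fun p => deg p == 5%N) ps); first by exists p.
have : (\sum_(p <- ps) deg p <= \sum_(p <- ps) 4)%N.
  rewrite big_seq [leqRHS]big_seq; apply: leq_sum => p pin.
  have := lns_count_le5 charK H pin; rewrite -/(deg p) leq_eqVlt ltnS => /orP[e|//].
  by case/hasP: no; exists p.
by rewrite sum_deg big_const_seq count_predT size_ps.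
Qed.

Lemma count_uncovered p : p \in ps ->
  count (fun r => (r != p) && ~~ covered p r) ps = (11 - 2 * deg p)%N.
Proof.
move=> pin; have := count_predC (covered p) ps; rewrite size_ps count_covered // => e.
have : count (predC (covered p)) ps = (1 + count (fun r => (r != p) && ~~ covered p r) ps)%N.
  have cpp : ~~ covered p p by rewrite coveredP // eqxx.
  have <- : count (pred1 p) ps = 1%N by rewrite count_uniq_mem ?(ps_uniq H) // pin.
  rewrite -count_predUI [X in (_ + X)%N](_ : _ = 0%N) ?addn0.
    by apply: eq_count => r /=; case: eqP => [->|].
  by rewrite -(count_pred0 ps); apply: eq_count => r /=; case: eqP.
by lia.
Qed.

Definition parallel s := [/\ {subset s <= ls}, size s = 4%N & perm_eq (flatten (map on_pts s)) ps].

Lemma parallel_perm s s' : perm_eq s s' -> parallel s -> parallel s'.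
Proof.
move=> e [h1 h2 h3]; split.
- by move=> x; rewrite -(perm_mem e); exact: h1.
- by rewrite -(perm_size e).
- by apply: perm_trans h3; apply: perm_flatten; apply: perm_map; rewrite perm_sym.
Qed.

Lemma parallel_cover (l1 l2 l3 l4 : pt) : [/\ l1 \in ls, l2 \in ls, l3 \in ls & l4 \in ls] ->
  (forall p, p \in ps -> has (fun l => dot l p == 0) [:: l1; l2; l3; l4]) ->
  parallel [:: l1; l2; l3; l4].
Proof.
move=> [i1 i2 i3 i4] cov; split=> //.
  by move=> x; rewrite !inE => /or4P[] /eqP ->.
have sub : {subset ps <= flatten (map on_pts [:: l1; l2; l3; l4])}.
  move=> p pin; have /hasP[l hl lp] := cov p pin; apply/flattenP.
  by exists (on_pts l); rewrite ?mem_on ?lp //; apply: map_f.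
have sz : (size (flatten (map on_pts [:: l1; l2; l3; l4])) <= size ps)%N.
  by rewrite /= !size_cat !size_on // size_ps.
rewrite perm_sym; apply: uniq_perm; first exact: (ps_uniq H).
  exact: (leq_size_uniq (ps_uniq H) sub sz).
by have [_] := uniq_min_size (ps_uniq H) sub sz.
Qed.

Lemma parallel_disj s p l l' : parallel s -> l \in s -> l' \in s -> p \in ps ->
  dot l p = 0 -> dot l' p = 0 -> l = l'.
Proof.
move=> par ls_ l's pin lp l'p; apply/eqP; apply: contraT => ne.
have [_ _ pe] := parallel_perm (perm_to_rem ls_) par.
have : uniq (flatten (map on_pts (l :: rem l s))) by rewrite (perm_uniq pe) (ps_uniq H).
rewrite /= cat_uniq => /and3P[_ /hasP[]]; exists p; last by rewrite /= mem_on lp eqxx.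
apply/flattenP; exists (on_pts l'); last by rewrite mem_on l'p eqxx.
apply: map_f; have := perm_mem (perm_to_rem ls_) l'; rewrite l's inE eq_sym (negbTE ne) /=.
by move=> <-.
Qed.

Lemma parallel_on s p : parallel s -> p \in ps -> exists2 l, l \in s & dot l p = 0.
Proof.
move=> [_ _ pe] pin; have : p \in flatten (map on_pts s) by rewrite (perm_mem pe).
by case/flattenP => x /mapP[l ls_ ->]; rewrite mem_on => /andP[/eqP lp _]; exists l.
Qed.

(** A line meeting l in p and l' in r cannot meet either of them again, so its third point is on
    another line of the partition. *)
Lemma third_class s p r x l l' : parallel s -> l \in s -> l' \in s -> l != l' ->
  p \in ps -> r \in ps -> x \in ps -> dot l p = 0 -> dot l' r = 0 -> tri p r x ->
  exists2 m, m \in s & [/\ dot m x = 0, m != l & m != l'].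
Proof.
move=> par ls_ l's ne pin rin xin lp l'r /triP[[pr px rx] [k kin [kp kr kx]]].
have [sub _ _] := par.
have [m ms mx] := parallel_on par xin; exists m => //; split=> //.
  apply: contra_neq ne => ml; rewrite ml in mx.
  have kl := ls_eq H kin (sub _ ls_) pin xin px kp kx lp mx.
  by apply: (parallel_disj par ls_ l's rin) => //; rewrite -kl.
apply: contra_neq ne => ml; rewrite ml in mx.
have kl := ls_eq H kin (sub _ l's) rin xin rx kr kx l'r mx.
by apply: (parallel_disj par ls_ l's pin) => //; rewrite -kl.
Qed.

(** A point p of degree 5 is joined to all points but one, u. Let l1 and l4 be the lines of the
    partition through p and u. The lines from p to the two other points v, w of l4 have third points
    x, y, one on each remaining line l2, l3, and p joins the two other points of l2 to those of l3.
    Here p gets the label 0 and u the label 11. *)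
Lemma exists_labels s : parallel s -> exists q : seq pt,
  [/\ perm_eq q ps,
      {in start_lines, forall abc, tri (nth (null K) q abc.1.1) (nth (null K) q abc.1.2) (nth (null K) q abc.2)} &
      ~~ covered (nth (null K) q 0) (nth (null K) q 11)].
Proof.
move=> par; have [p pin dp] := exists_deg5.
have := count_uncovered pin; rewrite dp -size_filter.
case uE : [seq r <- ps | (r != p) && ~~ covered p r] => [|u [|]] // _.
have [up uncov uin] : [/\ u != p, ~~ covered p u & u \in ps].
  have : u \in [seq r <- ps | (r != p) && ~~ covered p r] by rewrite uE mem_head.
  by rewrite mem_filter => /andP[/andP[]].
have cov r : r \in ps -> r != p -> r != u -> exists2 x, x \in ps & tri p r x.
  move=> rin rp ru; apply/hasP; apply: contraNT ru => nc.
  have : r \in [seq r <- ps | (r != p) && ~~ covered p r] by rewrite mem_filter rp nc rin.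
  by rewrite uE inE.
have [l1 l1s l1p] := parallel_on par pin; have [l4 l4s l4u] := parallel_on par uin.
have sub := let: And3 h _ _ := par in h.
have n14 : l1 != l4.
  apply: contraNneq uncov => e; rewrite -e in l4u.
  by apply: (line_covered (sub _ l1s)) => //; rewrite eq_sym.
have [v [w ev]] : exists v w, perm_eq (on_pts l4) [:: u; v; w].
  by apply: on_perm; [exact: sub | rewrite mem_on l4u eqxx].
have [p1 [p2 ep]] : exists p1 p2, perm_eq (on_pts l1) [:: p; p1; p2].
  by apply: on_perm; [exact: sub | rewrite mem_on l1p eqxx].
have mem4 x : x \in [:: u; v; w] -> dot l4 x = 0 /\ x \in ps.
  by rewrite -(perm_mem ev) mem_on => /andP[/eqP].
have [l4v vin] : dot l4 v = 0 /\ v \in ps by apply: mem4; rewrite !inE eqxx orbT.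
have [l4w win] : dot l4 w = 0 /\ w \in ps by apply: mem4; rewrite !inE eqxx !orbT.
have : uniq [:: u; v; w] by rewrite -(perm_uniq ev) uniq_on.
rewrite /= !inE negb_or => /and3P[/andP[uv uw] vw _].
have vu : v != u by rewrite eq_sym.
have wu : w != u by rewrite eq_sym.
have off4 r : r \in ps -> dot l4 r = 0 -> r != p.
  move=> rin l4r; apply: contraNneq n14 => rp; rewrite rp in l4r.
  by apply/eqP/(parallel_disj par l1s l4s pin).
have [x xin tx] := cov v vin (off4 v vin l4v) vu.
have [l2 l2s [l2x n21 n24]] := third_class par l1s l4s n14 pin vin xin l1p l4v tx.
have [y yin ty] := cov w win (off4 w win l4w) wu.
have xy : x != y.
  apply: contraNneq vw => e; rewrite -e triCr in ty; rewrite triCr in tx.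
  by apply/eqP/(tri_uniq pin xin vin win tx ty).
have [l3 [e4 n3]] : exists l3, perm_eq s [:: l1; l2; l3; l4] /\ [/\ l3 != l1, l3 != l2 & l3 != l4].
  have r2 : l2 \in rem l1 s by move: l2s; rewrite (perm_mem (perm_to_rem l1s)) inE (negbTE n21).
  have r4 : l4 \in rem l2 (rem l1 s).
    move: l4s; rewrite (perm_mem (perm_to_rem l1s)) inE (perm_mem (perm_to_rem r2)) inE.
    by rewrite (eq_sym l4 l1) (negbTE n14) (eq_sym l4 l2) (negbTE n24).
  have sz : size (rem l4 (rem l2 (rem l1 s))) = 1%N.
    by rewrite !size_rem //; case: par => _ ->.
  case e : (rem l4 (rem l2 (rem l1 s))) sz => [|l3 []] // _; exists l3.
  have pe : perm_eq s [:: l1; l2; l4; l3].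
    rewrite -e; apply: (perm_trans (perm_to_rem l1s)); rewrite perm_cons.
    by apply: (perm_trans (perm_to_rem r2)); rewrite perm_cons; apply: perm_to_rem.
  have pe' : perm_eq s [:: l1; l2; l3; l4].
    apply: (perm_trans pe); rewrite !perm_cons.
    by rewrite -[X in perm_eq X]/([:: l4] ++ [:: l3]) perm_catC.
  split=> //.
  have [sub' _ pf] := parallel_perm pe' par.
  have : uniq (flatten (map on_pts [:: l1; l2; l3; l4])) by rewrite (perm_uniq pf) (ps_uniq H).
  have ne l : l \in ls -> exists2 z, z \in on_pts l & z \in on_pts l.
    by move=> lin; case: (on_pts l) (size_on lin) => // z t _; exists z; rewrite mem_head.
  have l3in : l3 \in ls by apply: sub'; rewrite !inE eqxx !orbT.
  have [z zl _] := ne l3 l3in.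
  rewrite /= cats0 => u4; split; apply: contraTneq u4 => e'; rewrite -?e'.
  - by rewrite cat_uniq; apply/negP => /and3P[_ /hasP[]]; exists z; rewrite // !mem_cat zl !orbT.
  - rewrite cat_uniq; apply/negP => /and3P[_ _]; rewrite cat_uniq => /and3P[_ /hasP[]].
    by exists z; rewrite // mem_cat zl.
  - rewrite cat_uniq; apply/negP => /and3P[_ _]; rewrite cat_uniq => /and3P[_ _].
    by rewrite cat_uniq => /and3P[_ /hasP[]]; exists z.
have par' := parallel_perm e4 par; have [sub' _ pf] := par'.
have in4 l : l \in [:: l1; l2; l3; l4] -> l \in s by rewrite (perm_mem e4).
have l3s : l3 \in s by apply: in4; rewrite !inE eqxx !orbT.
case: n3 => n31 n32 n34.
have [a [b ex]] : exists a b, perm_eq (on_pts l2) [:: x; a; b].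
  by apply: on_perm; [exact: sub | rewrite mem_on l2x eqxx].
have mem2 z : z \in [:: x; a; b] -> dot l2 z = 0 /\ z \in ps.
  by rewrite -(perm_mem ex) mem_on => /andP[/eqP].
have off12 r l : r \in ps -> l \in s -> dot l r = 0 -> l != l1 -> r != p.
  by move=> rin lin lr nl; apply: contraNneq nl => rp; rewrite rp in lr; apply/eqP/(parallel_disj par lin l1s pin).
have offu r l : r \in ps -> l \in s -> dot l r = 0 -> l != l4 -> r != u.
  by move=> rin lin lr nl; apply: contraNneq nl => ru; rewrite ru in lr; apply/eqP/(parallel_disj par lin l4s uin).
(* the mate of a point of l3 (resp. l2) that is not x, y lies on l2 (resp. l3) *)
have mate r l l' : r \in ps -> l \in s -> l' \in s -> dot l r = 0 -> l != l1 -> l != l4 -> l' != l1 ->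
    l' != l4 -> l != l' -> r != x -> r != y ->
    exists2 z, z \in ps & tri p r z /\ dot l' z = 0.
  move=> rin lin l'in lr nl1 nl4 nl'1 nl'4 nll' rx ry.
  have rp := off12 r l rin lin lr nl1; have ru := offu r l rin lin lr nl4.
  have [z zin tz] := cov r rin rp ru; exists z => //; split=> //.
  have n1l : l1 != l by rewrite eq_sym.
  have [m ms [mz nm1 nml]] := third_class par l1s lin n1l pin rin zin l1p lr tz.
  have [m4|nm4] := eqVneq m l4.
    rewrite m4 in mz; have zl4 : z \in [:: u; v; w] by rewrite -(perm_mem ev) mem_on mz eqxx.
    move: zl4; rewrite !inE => /or3P[] /eqP ze; rewrite ze in tz.
    - by case/negP: uncov; apply/hasP; exists r => //; rewrite triCr.
    - rewrite triCr in tz; rewrite (tri_uniq pin vin rin xin tz tx) eqxx in rx.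
      by [].
    - rewrite triCr in tz; rewrite (tri_uniq pin win rin yin tz ty) eqxx in ry.
      by [].
  move: ms l'in; rewrite !(perm_mem e4) !inE (negbTE nm1) (negbTE nm4) (negbTE nl'1) (negbTE nl'4) !orbF /=.
  move: lin; rewrite (perm_mem e4) !inE (negbTE nl1) (negbTE nl4) !orbF /=.
  move=> /orP[] /eqP el /orP[] /eqP em /orP[] /eqP el'; rewrite ?el ?em ?el' ?eqxx // in nml nll' mz *.
have uniq3 l (c d e : pt) : perm_eq (on_pts l) [:: c; d; e] -> [/\ c != d, c != e & d != e].
  by move=> pe; have := uniq_on l; rewrite (perm_uniq pe) /= !inE negb_or => /and3P[/andP[-> ->] ->].
have mem3 l (c d e : pt) : perm_eq (on_pts l) [:: c; d; e] ->
    [/\ dot l c = 0, dot l d = 0 & dot l e = 0] /\ [/\ c \in ps, d \in ps & e \in ps].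
  move=> pe; have h z : z \in [:: c; d; e] -> dot l z = 0 /\ z \in ps.
    by rewrite -(perm_mem pe) mem_on => /andP[/eqP].
  have [? ?] := h c (mem_head _ _).
  have [? ?] : dot l d = 0 /\ d \in ps by apply: h; rewrite !inE eqxx orbT.
  by have [? ?] : dot l e = 0 /\ e \in ps by apply: h; rewrite !inE eqxx !orbT.
have notboth l l' z : l \in s -> l' \in s -> l != l' -> z \in ps -> dot l z = 0 -> dot l' z = 0 -> False.
  by move=> lin l'in ne zin lz l'z; case/eqP: ne; apply: (parallel_disj par lin l'in zin).
have neq l l' z z' : l \in s -> l' \in s -> l != l' -> z \in ps -> dot l z = 0 -> dot l' z' = 0 -> z != z'.
  by move=> lin l'in ne zin lz l'z; apply/eqP => e; rewrite -e in l'z; apply: (notboth l l' z).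
have n23 : l2 != l3 by rewrite eq_sym.
have [[_ l2a l2b] [_ ain bin]] := mem3 _ _ _ _ ex; have [xa xb ab] := uniq3 _ _ _ _ ex.
have same r r' z : r \in ps -> r' \in ps -> z \in ps -> tri p r z -> tri p r' z -> r = r'.
  by move=> rin r'in zin; rewrite triCr (triCr p r'); apply: tri_uniq.
(* If y were on l2, all points of l3 would be joined to p through the single remaining point of
   l2. *)
have l3y : dot l3 y = 0.
  have [m ms [my nm1 nm4]] := third_class par l1s l4s n14 pin win yin l1p l4w ty.
  move: ms; rewrite (perm_mem e4) !inE (negbTE nm1) (negbTE nm4) orbF /=.
  case/orP => /eqP em; rewrite em in my => //; exfalso.
  have : size (on_pts l3) = 3 by apply/size_on/sub.
  case e3 : (on_pts l3) => [|r [|r' t]] // _.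
  have in3 z : z \in [:: r, r' & t] -> dot l3 z = 0 /\ z \in ps by rewrite -e3 mem_on => /andP[/eqP].
  have [l3r rin] := in3 r (mem_head _ _).
  have [l3r' r'in] : dot l3 r' = 0 /\ r' \in ps by apply: in3; rewrite !inE eqxx orbT.
  have rr' : r != r' by have := uniq_on l3; rewrite e3 /= inE negb_or => /andP[/andP[]].
  have third z : z \in ps -> dot l2 z = 0 -> z != x -> z != y -> z = if a == y then b else a.
    move=> zin l2z zx zy; have : z \in [:: x; a; b] by rewrite -(perm_mem ex) mem_on l2z eqxx.
    have : y \in [:: x; a; b] by rewrite -(perm_mem ex) mem_on my eqxx.
    rewrite !inE (eq_sym y x) (negbTE xy) (negbTE zx) /=.
    case/orP => /eqP ye; rewrite -ye in zy *; rewrite ?eqxx; case/orP => /eqP ze //.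
    - by rewrite ze eqxx in zy.
    - by rewrite ze ye (negbTE ab).
    - by rewrite ze eqxx in zy.
  have mt r0 : r0 \in ps -> dot l3 r0 = 0 -> exists2 z, z \in ps & tri p r0 z /\ z = if a == y then b else a.
    move=> r0in l3r0.
    have [||z zin [tz l2z]] := mate r0 l3 l2 r0in l3s l2s l3r0 n31 n34 n21 n24 n32.
    - exact: (neq l3 l2).
    - exact: (neq l3 l2).
    exists z => //; split=> //; apply: third => //.
      apply/eqP => ze; rewrite ze in tz; have e := same _ _ _ r0in vin xin tz tx.
      by apply: (notboth l3 l4 r0) => //; rewrite e.
    apply/eqP => ze; rewrite ze in tz; have e := same _ _ _ r0in win yin tz ty.
    by apply: (notboth l3 l4 r0) => //; rewrite e.
  have [z zin [tz ze]] := mt r rin l3r; have [z' _ [tz' z'e]] := mt r' r'in l3r'.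
  rewrite z'e -ze in tz'; case/eqP: rr'; exact: (same _ _ _ rin r'in zin tz tz').
have ax : a != x by rewrite eq_sym.
have bx : b != x by rewrite eq_sym.
have [z6 z6in [t6 l3z6]] := mate a l2 l3 ain l2s l3s l2a n21 n24 n31 n34 n23 ax (neq l2 l3 a y l2s l3s n23 ain l2a l3y).
have [z7 z7in [t7 l3z7]] := mate b l2 l3 bin l2s l3s l2b n21 n24 n31 n34 n23 bx (neq l2 l3 b y l2s l3s n23 bin l2b l3y).
have z6y : z6 != y.
  apply/eqP => e; rewrite e in t6; have e' := same _ _ _ ain win yin t6 ty.
  by apply: (notboth l2 l4 a) => //; rewrite e'.
have z7y : z7 != y.
  apply/eqP => e; rewrite e in t7; have e' := same _ _ _ bin win yin t7 ty.
  by apply: (notboth l2 l4 b) => //; rewrite e'.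
have z67 : z6 != z7.
  by apply/eqP => e; rewrite -e in t7; case/eqP: ab; apply: (same _ _ _ ain bin z6in t6 t7).
have e3 : perm_eq (on_pts l3) [:: z6; z7; y].
  have u3 : uniq [:: z6; z7; y] by rewrite /= !inE negb_or z67 z6y z7y.
  have s3 : {subset [:: z6; z7; y] <= on_pts l3}.
    by move=> z; rewrite !inE mem_on => /or3P[] /eqP ->; rewrite ?l3z6 ?l3z7 ?l3y eqxx.
  have le3 : (size (on_pts l3) <= size [:: z6; z7; y])%N by rewrite (size_on (sub _ l3s)).
  rewrite perm_sym; apply: uniq_perm => //; first exact: uniq_on.
  by have [] := uniq_min_size u3 s3 le3.
have ex' : perm_eq (on_pts l2) [:: a; b; x] by apply: (perm_trans ex); rewrite -(perm_rot 1 [:: x; a; b]).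
have ev' : perm_eq (on_pts l4) [:: v; w; u] by apply: (perm_trans ev); rewrite -(perm_rot 1 [:: u; v; w]).
have line l (c d e : pt) : l \in ls -> perm_eq (on_pts l) [:: c; d; e] -> tri c d e.
  by move=> lin pe; have [[? ? ?] _] := mem3 _ _ _ _ pe; have [? ? ?] := uniq3 _ _ _ _ pe; exact: (triI lin).
exists [:: p; p1; p2; a; b; x; z6; z7; y; v; w; u]; split=> //.
  rewrite perm_sym; apply: (@perm_trans _ (flatten (map on_pts [:: l1; l2; l3; l4]))); first by rewrite perm_sym.
  by rewrite /= cats0; exact: (perm_cat ep (perm_cat ex' (perm_cat e3 ev'))).
have t012 := line l1 p p1 p2 (sub _ l1s) ep; have t345 := line l2 a b x (sub _ l2s) ex'.
have t678 := line l3 z6 z7 y (sub _ l3s) e3; have t9 := line l4 v w u (sub _ l4s) ev'.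
by apply/allP; rewrite /= t012 t345 t678 t9 t6 t7 (triCr p x) tx (triCr p y) ty.
Qed.

Section Table.
Variable q : seq pt.
Hypothesis q_perm : perm_eq q ps.
Local Notation lab := (nth (null K) q).

(** Without a third point [find] returns the size of q, which is 12, the convention of the
    tables. *)
Definition third i j := find (tri (lab i) (lab j)) q.

Lemma size_q : size q = 12%N. Proof. by rewrite (perm_size q_perm). Qed.

Lemma uniq_q : uniq q. Proof. by rewrite (perm_uniq q_perm) (ps_uniq H). Qed.

Lemma lab_in i : (i < 12)%N -> lab i \in ps.
Proof. by move=> h; rewrite -(perm_mem q_perm) mem_nth // size_q. Qed.

Lemma lab_inj i j : (i < 12)%N -> (j < 12)%N -> (lab i == lab j) = (i == j).
Proof. by move=> hi hj; rewrite nth_uniq ?size_q ?uniq_q. Qed.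

Lemma third_le i j : (third i j <= 12)%N.
Proof. by rewrite -size_q find_size. Qed.

Lemma third_lt i j : (third i j < 12)%N = covered (lab i) (lab j).
Proof. by rewrite -size_q -has_find /covered (perm_has _ q_perm). Qed.

Lemma third_tri i j : (third i j < 12)%N -> tri (lab i) (lab j) (lab (third i j)).
Proof. by rewrite -size_q -has_find => h; exact: nth_find h. Qed.

Lemma third_eq i j k : (i < 12)%N -> (j < 12)%N -> (k < 12)%N ->
  tri (lab i) (lab j) (lab k) -> third i j = k.
Proof.
move=> hi hj hk t; have lt : (third i j < 12)%N.
  by rewrite third_lt; apply/hasP; exists (lab k); first exact: lab_in.
apply/eqP; rewrite -lab_inj //; apply/eqP.
by apply: (tri_uniq (lab_in hi) (lab_in hj) (lab_in lt) (lab_in hk) (third_tri lt) t).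
Qed.

(** [grid_closed] in terms of labels. A column carries three base points and no more, so distinct
    labels make the two columns disjoint. *)
Lemma third_grid a1 a2 a3 b1 b2 b3 :
  all (ltn^~ 12) ([:: a1; a2; a3] ++ [:: b1; b2; b3]) -> uniq ([:: a1; a2; a3] ++ [:: b1; b2; b3]) ->
  third a1 a2 = a3 -> third b1 b2 = b3 ->
  (third a1 b1 < 12)%N -> (third a2 b2 < 12)%N -> (third a3 b3 < 12)%N ->
  uniq [:: third a1 b1; third a2 b2; third a3 b3] -> third (third a1 b1) (third a2 b2) = third a3 b3.
Proof.
move=> al u ea eb h1 h2 h3 ur.
move: al; rewrite /= !andbT => /and5P[a1l a2l a3l b1l /andP[b2l b3l]].
have [_ [m1 m1in [ma1 ma2 ma3]]] : [/\ lab a1 != lab a2, lab a1 != lab a3 & lab a2 != lab a3] /\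
    exists2 l, l \in ls & [/\ dot l (lab a1) = 0, dot l (lab a2) = 0 & dot l (lab a3) = 0].
  by apply: triP; rewrite -[in lab a3]ea; apply: third_tri; rewrite ea.
have [_ [m2 m2in [mb1 mb2 mb3]]] : [/\ lab b1 != lab b2, lab b1 != lab b3 & lab b2 != lab b3] /\
    exists2 l, l \in ls & [/\ dot l (lab b1) = 0, dot l (lab b2) = 0 & dot l (lab b3) = 0].
  by apply: triP; rewrite -[in lab b3]eb; apply: third_tri; rewrite eb.
have [[_ r1a r1b] [l1 l1in [la1 lb1 lr1]]] := triP (third_tri h1).
have [[_ r2a r2b] [l2 l2in [la2 lb2 lr2]]] := triP (third_tri h2).
have [[_ r3a r3b] [l3 l3in [la3 lb3 lr3]]] := triP (third_tri h3).
have lu (xs : seq nat) : all (ltn^~ 12) xs -> uniq xs -> uniq (map lab xs).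
  move=> al' ux; rewrite map_inj_in_uniq // => i j hi hj /eqP.
  by rewrite (lab_inj (allP al' _ hi) (allP al' _ hj)) => /eqP.
have ulab : uniq (map lab ([:: a1; a2; a3] ++ [:: b1; b2; b3])).
  by apply: lu => //; rewrite /= a1l a2l a3l b1l b2l b3l.
have [m1m2|m1m2] := eqVneq (cross m1 m2) (null K).
  have e := ls_inj H m1in m2in m1m2; rewrite -e in mb1.
  have : (size [:: lab a1; lab a2; lab a3; lab b1] <= size (on_pts m1))%N.
    apply: uniq_leq_size.
      apply: subseq_uniq ulab; exact: (prefix_subseq [:: lab a1; lab a2; lab a3; lab b1] [:: lab b2; lab b3]).
    move=> z; rewrite !inE mem_on => /or4P[] /eqP ->;
      by rewrite ?ma1 ?ma2 ?ma3 ?mb1 eqxx lab_in.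
  by rewrite (size_on m1in).
have dis : F3 (cross m1 m2) != 0.
  apply/eqP => e; have [z zin [mz1 mz2]] := meet_base H (ls_lift H m1in) (ls_lift H m2in) m1m2 e.
  have sub_on m (i j k : nat) : m \in ls -> uniq [:: lab i; lab j; lab k] ->
      (i < 12)%N -> (j < 12)%N -> (k < 12)%N ->
      dot m (lab i) = 0 -> dot m (lab j) = 0 -> dot m (lab k) = 0 -> dot m z = 0 ->
      z \in [:: lab i; lab j; lab k].
    move=> min uu hi hj hk mi mj mk mz.
    have ss : {subset [:: lab i; lab j; lab k] <= on_pts m}.
      by move=> x; rewrite !inE mem_on => /or3P[] /eqP ->; rewrite ?mi ?mj ?mk eqxx lab_in.
    have le : (size (on_pts m) <= size [:: lab i; lab j; lab k])%N by rewrite (size_on min).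
    by have [_ ->] := uniq_min_size uu ss le; rewrite mem_on mz eqxx.
  move: ulab; rewrite map_cat cat_uniq => /and3P[ua /hasP[]].
  have zb : uniq [:: lab b1; lab b2; lab b3] -> z \in [:: lab b1; lab b2; lab b3].
    by move=> ub; apply: (sub_on m2).
  have ub : uniq [:: lab b1; lab b2; lab b3].
    by apply: (lu [:: b1; b2; b3]); [rewrite /= b1l b2l b3l | move: u; rewrite cat_uniq => /and3P[]].
  by exists z; [exact: zb | apply: (sub_on m1)].
have ua : uniq [:: lab a1; lab a2; lab a3] by move: ulab; rewrite map_cat cat_uniq => /and3P[].
have ub : uniq [:: lab b1; lab b2; lab b3] by move: ulab; rewrite map_cat cat_uniq => /and3P[].
have url : uniq [:: lab (third a1 b1); lab (third a2 b2); lab (third a3 b3)].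
  by apply: (lu [:: _; _; _]) => //; rewrite /= h1 h2 h3.
have [|||||n nin [n1 n2 n3]] := @grid_closed K charK F3 F4 ps ls H l1 l2 l3 m1 m2
  (lab a1) (lab a2) (lab a3) (lab b1) (lab b2) (lab b3)
  (lab (third a1 b1)) (lab (third a2 b2)) (lab (third a3 b3)) _ dis _ ua ub
  (And3 ma1 ma2 ma3) (And3 mb1 mb2 mb3) (And3 la1 la2 la3) (And3 lb1 lb2 lb3)
  (And3 lr1 lr2 lr3) _ url _ _.
- by move=> x; rewrite !inE => /or4P[|||/orP[]] /eqP ->.
- by move=> x; rewrite !inE => /or4P[|||/or3P[]] /eqP ->; exact: lab_in.
- by move=> x; rewrite !inE => /or3P[] /eqP ->; exact: lab_in.
- by split; rewrite eq_sym.
- by split; rewrite eq_sym.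
apply: third_eq => //; move: url; rewrite /= !inE negb_or => /and3P[/andP[r12 r13] r23 _].
exact: (triI nin).
Qed.

Lemma map_lab : map lab (iota 0 12) = q.
Proof. by rewrite -size_q; exact: mkseq_nth. Qed.

Lemma free_third i : (i < 12)%N -> unlinked_in third i = (11 - 2 * deg (lab i))%N.
Proof.
move=> hi; rewrite -(count_uncovered (lab_in hi)) -(permP q_perm).
rewrite -[X in _ = count _ X]map_lab count_map; apply: eq_in_count => j.
rewrite mem_iota => /andP[_ hj] /=; rewrite lab_inj // -third_lt ltn_neqAle third_le andbT.
by rewrite negbK.
Qed.

Lemma labels_modelled :
  {in start_lines, forall abc, tri (lab abc.1.1) (lab abc.1.2) (lab abc.2)} ->
  ~~ covered (lab 0) (lab 11) -> modelled third.
Proof.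
move=> hs h11.
have deg5 i : (i < 12)%N -> (2 * deg (lab i) <= 10)%N.
  by move=> hi; rewrite (@leq_mul2l 2 _ 5); exact: (lns_count_le5 charK H (lab_in hi)).
apply: (@start_sound third _ _ _ _ _ _ 100); last exact: search_succeeds.
- move=> i j hi hj ij; apply/eqP; rewrite /third.
  by apply/eqP; apply: eq_find => r; rewrite triC.
- exact: third_le.
- move=> i j hi hj ij lt; have t := third_tri lt; have [[_ n1 n2] _] := triP t.
  rewrite lab_inj // eq_sym in n1; rewrite lab_inj // eq_sym in n2; split=> //.
  by apply: third_eq => //; rewrite triCr.
- exact: third_grid.
- move=> i hi; rewrite free_third // oddB; last by have := deg5 i hi; lia.
  by rewrite oddM.
- have -> : [seq unlinked_in third i | i <- iota 0 12] = [seq (11 - 2 * deg (lab i))%N | i <- iota 0 12].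
    by apply/eq_in_map => i; rewrite mem_iota => /andP[_]; exact: free_third.
  have e : (\sum_(i <- iota 0 12) deg (lab i) = 57)%N.
    by rewrite -sum_deg -(perm_big _ q_perm) /= -[X in _ = \sum_(i <- X) _]map_lab big_map.
  have : (\sum_(i <- iota 0 12) (11 - 2 * deg (lab i)) + 2 * \sum_(i <- iota 0 12) deg (lab i) = 132)%N.
    rewrite big_distrr -big_split /= (eq_big_seq (fun=> 11%N)); first by rewrite big_const_seq.
    by move=> i hi; have /deg5 : (i < 12)%N by [move: i hi; exact/allP]; lia.
  by rewrite e sumnE big_map; lia.
- move=> abc habc; have : [&& abc.1.1 < 12, abc.1.2 < 12 & abc.2 < 12]%N by move: abc habc; exact/allP.
  by move=> /and3P[h1 h2 h3]; apply: third_eq => //; exact: hs.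
- by apply/eqP; rewrite eqn_leq third_le leqNgt third_lt.
Qed.

End Table.

Lemma model_points (l1 l2 l3 l4 : pt) : [/\ l1 \in ls, l2 \in ls, l3 \in ls & l4 \in ls] ->
  (forall p, p \in ps -> has (fun l => dot l p == 0) [:: l1; l2; l3; l4]) ->
  exists2 o : seq pt, perm_eq o ps &
  {in model_lines, forall abc, tri (nth (null K) o abc.1.1) (nth (null K) o abc.1.2) (nth (null K) o abc.2)}.
Proof.
move=> inl cov; have [q [qp hs h11]] := exists_labels (parallel_cover inl cov).
have [o ho hm] := labels_modelled qp hs h11.
have po : perm_eq o (iota 0 12).
  have : all (fun o => perm_eq o (iota 0 12)) labellings by vm_compute.
  by move/allP; apply.
have so : size o = 12%N by rewrite (perm_size po).
exists (map (nth (null K) q) o).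
  apply: (perm_trans _ qp); rewrite -[X in perm_eq _ X](map_lab qp).
  exact: perm_map.
move=> abc habc; have : [&& abc.1.1 < 12, abc.1.2 < 12 & abc.2 < 12]%N by move: abc habc; exact/allP.
move=> /and3P[h1 h2 h3]; rewrite !(nth_map 0%N) ?so //.
have lt : (nth 0 o abc.2 < 12)%N.
  by have := mem_nth 0%N (eq_ind_r (fun n => (abc.2 < n)%N) h3 so); rewrite (perm_mem po) mem_iota.
by rewrite -[in nth 0%N o abc.2](hm _ habc); apply: third_tri; rewrite ?hm.
Qed.

End Labels.

(** * Coordinates *)

Section Coordinates.
Variable K : fieldType.
Hypothesis charK : [pchar K] =i pred0.
Local Notation pt := (pt K).
Variables F3 F4 : pt -> K.
Variables ps ls : seq pt.
Hypothesis H : monoid_config F3 F4 ps ls.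
Hypotheses (size_ls : size ls = 19%N) (size_ps : size ps = 12%N).
Hypothesis three : {in ls, forall l, count (fun p => dot l p == 0%R) ps = 3%N}.

Lemma line_off l (p q r s : pt) : l \in ls -> {subset [:: p; q; r; s] <= ps} ->
  uniq [:: p; q; r; s] -> dot l p = 0 -> dot l q = 0 -> dot l r = 0 -> dot l s != 0.
Proof.
move=> lin sub u lp lq lr; apply/eqP => lz.
have : (size [:: p; q; r; s] <= size (on_pts ps l))%N.
  apply: uniq_leq_size => // x hx; rewrite mem_on sub // andbT.
  by move: hx; rewrite !inE => /or4P[] /eqP ->; apply/eqP.
by rewrite size_filter three.
Qed.

Lemma on_three l (p q r z : pt) : l \in ls -> {subset [:: p; q; r] <= ps} ->
  uniq [:: p; q; r] -> dot l p = 0 -> dot l q = 0 -> dot l r = 0 ->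
  z \in ps -> dot l z = 0 -> z \in [:: p; q; r].
Proof.
move=> lin sub u lp lq lr zin lz.
have sb : {subset [:: p; q; r] <= on_pts ps l}.
  move=> x hx; rewrite mem_on sub // andbT.
  by move: hx; rewrite !inE => /or3P[] /eqP ->; apply/eqP.
have le : (size (on_pts ps l) <= size [:: p; q; r])%N by rewrite size_filter three.
by have [_ ->] := uniq_min_size u sb le; rewrite mem_on zin lz eqxx.
Qed.

Lemma disjoint_lines l m (p q r p' q' r' : pt) : l \in ls -> m \in ls ->
  {subset [:: p; q; r; p'; q'; r'] <= ps} -> uniq [:: p; q; r; p'; q'; r'] ->
  [/\ dot l p = 0, dot l q = 0 & dot l r = 0] -> [/\ dot m p' = 0, dot m q' = 0 & dot m r' = 0] ->
  F3 (cross l m) != 0.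
Proof.
move=> lin min sub u [lp lq lr] [mp mq mr].
have inps x : x \in [:: p; q; r; p'; q'; r'] -> x \in ps by exact: sub.
have p'in : p' \in ps by apply: sub; rewrite !inE eqxx !orbT.
have pre : subseq [:: p; q; r; p'] [:: p; q; r; p'; q'; r'] by exact: (prefix_subseq [:: p; q; r; p'] [:: q'; r']).
have off : dot l p' != 0.
  apply: (line_off lin _ (subseq_uniq pre u)) => // x hx; apply: sub; exact: (mem_subseq pre).
have X0 : cross l m != null K.
  by apply: contraNneq off => e; rewrite (ls_inj H lin min e) mp.
apply/eqP => e; have [z zin [lz mz]] := meet_base H (ls_lift H lin) (ls_lift H min) X0 e.
have u1 : uniq [:: p; q; r] by exact: subseq_uniq (prefix_subseq [:: p; q; r] [:: p'; q'; r']) u.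
have u2 : uniq [:: p'; q'; r'] by exact: subseq_uniq (suffix_subseq [:: p; q; r] [:: p'; q'; r']) u.
have zl : z \in [:: p; q; r].
  apply: (on_three lin) => // x hx; apply: sub; exact: (mem_subseq (prefix_subseq [:: p; q; r] [:: p'; q'; r'])).
have zm : z \in [:: p'; q'; r'].
  apply: (on_three min) => // x hx; apply: sub; exact: (mem_subseq (suffix_subseq [:: p; q; r] [:: p'; q'; r'])).
move: u; rewrite -[_ :: _]/([:: p; q; r] ++ [:: p'; q'; r']) cat_uniq => /and3P[_ /hasP[]].
by exists z.
Qed.

Lemma tri_det0 (p q r : pt) : tri ls p q r -> det3 p q r = 0.
Proof.
move=> /triP[_ [l lin [lp lq lr]]]; have [l0 _] := ls_lift H lin.
have [w hw] := null_dot l0; apply/eqP; apply: contraNT hw => d.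
by rewrite (cmb_basis w d) dot_cmb lp lq lr !mulr0 !addr0.
Qed.

Lemma tri_det (p q r s : pt) : tri ls p q r -> {subset [:: p; q; r; s] <= ps} ->
  [/\ s != p, s != q & s != r] -> det3 p q s != 0.
Proof.
move=> t sub [sp sq sr]; have [[pq pr qr] [l lin [lp lq lr]]] := triP t.
have inp x : x \in [:: p; q; r; s] -> x \in ps by exact: sub.
have off : dot l s != 0.
  apply: (line_off lin sub _ lp lq lr).
  by rewrite /= !inE !negb_or pq pr qr (eq_sym p s) (eq_sym q s) (eq_sym r s) sp sq sr.
have X0 : cross p q != null K.
  apply: contraNneq pq => e; apply/eqP/(ps_inj H) => //; apply: inp; by rewrite !inE eqxx ?orbT.
have [k kE] := line_through X0 lp lq.
apply: contraNneq off => e.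
by rewrite kE dotC dot_scal dotC dot_cross e mulr0.
Qed.

Variable o : seq pt.
Hypothesis o_perm : perm_eq o ps.
Hypothesis o_model : {in model_lines, forall abc,
  tri ls (nth (null K) o abc.1.1) (nth (null K) o abc.1.2) (nth (null K) o abc.2)}.
Local Notation P := (nth (null K) o).

Lemma Pin i : (i < 12)%N -> P i \in ps.
Proof. by move=> h; rewrite -(perm_mem o_perm) mem_nth // (perm_size o_perm) size_ps. Qed.

Lemma P_eq i j : (i < 12)%N -> (j < 12)%N -> (P i == P j) = (i == j).
Proof.
by move=> hi hj; rewrite nth_uniq ?(perm_size o_perm) ?size_ps // (perm_uniq o_perm) (ps_uniq H).
Qed.

Lemma P_uniq (s : seq nat) : all (ltn^~ 12) s -> uniq s -> uniq (map P s).
Proof.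
move=> al us; rewrite map_inj_in_uniq // => i j hi hj /eqP.
by rewrite (P_eq (allP al _ hi) (allP al _ hj)) => /eqP.
Qed.

Lemma P_sub (s : seq nat) : all (ltn^~ 12) s -> {subset map P s <= ps}.
Proof. by move=> al x /mapP[i hi ->]; apply/Pin/(allP al). Qed.

Lemma P_tri i j k : (i, j, k) \in model_lines -> tri ls (P i) (P j) (P k).
Proof. by move=> h; exact: (o_model h). Qed.

Lemma P_line i j k : (i, j, k) \in model_lines ->
  exists2 l, l \in ls & [/\ dot l (P i) = 0, dot l (P j) = 0 & dot l (P k) = 0].
Proof. by move=> /P_tri /triP[]. Qed.

(** 0, 2, 5 form a triangle with 3 on the side 2 5 and 4 on the side 0 5, neither being a vertex.
    Scaling the vectors of 5 and 2 normalizes 3, and scaling that of 0 by - a d / c then normalizes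
    4. *)
Lemma P_frame : exists p q r : pt, [/\ det3 p q r != 0,
  exists2 k, k != 0 & P 5 = scal k p, exists2 k, k != 0 & P 2 = scal k q,
  exists2 k, k != 0 & P 0 = scal k r &
  (exists2 k, k != 0 & P 3 = scal k (cmb p q r 1 (-1) 0)) /\
  (exists2 k, k != 0 & P 4 = scal k (cmb p q r 1 0 (-1)))].
Proof.
have X i j : (i < 12)%N -> (j < 12)%N -> i != j -> cross (P i) (P j) != null K.
  move=> hi hj; rewrite -P_eq //; apply: contraNneq => e; apply/eqP.
  by apply: (ps_inj H) => //; apply: Pin.
have [l lin [l2 l3 l5]] := P_line (isT : (2, 3, 5) \in model_lines).
have [m min [m0 m4 m5]] := P_line (isT : (0, 4, 5) \in model_lines).
have [ln _] := ls_lift H lin; have [mn _] := ls_lift H min.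
have [a [b e3]] := on_line (X 5 2 isT isT isT) l5 l2 ln l3.
have [c [d e4]] := on_line (X 5 0 isT isT isT) m5 m0 mn m4.
have a0 : a != 0.
  apply: contraTneq (X 2 3 isT isT isT) => a0; rewrite negbK e3 a0.
  by apply/eqP/pt_ext => /=; ring.
have b0 : b != 0.
  apply: contraTneq (X 5 3 isT isT isT) => b0; rewrite negbK e3 b0.
  by apply/eqP/pt_ext => /=; ring.
have c0 : c != 0.
  apply: contraTneq (X 0 4 isT isT isT) => c0; rewrite negbK e4 c0.
  by apply/eqP/pt_ext => /=; ring.
have d0 : d != 0.
  apply: contraTneq (X 5 4 isT isT isT) => d0; rewrite negbK e4 d0.
  by apply/eqP/pt_ext => /=; ring.
have D : det3 (P 0) (P 2) (P 5) != 0.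
  have t : tri ls (P 0) (P 2) (P 1) by rewrite triCr; apply: P_tri.
  by apply: (tri_det t); [apply: (P_sub (s := [:: 0; 2; 1; 5])) | rewrite !P_eq].
exists (scal a (P 5)), (scal (- b) (P 2)), (scal (- (a * d / c)) (P 0)); split.
- have -> : det3 (scal a (P 5)) (scal (- b) (P 2)) (scal (- (a * d / c)) (P 0)) =
    - (a * b * (a * d / c)) * det3 (P 0) (P 2) (P 5) by rewrite /det3 /dot /=; ring.
  by rewrite mulf_neq0 // oppr_eq0 !mulf_neq0 // invr_eq0.
- by exists a^-1; rewrite ?invr_eq0 //; apply: pt_ext; rewrite /= mulKf.
- by exists (- b)^-1; rewrite ?invr_eq0 ?oppr_eq0 //; apply: pt_ext; rewrite /= mulKf // oppr_eq0.
- have n0 : - (a * d / c) != 0 by rewrite oppr_eq0 !mulf_neq0 // invr_eq0.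
  by exists (- (a * d / c))^-1; rewrite ?invr_eq0 //; apply: pt_ext; rewrite /= mulKf.
- split; first by exists 1; rewrite ?oner_eq0 // e3; apply: pt_ext => /=; ring.
  exists (c / a); first by rewrite mulf_neq0 // invr_eq0.
  by rewrite e4; apply: pt_ext; rewrite /=; field; rewrite a0 c0.
Qed.

End Coordinates.

(** * The free parameter *)

Section Surface_parameter.
Variable K : fieldType.
Hypothesis charK : [pchar K] =i pred0.
Local Notation pt := (pt K).
Variables F3 F4 : pt -> K.
Variables ps ls : seq pt.
Hypothesis H : monoid_config F3 F4 ps ls.
Hypotheses (size_ls : size ls = 19%N) (size_ps : size ps = 12%N).
Hypothesis three : {in ls, forall l, count (fun p => dot l p == 0%R) ps = 3%N}.
Variable o : seq pt.
Hypothesis o_perm : perm_eq o ps.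
Hypothesis o_model : {in model_lines, forall abc,
  tri ls (nth (null K) o abc.1.1) (nth (null K) o abc.1.2) (nth (null K) o abc.2)}.
Local Notation P := (nth (null K) o).
Variables p q r : pt.
Hypothesis pqr : det3 p q r != 0.

Definition in_frame (u : pt) : pt := cmb p q r u.1.1 u.1.2 u.2.
(** m is an equation, in frame coordinates, of the lifting line through three labelled points. *)
Definition line_at i j k (m : pt) :=
  exists2 l, l \in ls /\ [/\ dot l (P i) = 0, dot l (P j) = 0 & dot l (P k) = 0] &
    exists2 c, c != 0 & forall x, dot l (in_frame x) = c * dot m x.
Definition at_pt i (u : pt) := exists2 k, k != 0 & P i = scal k (in_frame u).

Lemma det_frame (a b c : K) (u v w : pt) :
  det3 (scal a (in_frame u)) (scal b (in_frame v)) (scal c (in_frame w)) =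
  a * b * c * (det3 u v w * det3 p q r).
Proof. by rewrite /det3 /dot /=; ring. Qed.

Lemma dot_frame (l x : pt) : dot l (in_frame x) = dot (dot l p, dot l q, dot l r) x.
Proof. by rewrite /dot /=; ring. Qed.

Lemma in_frame_onto (w : pt) : exists x, w = in_frame x.
Proof. by rewrite (cmb_basis w pqr); eexists (_, _, _). Qed.

Lemma at_scal i (c : K) (u v : pt) : at_pt i u -> c != 0 -> u = scal c v -> at_pt i v.
Proof.
move=> [k k0 e] c0 uv; exists (k * c); first by rewrite mulf_neq0.
by rewrite e uv; apply: pt_ext => /=; ring.
Qed.

Lemma at_exists i : exists u, at_pt i u.
Proof.
have [x e] := in_frame_onto (P i); exists x, 1; rewrite ?oner_eq0 // e.
by apply: pt_ext => /=; ring.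
Qed.

Lemma at_inj i j u : (i < 12)%N -> (j < 12)%N -> i != j -> at_pt i u -> at_pt j u -> False.
Proof.
move=> hi hj ij [a a0 ea] [b b0 eb]; move: ij.
rewrite -(P_eq H size_ps o_perm) // => /eqP[]; apply: (ps_inj H).
- exact: Pin.
- exact: Pin.
- by rewrite ea eb; apply: pt_ext => /=; ring.
Qed.

Lemma at_tri i j k u v w : (i, j, k) \in model_lines -> at_pt i u -> at_pt j v -> at_pt k w ->
  det3 u v w = 0.
Proof.
move=> h [a a0 ea] [b b0 eb] [c c0 ec].
have /eqP := tri_det0 H (P_tri o_model h); rewrite ea eb ec det_frame.
by rewrite !mulf_eq0 (negPf a0) (negPf b0) (negPf c0) (negPf pqr) /= orbF => /eqP.
Qed.

Lemma at_ntri i j k l u v w : (i, j, k) \in model_lines -> (l < 12)%N -> l \notin [:: i; j; k] ->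
  at_pt i u -> at_pt j v -> at_pt l w -> det3 u v w != 0.
Proof.
move=> h l12 ln [a a0 ea] [b b0 eb] [c c0 ec].
have : all (fun abc => [&& abc.1.1 < 12, abc.1.2 < 12 & abc.2 < 12])%N model_lines by [].
move=> /allP /(_ _ h) /and3P[/= i12 j12 k12].
have : det3 (P i) (P j) (P l) != 0.
  apply: (tri_det H three (P_tri o_model h)).
    by apply: (P_sub size_ps o_perm (s := [:: i; j; k; l])); rewrite /= i12 j12 k12 l12.
  by move: ln; rewrite !(P_eq H size_ps o_perm) // !inE !negb_or => /and3P.
by rewrite ea eb ec det_frame; apply: contraNneq => ->; rewrite mul0r mulr0.
Qed.

Lemma at_line i j k u v m : (i, j, k) \in model_lines -> at_pt i u -> at_pt j v ->
  m != null K -> dot m u = 0 -> dot m v = 0 ->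
  line_at i j k m.
Proof.
move=> h [a a0 ea] [b b0 eb] m0 mu mv.
have /triP[[ij _ _] [l lin [l1 l2 l3]]] := P_tri o_model h.
have : all (fun abc => [&& abc.1.1 < 12, abc.1.2 < 12 & abc.2 < 12])%N model_lines by [].
move=> /allP /(_ _ h) /and3P[/= i12 j12 k12].
have pi := Pin size_ps o_perm i12; have pj := Pin size_ps o_perm j12.
have u0 : u != null K.
  apply: contraTneq (pi) => u0; apply/negP => /(ps_base H)[].
  by rewrite ea u0; case/eqP; apply: pt_ext => /=; ring.
have uv : cross u v != null K.
  apply: contraNneq ij => /(cross_null u0)[k' e]; apply/eqP/(ps_inj H) => //.
  by rewrite ea eb e; apply: pt_ext => /=; ring.
exists l => //.
pose l' : pt := (dot l p, dot l q, dot l r).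
have l'u : dot l' u = 0.
  move: l1; rewrite ea dot_scal dot_frame => /eqP.
  by rewrite mulf_eq0 (negPf a0) => /eqP.
have l'v : dot l' v = 0.
  move: l2; rewrite eb dot_scal dot_frame => /eqP.
  by rewrite mulf_eq0 (negPf b0) => /eqP.
have [s es] := line_through uv l'u l'v.
have [t et] := line_through uv mu mv.
have t0 : t != 0 by apply: contraNneq m0 => t0; rewrite et t0; apply/eqP/pt_ext => /=; ring.
have [ln _] := ls_lift H lin; have [w lw] := null_dot ln.
have [x ex] := in_frame_onto w.
have s0 : s != 0.
  apply: contraNneq lw => s0; rewrite ex dot_frame -/l' es s0 dotC dot_scal mul0r //.
exists (s / t); first by rewrite mulf_neq0 // invr_eq0.
by move=> y; rewrite dot_frame -/l' es et !(dotC _ y) !dot_scal mulrA divfK.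
Qed.

Hypotheses (at0 : at_pt 0 (0, 0, 1)) (at2 : at_pt 2 (0, 1, 0)) (at5 : at_pt 5 (1, 0, 0))
  (at3 : at_pt 3 (1, -1, 0)) (at4 : at_pt 4 (1, 0, -1)).

Lemma at_affine i : i \in [:: 6; 7; 8; 9; 10; 11] -> exists y z, at_pt i (1, y, z).
Proof.
move=> hi; have i12 : (i < 12)%N by move: i hi; apply/allP.
have i0 : i \notin [:: 0; 2; 1] by move: i hi {i12}; apply/allP.
have [[[x y] z] ai] := at_exists i.
have t021 : tri ls (P 0) (P 2) (P 1) by rewrite triCr; apply: P_tri.
have x0 : x != 0.
  have [a a0 ea] := at0; have [b b0 eb] := at2; have [c c0 ec] := ai.
  have : det3 (P 0) (P 2) (P i) != 0.
    apply: (tri_det H three t021).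
      by apply: (P_sub size_ps o_perm (s := [:: 0; 2; 1; i])); rewrite /= i12.
    by move: i0; rewrite !(P_eq H size_ps o_perm) // !inE !negb_or => /and3P.
  rewrite ea eb ec det_frame; apply: contraNneq => ->.
  by rewrite /det3 /dot /=; apply/eqP; ring.
exists (y / x), (z / x); apply: (at_scal ai x0).
by apply: pt_ext; rewrite /= ?mulr1 // mulrC divfK.
Qed.

(** 1 is where the line x = 0 of 0 and 2 meets the line x + y + z = 0 of 3 and 4. *)
Lemma at1 : at_pt 1 (0, 1, -1).
Proof.
have [[[x y] z] a1] := at_exists 1.
have := at_tri (isT : (0, 1, 2) \in model_lines) at0 a1 at2.
rewrite /det3 /dot /= => hx; have {hx} x0 : x = 0 by rewrite -hx; ring.
have := at_tri (isT : (1, 3, 4) \in model_lines) a1 at3 at4.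
rewrite /det3 /dot /= x0 => hz; have {hz} zy : z = - y.
  by apply/eqP; rewrite -subr_eq0 -hz; apply/eqP; ring.
subst x z; apply: (at_scal a1 (c := y)); last by apply: pt_ext => /=; ring.
apply: contraTneq (Pin size_ps o_perm (isT : 1 < 12)%N) => y0.
apply/negP => /(ps_base H)[/eqP[]]; have [c c0 ->] := a1; rewrite y0.
by apply: pt_ext => /=; ring.
Qed.

Lemma surface_parameter : exists a : K,
  [/\ a != -1, a != 0, a * 2 != 1, a != 1 & a != 2] /\
  [/\ at_pt 6 (1, a - 2, - a), at_pt 7 (1, a - 2, 1), at_pt 8 (1, 2 * a - 1, - a),
      at_pt 9 (a, 1 - 2 * a, -1) & at_pt 10 (a, 1 - 2 * a, a) /\ at_pt 11 (a, 2 - a, -1)].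
Proof.
have [Q [S a6]] := @at_affine 6 isT; have [Q' [R a7]] := @at_affine 7 isT.
have [N [S' a8]] := @at_affine 8 isT; have [W [V a9]] := @at_affine 9 isT.
have [W' [R' a10]] := @at_affine 10 isT; have [M [V' a11]] := @at_affine 11 isT.
have eQ : Q' = Q.
  have := at_tri (isT : (0, 6, 7) \in model_lines) at0 a6 a7.
  by rewrite /det3 /dot /= => h; apply/eqP; rewrite -subr_eq0 -h; apply/eqP; ring.
have eW : W' = W.
  have := at_tri (isT : (0, 9, 10) \in model_lines) at0 a9 a10.
  by rewrite /det3 /dot /= => h; apply/eqP; rewrite -subr_eq0 -h; apply/eqP; ring.
have eR : R' = R.
  have := at_tri (isT : (2, 7, 10) \in model_lines) at2 a7 a10.
  by rewrite /det3 /dot /= => h; apply/eqP; rewrite -subr_eq0 -oppr_eq0 -h; apply/eqP; ring.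
have eS : S' = S.
  have := at_tri (isT : (2, 6, 8) \in model_lines) at2 a6 a8.
  by rewrite /det3 /dot /= => h; apply/eqP; rewrite -subr_eq0 -oppr_eq0 -h; apply/eqP; ring.
have eV : V' = V.
  have := at_tri (isT : (2, 9, 11) \in model_lines) at2 a9 a11.
  by rewrite /det3 /dot /= => h; apply/eqP; rewrite -subr_eq0 -oppr_eq0 -h; apply/eqP; ring.
subst Q' W' R' S' V'.
have e57 : Q * V = R * M.
  have := at_tri (isT : (5, 7, 11) \in model_lines) at5 a7 a11.
  by rewrite /det3 /dot /= => h; apply/eqP; rewrite -subr_eq0 -h; apply/eqP; ring.
have e58 : N * R = S * W.
  have := at_tri (isT : (5, 8, 10) \in model_lines) at5 a8 a10.
  by rewrite /det3 /dot /= => h; apply/eqP; rewrite -subr_eq0 -h; apply/eqP; ring.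
have e36 : (Q + 1) * R = (W + 1) * S.
  have := at_tri (isT : (3, 6, 10) \in model_lines) at3 a6 a10.
  by rewrite /det3 /dot /= => h; apply/eqP; rewrite -subr_eq0 -h; apply/eqP; ring.
have e37 : (Q + 1) * V = (W + 1) * R.
  have := at_tri (isT : (3, 7, 9) \in model_lines) at3 a7 a9.
  by rewrite /det3 /dot /= => h; apply/eqP; rewrite -subr_eq0 -h; apply/eqP; ring.
have e17 : Q + R = N + S.
  have := at_tri (isT : (1, 7, 8) \in model_lines) at1 a7 a8.
  by rewrite /det3 /dot /= => h; apply/eqP; rewrite -subr_eq0 -h; apply/eqP; ring.
have e16 : Q + S = W + V.
  have := at_tri (isT : (1, 6, 9) \in model_lines) at1 a6 a9.
  by rewrite /det3 /dot /= => h; apply/eqP; rewrite -subr_eq0 -h; apply/eqP; ring.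
have z0 i x y z : (i < 12)%N -> i \notin [:: 2; 3; 5] -> at_pt i (x, y, z) -> z != 0.
  move=> i12 ni ai.
  have := at_ntri (isT : (2, 3, 5) \in model_lines) i12 ni at2 at3 ai.
  by apply: contraNneq => ->; rewrite /det3 /dot /=; apply/eqP; ring.
have y0 i x y z : (i < 12)%N -> i \notin [:: 0; 4; 5] -> at_pt i (x, y, z) -> y != 0.
  move=> i12 ni ai.
  have := at_ntri (isT : (0, 4, 5) \in model_lines) i12 ni at0 at4 ai.
  by apply: contraNneq => ->; rewrite /det3 /dot /=; apply/eqP; ring.
have S0 := z0 6 _ _ _ isT isT a6; have R0 := z0 7 _ _ _ isT isT a7.
have V0 := z0 9 _ _ _ isT isT a9; have Q0 := y0 6 _ _ _ isT isT a6.
have W0 := y0 9 _ _ _ isT isT a9.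
(* Otherwise Q = W = - 1, and 7 and 10 coincide. *)
have W1 : W + 1 != 0.
  apply/eqP => W1; move/eqP: e36; rewrite W1 mul0r mulf_eq0 (negPf R0) orbF => /eqP Q1.
  have eQW : Q = W by apply: (addIr 1); rewrite Q1 W1.
  by rewrite -eQW in a10; exact: (@at_inj 7 10 _ isT isT isT a7 a10).
pose k := (Q + 1) / (W + 1).
have eQ : Q = k * (W + 1) - 1 by rewrite /k divfK // addrK.
have eS : S = k * R by apply: (mulfI W1); rewrite -e36 eQ; ring.
have eR : R = k * V by apply: (mulfI W1); rewrite -e37 eQ; ring.
have k0 : k != 0 by apply: contraNneq R0 => k0; rewrite eR k0 mul0r.
have k1 : k != 1.
  apply/eqP => k1; have eSR : S = R by rewrite eS k1 mul1r.
  by rewrite eSR in a6; exact: (@at_inj 6 7 _ isT isT isT a6 a7).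
have k1' : k - 1 != 0 by rewrite subr_eq0.
have eN : N = k * W by apply: (mulIf R0); rewrite e58 eS; ring.
have R1 : R = 1.
  apply: (mulfI k1'); rewrite mulr1; apply/eqP; rewrite -subr_eq0.
  have /eqP := e17; rewrite -subr_eq0 eN eS eQ => /eqP h.
  by rewrite -oppr_eq0 -h; apply/eqP; ring.
have eV : V = k^-1 by apply: (mulfI k0); rewrite -eR R1 divff.
have eS' : S = k by rewrite eS R1 mulr1.
have eW : W = - (1 + 2 * k) / k.
  apply: (mulfI k1'); apply/eqP; rewrite -subr_eq0.
  have /eqP := e16; rewrite -subr_eq0 eV eS' eQ => /eqP h.
  by rewrite -h; apply/eqP; field.
have eQ' : Q = - k - 2 by rewrite eQ eW; field.
have eN' : N = - (1 + 2 * k) by rewrite eN eW mulrC divfK.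
have eM : M = Q / k by apply: (mulfI R0); rewrite -e57 R1 eV mul1r.
have nk x : - k = - x -> k = x by move/oppr_inj.
exists (- k); split.
  split.
  - by apply: contraNneq k1 => /nk ->.
  - by rewrite oppr_eq0.
  - apply: contraNneq W0 => h; have {}h : 1 + 2 * k = 0.
      have -> : 1 + 2 * k = 1 - (- k * 2) by ring.
      by rewrite h subrr.
    by rewrite eW h oppr0 mul0r.
  - apply/eqP => h; have {}h : k = -1 by rewrite -h opprK.
    have e1 : S = V by rewrite eS' eV h invrN invr1.
    have e2 : Q = W by rewrite eQ' eW h invrN invr1; ring.
    by rewrite -e1 -e2 in a9; exact: (@at_inj 6 9 _ isT isT isT a6 a9).
  - apply: contraNneq Q0 => h; have {}h : k = -2 by rewrite -h opprK.
    by rewrite eQ' h; apply/eqP; ring.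
have kn : (- k)^-1 != 0 by rewrite invr_eq0 oppr_eq0.
split.
- by rewrite -eQ' opprK -eS'.
- by rewrite -eQ'; rewrite R1 in a7.
- have -> : 2 * - k - 1 = N by rewrite eN'; ring.
  by rewrite opprK -eS'.
- apply: (at_scal a9 kn); rewrite eW eV; apply: pt_ext => /=; field; by rewrite ?oppr_eq0 k0.
- split.
    apply: (at_scal a10 kn); rewrite eW R1; apply: pt_ext => /=; field; by rewrite ?oppr_eq0 k0.
  apply: (at_scal a11 kn); rewrite eM eV eQ'; apply: pt_ext => /=; field; by rewrite ?oppr_eq0 k0.
Qed.

End Surface_parameter.

(** * The normal form of the equation *)

Definition normal_cubic (K : fieldType) (a x y z : K) : K :=
  - (2 * a) * (x ^+ 2 * y) - (2 * a) * (x * y ^+ 2)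
  + (2 * (2 * a - 1) * (a - 2)) * (x ^+ 2 * z)
  + (4 * (a ^+ 2 - 3 * a + 1)) * (x * y * z)
  - (2 * a) * (y ^+ 2 * z)
  + (2 * (2 * a - 1) * (a - 2)) * (x * z ^+ 2)
  - (2 * a) * (y * z ^+ 2).

(** [Q a] is t [normal_cubic] + [normal_quartic]. *)
Definition normal_quartic (K : fieldType) (a x y z : K) : K :=
  (2 * a) * (x ^+ 3 * y) + (4 * a) * (x ^+ 2 * y ^+ 2)
  + (2 * a) * (x * y ^+ 3)
  - ((2 * a - 1) * (a - 2)) * (x ^+ 3 * z)
  - (5 * a ^+ 2 - 17 * a + 5) * (x ^+ 2 * y * z)
  - (3 * (a ^+ 2 - 4 * a + 1)) * (x * y ^+ 2 * z)
  + a * (y ^+ 3 * z)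
  - (3 * (2 * a - 1) * (a - 2)) * (x ^+ 2 * z ^+ 2)
  - (7 * a ^+ 2 - 19 * a + 7) * (x * y * z ^+ 2)
  + (2 * a) * (y ^+ 2 * z ^+ 2)
  - (2 * (2 * a - 1) * (a - 2)) * (x * z ^+ 3)
  + a * (y * z ^+ 3).

Section Normal.
Variable K : fieldType.
Hypothesis charK : [pchar K] =i pred0.
Implicit Types a x y z : K.

Lemma normal_cubicE a x y z : normal_cubic a x y z =
  2 * (x * (a * y + (2 * a - 1) * z) * ((a - 2) * x + (a - 1) * y + (a - 2) * z) -
       y * ((a - 1) * x + a * y + a * z) * (a * x + z)).
Proof. by rewrite /normal_cubic; ring. Qed.

Lemma normal_quarticE a x y z : a != 1 ->
  y * ((a - 1) * x + a * y + a * z) * (a * x + z) * (x + y + (1 - a) * z) =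
  (a - 1) * (normal_quartic a x y z -
     (- (1 / 2) * x + (2 - a) / (2 * (a - 1)) * y - z) * normal_cubic a x y z).
Proof.
move=> a1; have two : 2 != 0 :> K by have := charK 2; rewrite !inE /= => ->.
rewrite /normal_cubic /normal_quartic; field.
by rewrite two subr_eq0 a1.
Qed.

Variables F3 F4 : pt K -> K.
Variables ps ls : seq (pt K).
Hypothesis H : monoid_config F3 F4 ps ls.

Lemma normal_form : (size ps + size ls = 31)%N ->
  exists2 a : K, [/\ a != -1, a != 0, a * 2 != 1, a != 1 & a != 2] &
  exists p q r : pt K, det3 p q r != 0 /\
  exists (c d : K) (e : pt K), [/\ c != 0, d != 0 &
  forall x y z, F3 (cmb p q r x y z) = c * normal_cubic a x y z /\
    F4 (cmb p q r x y z) = d * normal_quartic a x y z + dot e (x, y, z) * normal_cubic a x y z].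
Proof.
move=> total.
have [l1 [l2 [l3 [l4 [lin [size_ls size_ps three cover]]]]]] := four_lines charK H total.
have [o o_perm o_model] := model_points charK H size_ls size_ps three lin cover.
have [p [q [r [pqr [k5 k50 e5] [k2 k20 e2] [k0 k00 e0] [e3 e4]]]]] :=
  P_frame H size_ps three o_perm o_model.
pose at_o := at_pt o p q r.
have at0 : at_o 0 (0, 0, 1) by exists k0 => //; rewrite e0; congr scal; apply: pt_ext => /=; ring.
have at2 : at_o 2 (0, 1, 0) by exists k2 => //; rewrite e2; congr scal; apply: pt_ext => /=; ring.
have at5 : at_o 5 (1, 0, 0) by exists k5 => //; rewrite e5; congr scal; apply: pt_ext => /=; ring.
have at3 : at_o 3 (1, -1, 0) by [].
have at4 : at_o 4 (1, 0, -1) by [].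
have at_1 := at1 H size_ps o_perm o_model pqr at0 at2 at3 at4.
have [a [[am1 a0 ah a1 a2] [at6 at7 at8 at9 [at10 at11]]]] :=
  surface_parameter H size_ps three o_perm o_model pqr at0 at2 at5 at3 at4.
exists a; first by split.
exists p, q, r; split=> //.
have nn (x y z : K) : [|| x != 0, y != 0 | z != 0] -> (x, y, z) != null K.
  by apply: contraTneq => -[-> -> ->]; rewrite eqxx.
have line i j k u v m := at_line H size_ps o_perm o_model pqr (i := i) (j := j) (k := k)
  (u := u) (v := v) (m := m).
have a2' : a - 2 != 0 by rewrite subr_eq0.
have a1' : a - 1 != 0 by rewrite subr_eq0.
have am1' : a + 1 != 0 by rewrite addr_eq0.
have [L012 [in012 [p0 p1 p2]] [c012 n012 d012]] :
  line_at ls o p q r 0 1 2 (1, 0, 0).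
  apply: (line 0%N 1%N 2%N _ _ (1, 0, 0) isT at0 at_1);
    [by rewrite nn // oner_eq0 | by rewrite /dot /=; ring | by rewrite /dot /=; ring].
have [L045 [in045 [q0 q4 q5]] [c045 n045 d045]] :
  line_at ls o p q r 0 4 5 (0, 1, 0).
  apply: (line 0%N 4%N 5%N _ _ (0, 1, 0) isT at0 at4);
    [by rewrite nn // oner_eq0 orbT | by rewrite /dot /=; ring | by rewrite /dot /=; ring].
have [L268 [in268 [r2 r6 r8]] [c268 n268 d268]] :
  line_at ls o p q r 2 6 8 (a, 0, 1).
  apply: (line 2%N 6%N 8%N _ _ (a, 0, 1) isT at2 at6);
    [by rewrite nn // a0 | by rewrite /dot /=; ring | by rewrite /dot /=; ring].
have [L58A [in58A [s5 s8 sA]] [c58A n58A d58A]] :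
  line_at ls o p q r 5 8 10 (0, a, 2 * a - 1).
  apply: (line 5%N 8%N 10%N _ _ (0, a, 2 * a - 1) isT at5 at8);
    [by rewrite nn // a0 orbT | by rewrite /dot /=; ring | by rewrite /dot /=; ring].
have [L46B [in46B [t4 t6 tB]] [c46B n46B d46B]] :
  line_at ls o p q r 4 6 11 (a - 2, a - 1, a - 2).
  apply: (line 4%N 6%N 11%N _ _ (a - 2, a - 1, a - 2) isT at4 at6);
    [by rewrite nn // a2' | by rewrite /dot /=; ring | by rewrite /dot /=; ring].
have [L1AB [in1AB [u1 uA uB]] [c1AB n1AB d1AB]] :
  line_at ls o p q r 1 10 11 (a - 1, a, a).
  apply: (line 1%N 10%N 11%N _ _ (a - 1, a, a) isT at_1 at10);
    [by rewrite nn // a1' | by rewrite /dot /=; ring | by rewrite /dot /=; ring].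
have Psub s : all (ltn^~ 12) s -> {subset map (nth (null K) o) s <= ps}.
  exact: (P_sub size_ps o_perm).
have Puniq s : all (ltn^~ 12) s -> uniq s -> uniq (map (nth (null K) o) s).
  exact: (P_uniq H size_ps o_perm).
have dis1 : F3 (cross L045 L1AB) != 0.
  apply: (disjoint_lines H three in045 in1AB (Psub [:: 0; 4; 5; 1; 11; 10] isT)
    (Puniq [:: 0; 4; 5; 1; 11; 10] isT isT)); by split.
have dis2 : F3 (cross L045 L268) != 0.
  apply: (disjoint_lines H three in045 in268 (Psub [:: 0; 4; 5; 2; 6; 8] isT)
    (Puniq [:: 0; 4; 5; 2; 6; 8] isT isT)); by split.
have dis3 : F3 (cross L1AB L268) != 0.
  apply: (disjoint_lines H three in1AB in268 (Psub [:: 1; 10; 11; 2; 6; 8] isT)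
    (Puniq [:: 1; 10; 11; 2; 6; 8] isT isT)); by split.
have base i u : (i < 12)%N -> at_o i u ->
    F3 (in_frame p q r u) = 0 /\ F4 (in_frame p q r u) = 0.
  move=> i12 [k kn e]; have [_ f3 f4] := ps_base H (Pin size_ps o_perm i12).
  have e' : in_frame p q r u = scal k^-1 (nth (null K) o i).
    by rewrite e; apply: pt_ext; rewrite /= mulKf.
  by rewrite e' (form_scal _ _ (cubic_form H)) (form_scal _ _ (quartic_form H)) f3 f4 !mulr0.
have [k kn [n F3E]] := grid_cubic charK H (l1 := L012) (l2 := L46B) (l3 := L58A)
  (m1 := L045) (m2 := L1AB) (a1 := nth (null K) o 0) (a2 := nth (null K) o 4)
  (a3 := nth (null K) o 5) (b1 := nth (null K) o 1) (b2 := nth (null K) o 11)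
  (b3 := nth (null K) o 10) ltac:(by move=> x; rewrite !inE => /or4P[/eqP->|/eqP->|/eqP->|/orP[]/eqP->])
  dis1 (Psub [:: 0; 4; 5; 1; 11; 10] isT) (Puniq [:: 0; 4; 5] isT isT)
  (Puniq [:: 1; 11; 10] isT isT) (And3 q0 q4 q5) (And3 u1 uB uA) (And3 p0 t4 s5) (And3 p1 tB sA).
have [m [w F4E]] := residual_line charK H (ls_lift H in045) (ls_lift H in1AB) (ls_lift H in268)
  dis1 dis2 dis3.
pose A := k * (c012 * c46B * c58A); pose B := c045 * c1AB.
have A0 : A != 0 by rewrite !mulf_neq0.
have B0 : B != 0 by rewrite mulf_neq0.
have two : 2 != 0 :> K by have := charK 2; rewrite !inE /= => ->.
case nE : (dot n p, dot n q, dot n r) => [[n1 n2] n3].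
case wE : (dot w p, dot w q, dot w r) => [[w1 w2] w3].
case mE : (dot m p, dot m q, dot m r) => [[m1 m2] m3].
have F3X x y z : F3 (in_frame p q r (x, y, z)) =
    A * (x * (a * y + (2 * a - 1) * z) * ((a - 2) * x + (a - 1) * y + (a - 2) * z)) +
    B * (y * ((a - 1) * x + a * y + a * z) * (n1 * x + n2 * y + n3 * z)).
  by rewrite F3E d012 d46B d58A d045 d1AB dot_frame nE /A /B /dot /=; ring.
have F4X x y z : F4 (in_frame p q r (x, y, z)) =
    (m1 * x + m2 * y + m3 * z) * F3 (in_frame p q r (x, y, z)) +
    B * c268 * (y * ((a - 1) * x + a * y + a * z) * (a * x + z) * (w1 * x + w2 * y + w3 * z)).
  by rewrite F4E d045 d1AB d268 !dot_frame mE wE /B /dot /=; ring.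
(* The base points 2 and 6 lie on the unknown line n, and 3 fixes the ratio of the two triangles. *)
have n20 : n2 = 0.
  have [h _] := base 2 _ isT at2; rewrite F3X in h.
  apply: (mulfI (mulf_neq0 B0 a0)); rewrite mulr0 -[RHS]h; ring.
have n13 : n1 = a * n3.
  have [h _] := base 6 _ isT at6; rewrite F3X in h.
  apply/eqP; rewrite -subr_eq0; apply/eqP/(mulfI (mulf_neq0 B0 (mulf_neq0 a2' am1'))).
  by rewrite mulr0 -[RHS]oppr0 -[in RHS]h n20; ring.
have BA : B * n3 = - A.
  have [h _] := base 3 _ isT at3; rewrite F3X in h.
  apply/eqP; rewrite -addr_eq0; apply/eqP/(mulfI a0).
  by rewrite mulr0 -[RHS]h n20 n13; ring.
have F3N x y z : F3 (in_frame p q r (x, y, z)) = A / 2 * normal_cubic a x y z.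
  rewrite F3X normal_cubicE [in RHS]mulrA divfK // n13 n20.
  transitivity (A * (x * (a * y + (2 * a - 1) * z) * ((a - 2) * x + (a - 1) * y + (a - 2) * z)) +
    B * n3 * (y * ((a - 1) * x + a * y + a * z) * (a * x + z))); first by ring.
  by rewrite BA; ring.
have Bc0 : B * c268 != 0 by rewrite mulf_neq0.
(* The unknown line w passes through 3 and 7, which are off the three other lines. *)
have w12 : w2 = w1.
  have [h3 h4] := base 3 _ isT at3; rewrite F4X h3 mulr0 add0r in h4.
  apply/eqP; rewrite -subr_eq0; apply/eqP/(mulfI (mulf_neq0 Bc0 a0)).
  by rewrite mulr0 -[RHS]oppr0 -[in RHS]h4; ring.
have w13 : w3 = (1 - a) * w1.
  have [h3 h4] := base 7 _ isT at7; rewrite F4X h3 mulr0 add0r in h4.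
  apply/eqP; rewrite -subr_eq0.
  have nz : (a - 2) * (a - 1) * (a + 1) * (a + 1) != 0 by rewrite !mulf_neq0.
  apply/eqP/(mulfI (mulf_neq0 Bc0 nz)).
  by rewrite mulr0 -[RHS]h4 w12; ring.
have w10 : w1 != 0.
  apply/eqP => w10; apply: (@not_multiple _ charK _ _ _ _ H m) => X.
  have [[[x y] z] ->] := in_frame_onto pqr X.
  by rewrite F4X w13 w12 w10 dot_frame mE [dot _ _]/dot /=; ring.
(* The factor a - 1 comes from [normal_quarticE]; the multiple of the cubic in that identity joins m
   in the linear form e. *)
pose d := B * c268 * w1 * (a - 1).
exists (A / 2), d, (m1 * (A / 2) + d / 2, m2 * (A / 2) - d * ((2 - a) / (2 * (a - 1))),
  m3 * (A / 2) + d).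
split; [by rewrite mulf_neq0 ?invr_eq0 | by rewrite !mulf_neq0 |].
move=> x y z; rewrite -[cmb _ _ _ _ _ _]/(in_frame p q r (x, y, z)) F4X F3N; split=> //.
rewrite w13 w12.
transitivity ((m1 * x + m2 * y + m3 * z) * (A / 2 * normal_cubic a x y z) + B * c268 * w1 *
  (y * ((a - 1) * x + a * y + a * z) * (a * x + z) * (x + y + (1 - a) * z))); first by ring.
rewrite (normal_quarticE _ _ _ a1) /dot /= /d; field.
by rewrite two subr_eq0 a1.
Qed.

End Normal.

(** * Polynomials along a line *)

Section Along.
Variables (K : fieldType) (n : nat).
Hypothesis charK : [pchar K] =i pred0.
Implicit Types (P v : 'I_n -> K) (G : {mpoly K[n]}).

(** The restriction to the line P + s v; partial derivatives are read off its derivatives at 0. *)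
Definition along P v G : {poly K} := mmap (@polyC K) (fun i => (P i)%:P + v i *: 'X) G.

Lemma alongE P v G s : (along P v G).[s] = G.@[fun i => P i + s * v i].
Proof.
rewrite mevalE /along /mmap horner_sum; apply: eq_bigr => m _.
rewrite hornerM hornerC /mmap1 horner_prod; congr (_ * _); apply: eq_bigr => i _.
by rewrite horner_exp hornerD hornerC hornerZ hornerX mulrC.
Qed.

Lemma along0 P v G : (along P v G).[0] = G.@[P].
Proof. by rewrite alongE; apply: meval_eq => i; rewrite mul0r addr0. Qed.

Lemma alongD P v G H : along P v (G + H) = along P v G + along P v H.
Proof. exact: raddfD. Qed.

Lemma alongM P v G H : along P v (G * H) = along P v G * along P v H.
Proof. exact: rmorphM. Qed.

Lemma alongZ P v c G : along P v (c *: G) = c *: along P v G.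
Proof. by rewrite /along mmapZ mul_polyC. Qed.

Lemma alongX P v i : along P v 'X_i = (P i)%:P + v i *: 'X.
Proof. by rewrite /along mmapX mmap1U. Qed.

(** The chain rule: both sides are additive and obey the Leibniz rule, so constants and variables
    suffice. *)
Lemma along_deriv P v G : (along P v G)^`() = \sum_i v i *: along P v G^`M(i).
Proof.
pose D G := (along P v G)^`() = \sum_i v i *: along P v G^`M(i).
have DM G1 G2 : D G1 -> D G2 -> D (G1 * G2).
  move=> h1 h2; rewrite /D alongM derivM h1 h2 mulr_suml mulr_sumr -big_split.
  by apply: eq_bigr => i _ /=; rewrite mderivM alongD !alongM scalerDr scalerAl scalerAr.
have DC c : D c%:MP.
  by rewrite /D /along mmapC derivC big1 // => i _; rewrite mderivC mmap0 scaler0.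
have DX i : D 'X_i.
  rewrite /D alongX derivD derivC add0r derivZ derivX (bigD1 i) //= big1 => [|j ji].
    rewrite addr0 mderivX mnm1E eqxx alongZ (_ : (U_(i) - U_(i))%MM = 0%MM) ?mpolyX0; last by apply/mnmP => k; rewrite mnmBE subnn mnm0E.
    by rewrite -mpolyC1 /along mmapC scale1r.
  by rewrite mderivX mnm1E eq_sym (negPf ji) scale0r /along mmap0 scaler0.
elim/mpolyind: G => [|c m G _ _ IH]; first by rewrite -mpolyC0; exact: DC.
have DA G1 G2 : D G1 -> D G2 -> D (G1 + G2).
  move=> h1 h2; rewrite /D alongD derivD h1 h2 -big_split.
  by apply: eq_bigr => i _ /=; rewrite mderivD alongD scalerDr.
apply: (DA) => //; rewrite -mul_mpolyC mpolyXE_id; apply: (DM) => //.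
apply: (big_ind D) => // [|i _]; first by rewrite -mpolyC1; exact: DC.
by elim: (m i) => [|k IHk]; rewrite ?expr0 -?mpolyC1 // exprS; apply: (DM).
Qed.

Lemma along_deriv0 P v G : (along P v G)^`().[0] = \sum_i v i * (G^`M(i)).@[P].
Proof.
rewrite along_deriv horner_sum; apply: eq_bigr => i _.
by rewrite hornerZ along0.
Qed.

Lemma mderiv_along P G i : (G^`M(i)).@[P] = (along P (fun j => (j == i)%:R) G)^`().[0].
Proof.
rewrite along_deriv0 (bigD1 i) //= big1 => [|j /negPf ->]; last by rewrite mul0r.
by rewrite eqxx mul1r addr0.
Qed.

Lemma meval_at0 G : G.@[fun=> 0] = G@_0.
Proof.
elim/mpolyind: G => [|c m G _ _ IH]; first by rewrite meval0 mcoeff0.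
rewrite mevalD mevalZ mevalX mcoeffD mcoeffZ mcoeffX IH; congr (_ * _ + _).
have [->|] := eqVneq m 0%MM; first by rewrite big1 // => i _; rewrite mnm0E expr0.
rewrite -mdeg_eq0 mdegE sum_nat_eq0 => /forallPn[i]; rewrite implyTb => mi.
by rewrite (bigD1 i) //= expr0n (negPf mi) mul0r.
Qed.

(** The derivatives of a function that vanishes everywhere vanish too. At the origin the one of
    index m is the coefficient of m times a product of factorials, invertible in characteristic
    zero. *)
Lemma mpoly_eval_inj G H : (forall P, G.@[P] = H.@[P]) -> G = H.
Proof.
move=> GH; apply/eqP; rewrite -subr_eq0; set D := G - H.
have {GH} : forall P, D.@[P] = 0 by move=> P; rewrite mevalB GH subrr.
move: D => {G H} G G0.
have der (E : {mpoly K[n]}) i : (forall P, E.@[P] = 0) -> forall P, (E^`M(i)).@[P] = 0.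
  move=> E0 P; rewrite mderiv_along (_ : along _ _ _ = 0) ?deriv0 ?horner0 //.
  by apply: (poly_dense charK (xs := [::])) => s _; rewrite alongE.
have derm m : forall P, (G^`M[m]).@[P] = 0.
  rewrite mderivm_foldr; elim: (flatten _) => [|i s IH] //=; exact: der.
apply/eqP/mpolyP => m; rewrite mcoeff0.
have : (G^`M[m])@_0 = 0 by rewrite -(derm m (fun=> 0)) meval_at0.
rewrite mcoeff_mderivm addm0 => /eqP; rewrite -mulr_natr mulf_eq0 => /orP[/eqP //|].
rewrite ((pcharf0P K).1 charK) eqn0Ngt prodn_gt0 // => i.
by rewrite ffactnn fact_gt0.
Qed.

End Along.

(** * Projection from the triple point *)

Section Frame.
Variable K : fieldType.
Local Notation pt := (pt K).

(** Coordinates adapted to the triple point: X is the projection from [O], t the coordinate along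
    [O], and [M] chooses a complement of [O]. *)
Definition emb (M : 'I_4 -> pt) (O : 'rV[K]_4) (X : pt) (t : K) : 'rV[K]_4 :=
  \row_i (dot (M i) X + t * O 0 i).

Definition frame_at M (O : 'rV[K]_4) :=
  (forall P, exists X t, P = emb M O X t) /\
  (forall X t, emb M O X t = 0 -> X = null K /\ t = 0).

(** [O] is completed to a basis: as a matrix of rank 1 it is proportional to the first row of its
    [row_ebase]. *)
Lemma frame_exists (O : 'rV[K]_4) : O != 0 -> exists M, frame_at M O.
Proof.
move=> O0.
have [B Bu [a a0 eO]] : exists2 B : 'M[K]_4, B \in unitmx & exists2 a, a != 0 & O = a *: row 0 B.
  exists (row_ebase O); first exact: row_ebase_unit.
  have e : O = (col_ebase O) 0 0 *: row 0 (row_ebase O).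
    rewrite -{1}(mulmx_ebase O) rank_rV O0 [col_ebase O]mx11_scalar mul_scalar_mx -scalemxAl.
    rewrite mxE eqxx mulr1n; congr (_ *: _); apply/rowP => j; rewrite !mxE.
    rewrite (bigD1 ord0) //= big1 => [|k /negPf k0]; first by rewrite !mxE eqxx mul1r addr0.
    have k0' : ((0 : 'I_1) == k :> nat) = false by rewrite eq_sym; exact: k0.
    by rewrite !mxE k0' mul0r.
  by exists ((col_ebase O) 0 0) => //; apply: contraNneq O0 => z; rewrite e z scale0r.
exists (fun i => (B 1 i, B (inord 2) i, B (inord 3) i)).
have key X t : emb (fun i => (B 1 i, B (inord 2) i, B (inord 3) i)) O X t =
    (\row_(i < 4) [:: t * a; X.1.1; X.1.2; X.2]`_i) *m B.
  apply/rowP => j; rewrite eO !mxE !big_ord_recl big_ord0 !mxE /dot /=.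
  have -> : lift ord0 ord0 = 1 :> 'I_4 by apply/val_inj.
  have -> : lift ord0 (lift ord0 ord0) = inord 2 :> 'I_4 by apply/val_inj; rewrite /= inordK.
  have -> : lift ord0 (lift ord0 (lift ord0 ord0)) = inord 3 :> 'I_4 by apply/val_inj; rewrite /= inordK.
  rewrite -[0 : 'I_4]/ord0; ring.
split=> [P|X t].
  pose v := P *m invmx B; exists (v 0 1, v 0 (inord 2), v 0 (inord 3)), (v 0 0 / a).
  rewrite key divfK // -[LHS](mulmxKV Bu) -/v; congr (_ *m _); apply/rowP => j; rewrite [RHS]mxE.
  by case: j => -[|[|[|[|]]]] //= h; congr (v 0 _); apply: val_inj; rewrite /= ?inordK.
rewrite key => /(canRL (mulmxK Bu)); rewrite mul0mx => e.
have ej j : [:: t * a; X.1.1; X.1.2; X.2]`_j = 0 \/ (3 < j)%N.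
  case: ltnP => h; [by right | left].
  by have /rowP/(_ (Ordinal (h : (j < 4)%N))) := e; rewrite !mxE.
have [|//] := ej 0; have [|//] := ej 1; have [|//] := ej 2; have [|//] := ej 3.
rewrite /= => e3 e2 e1 /eqP; rewrite mulf_eq0 (negPf a0) orbF => /eqP ->.
by split=> //; apply: pt_ext.
Qed.

(** Forms in (X, t), in Horner form with respect to t, so that the coefficient of each power of t is
    a plane form. *)
Fixpoint tform d (g : pt -> K -> K) : Prop :=
  match d with
  | 0 => exists c, forall X t, g X t = c
  | d'.+1 => exists g1 f, [/\ tform d' g1, form d f & forall X t, g X t = t * g1 X t + f X]
  end.

Lemma eq_tform d g h : (forall X t, g X t = h X t) -> tform d g -> tform d h.
Proof.
case: d => [|d] e /=; first by case=> c gc; exists c => X t; rewrite -e.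
by case=> g1 [f [h1 h2 h3]]; exists g1, f; split=> // X t; rewrite -e.
Qed.

Lemma tform_zero d : tform d (fun _ _ => 0).
Proof.
elim: d => [|d IH] /=; first by exists 0.
exists (fun _ _ => 0), (fun _ => 0); split=> //; first exact: (form_zero _ d.+1).
by move=> X t; ring.
Qed.

Lemma tform_add d g h : tform d g -> tform d h -> tform d (fun X t => g X t + h X t).
Proof.
elim: d g h => [|d IH] g h /=.
  by move=> [b gb] [c hc]; exists (b + c) => X t; rewrite gb hc.
move=> [g1 [f [h1 h2 h3]]] [g1' [f' [h1' h2' h3']]].
exists (fun X t => g1 X t + g1' X t), (fun X => f X + f' X); split.
- exact: IH.
- exact: (form_add (d := d.+1) h2 h2').
- by move=> X t; rewrite h3 h3'; ring.
Qed.

Lemma tform_scale d k g : tform d g -> tform d (fun X t => k * g X t).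
Proof.
elim: d g => [|d IH] g /=; first by move=> [b gb]; exists (k * b) => X t; rewrite gb.
move=> [g1 [f [h1 h2 h3]]]; exists (fun X t => k * g1 X t), (fun X => k * f X); split.
- exact: IH.
- exact: (form_scale (d := d.+1) k h2).
- by move=> X t; rewrite h3; ring.
Qed.

Lemma tform_dot d l g : tform d g -> tform d.+1 (fun X t => dot l X * g X t).
Proof.
elim: d g => [|d IH] g.
  case=> c gc; exists (fun _ _ => 0), (fun X => dot l X * c); split; first by exists 0.
    by apply: (form_dot l (d := 0)); exists c.
  by move=> X t; rewrite gc mulr0 add0r.
case=> g1 [f [h1 h2 h3]]; exists (fun X t => dot l X * g1 X t), (fun X => dot l X * f X); split.
- exact: IH.
- exact: form_dot.
- by move=> X t; rewrite h3; ring.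
Qed.

Lemma tform_lin d l k g : tform d g -> tform d.+1 (fun X t => (dot l X + t * k) * g X t).
Proof.
move=> gd; apply: (eq_tform (g := fun X t => t * (k * g X t) + dot l X * g X t)).
  by move=> X t; ring.
apply: tform_add; last exact: tform_dot.
exists (fun X t => k * g X t), (fun _ => 0); split.
- exact: tform_scale.
- exact: (form_zero _ d.+1).
- by move=> X t; rewrite addr0.
Qed.

Lemma tform_homog M O d (G : {mpoly K[4]}) : G \is d.-homog ->
  tform d (fun X t => eval_at G (emb M O X t)).
Proof.
move=> /dhomogP hG.
have mono (m : 'X_{1..4}) : tform (mdeg m) (fun X t => \prod_i (emb M O X t) 0 i ^+ m i).
  rewrite mdegE.
  suff : forall s : seq 'I_4, tform (\sum_(i <- s) m i)
      (fun X t => \prod_(i <- s) (emb M O X t) 0 i ^+ m i) by apply.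
  elim=> [|i s IH].
    by rewrite big_nil; exists 1 => X t; rewrite big_nil.
  rewrite big_cons; apply: (eq_tform (g := fun X t => (dot (M i) X + t * O 0 i) ^+ m i *
      \prod_(i <- s) (emb M O X t) 0 i ^+ m i)).
    by move=> X t; rewrite big_cons mxE.
  elim: (m i) => [|k IHk]; first by apply: eq_tform IH => X t; rewrite expr0 mul1r.
  by apply: eq_tform (tform_lin (M i) (O 0 i) IHk) => X t; rewrite exprS mulrA.
apply: (eq_tform (g := fun X t => \sum_(m <- msupp G) G@_m * \prod_i (emb M O X t) 0 i ^+ m i)).
  by move=> X t; rewrite /eval_at mevalE.
have : {subset msupp G <= msupp G} by [].
elim: {1 3}(msupp G) => [|m s IH] sub.
  by apply: eq_tform (tform_zero d) => X t; rewrite big_nil.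
have dm : mdeg m = d by apply: hG; apply: sub; rewrite mem_head.
apply: (eq_tform (g := fun X t => G@_m * \prod_i (emb M O X t) 0 i ^+ m i +
  \sum_(m <- s) G@_m * \prod_i (emb M O X t) 0 i ^+ m i)).
  by move=> X t; rewrite big_cons.
apply: tform_add; first by apply: tform_scale; rewrite -dm.
by apply: IH => x xs; apply: sub; rewrite inE xs orbT.
Qed.

End Frame.

(** * The equation t F3 + F4 *)

Section Equation.
Variable K : fieldType.
Hypothesis charK : [pchar K] =i pred0.
Local Notation pt := (pt K).
Variables (F : {mpoly K[4]}) (O : 'rV[K]_4) (M : 'I_4 -> pt).
Hypothesis Fhom : F \is 4.-homog.
Hypothesis MO : frame_at M O.
Hypothesis triple : multiplicity_at F O 3.
Local Notation E := (emb M O).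

Lemma emb_add X t Y u : E X t + E Y u = E (cmb X Y (null K) 1 1 0) (t + u).
Proof. by apply/rowP => i; rewrite !mxE dot_cmb; ring. Qed.

Lemma emb_scale k X t : k *: E X t = E (scal k X) (k * t).
Proof. by apply/rowP => i; rewrite !mxE dot_scal; ring. Qed.

Lemma emb_apex k : k *: O = E (null K) k.
Proof. by apply/rowP => i; rewrite !mxE /dot /=; ring. Qed.

Lemma emb_inj X t Y u : E X t = E Y u -> X = Y /\ t = u.
Proof.
move=> e; have [|/eqP h /eqP] := MO.2 (cmb X Y (null K) 1 (-1) 0) (t - u).
  have -> : E (cmb X Y (null K) 1 (-1) 0) (t - u) = E X t - E Y u.
    by apply/rowP => i; rewrite !mxE dot_cmb; ring.
  by rewrite e subrr.
rewrite subr_eq0 => /eqP ->; split=> //; move: h; rewrite !xpair_eqE /=.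
rewrite !(mul1r, mulN1r, mul0r, addr0) !subr_eq0 => /andP[/andP[/eqP e1 /eqP e2] /eqP e3].
exact: pt_ext.
Qed.

Lemma apex_eval0 : eval_at F O = 0.
Proof. by have := triple.1 0%MM; rewrite mderivm0m mdeg0 => ->. Qed.

Lemma apex_deriv0 i : eval_at F^`M(i) O = 0.
Proof. by have := triple.1 U_(i)%MM; rewrite mderivmU1m mdeg1 => ->. Qed.

Lemma apex_deriv20 i j : eval_at F^`M(i)^`M(j) O = 0.
Proof.
have := triple.1 (U_(i) + U_(j))%MM.
by rewrite mderivmDm !mderivmU1m mdegD !mdeg1 => ->.
Qed.

(** In the coordinates (X, t): G does not involve t. *)
Let inv (G : {mpoly K[4]}) := forall P t, eval_at G (P + t *: O) = eval_at G P.

Lemma inv_mderiv G i : inv G -> inv G^`M(i).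
Proof.
move=> Gi P t; rewrite /eval_at !mderiv_along; congr (_^`().[0]).
apply/eqP; rewrite -subr_eq0; apply/eqP/(poly_dense charK (xs := [::])) => s _.
rewrite hornerD hornerN !alongE; apply/eqP; rewrite subr_eq0; apply/eqP.
have := Gi (P + s *: \row_j (j == i)%:R) t; rewrite /eval_at.
rewrite (meval_eq (v2 := fun j => (P + t *: O) 0 j + s * (j == i)%:R)); last first.
  by move=> j; rewrite !mxE; ring.
by move=> ->; apply: meval_eq => j; rewrite !mxE.
Qed.

(** Invariance passes to all derivatives, so a third derivative takes at [O] its value at the
    origin. That value is a multiple of a coefficient of degree 3 of a quartic form, hence zero,
    against the multiplicity 3. *)
Lemma not_inv : ~ inv F.
Proof.
move=> Fi; have [m [m3]] := triple.2.
have : inv F^`M[m].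
  by rewrite mderivm_foldr; elim: (flatten _) => [|i s IH] //=; exact: inv_mderiv.
move=> /(_ 0 1); rewrite add0r scale1r => -> /eqP; apply.
rewrite /eval_at (meval_eq (v2 := fun=> 0)); last by move=> i; rewrite mxE.
rewrite meval_at0 mcoeff_mderivm addm0 (dhomog_nemf_coeff Fhom) ?mul0rn //.
by rewrite /= m3.
Qed.

(** Along [O] + s X the equation is c + f1 s + f2 s^2 + f3 s^3 + f4 s^4, and the vanishing of the
    derivatives of order at most 2 at [O] kills c, f1, f2. If f3 were zero, F would not involve
    t. *)
Lemma monoid_equation : exists F3 F4 : pt -> K, [/\ form 3 F3, form 4 F4,
  exists X, F3 X != 0 & forall X t, eval_at F (E X t) = t * F3 X + F4 X].
Proof.
have [g3 [f4 [[g2 [f3 [[g1 [f2 [[g0 [f1 [[c cE] form1 g1E]]] form2 g2E]]] form3 g3E]]] form4 FE]]] :=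
  tform_homog M O Fhom.
have main X : [/\ c = 0, f1 X = 0 & f2 X = 0].
  pose v i := dot (M i) X; pose r := along (fun i => O 0 i) v F.
  have rE : r = Poly [:: c; f1 X; f2 X; f3 X; f4 X].
    apply/eqP; rewrite -subr_eq0; apply/eqP/(poly_dense charK (xs := [::])) => s _.
    rewrite hornerD hornerN horner_Poly /= /r alongE.
    rewrite (meval_eq (v2 := fun i => (E (scal s X) 1) 0 i)); last first.
      by move=> i; rewrite mxE dot_scal mul1r addrC.
    rewrite -[_.@[_]]/(eval_at F (E (scal s X) 1)) FE g3E g2E g1E cE.
    rewrite (form_scal _ _ (form4 : form 4 f4)) (form_scal _ _ (form3 : form 3 f3)).
    by rewrite (form_scal _ _ (form2 : form 2 f2)) (form_scal _ _ (form1 : form 1 f1)); ring.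
  have r0 : r.[0] = 0 by rewrite along0; exact: apex_eval0.
  have r1 : r^`().[0] = 0.
    by rewrite along_deriv0 // big1 // => i _; rewrite [X in _ * X]apex_deriv0 mulr0.
  have r2 : r^`()^`().[0] = 0.
    rewrite along_deriv // raddf_sum horner_sum big1 // => i _ /=.
    rewrite derivZ hornerZ along_deriv0 // big1 ?mulr0 // => j _.
    by rewrite [X in _ * X]apex_deriv20 mulr0.
  move: r0 r1 r2; rewrite !horner_coef0 !coef_deriv rE !coef_Poly /= !mulr1n => -> -> /eqP.
  by rewrite -mulr_natr mulf_eq0 ((pcharf0P K).1 charK) orbF => /eqP.
have c0 : c = 0 by have [] := main (null K).
have FE' X t : eval_at F (E X t) = t * f3 X + f4 X.
  by have [_ h1 h2] := main X; rewrite FE g3E g2E g1E cE c0 h1 h2; ring.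
exists f3, f4; split=> //.
apply: NNPP => no; apply: not_inv => P t; have [X [u ->]] := MO.1 P.
have f30 : f3 X = 0 by apply/eqP; apply: contraT => h; case: no; exists X.
rewrite emb_apex emb_add !FE' (_ : cmb _ _ _ _ _ _ = X); last first.
  by apply: pt_ext => /=; ring.
by rewrite f30; ring.
Qed.

End Equation.

Lemma seq_choice (T : eqType) (U : Type) (R : T -> U -> Prop) (u0 : U) (s : seq T) :
  (forall x, x \in s -> exists y, R x y) -> exists f, forall x, x \in s -> R x (f x).
Proof.
elim: s => [|x s IH] h; first by exists (fun=> u0).
have [y Rxy] := h x (mem_head x s).
have [|f fR] := IH; first by move=> z zs; apply: h; rewrite inE zs orbT.
exists (fun z => if z == x then y else f z) => z; rewrite inE.
by case: eqP => [-> //|_ /= zs]; exact: fR.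
Qed.

(** * Lines of the surface as vector planes *)

Section Planes.
Variables (K : fieldType) (V : vectType K).
Implicit Types (l : {vspace V}) (b P : V).

Definition indep2 b1 b2 := forall k1 k2 : K, k1 *: b1 + k2 *: b2 = 0 -> k1 = 0 /\ k2 = 0.

Lemma mem_plane b1 b2 P :
  P \in (<[b1]> + <[b2]>)%VS <-> exists k1 k2, P = k1 *: b1 + k2 *: b2.
Proof.
split=> [/memv_addP[u /vlineP[k1 ->] [v /vlineP[k2 ->] ->]]|[k1 [k2 ->]]]; first by exists k1, k2.
by apply: memv_add; apply: memvZ; exact: memv_line.
Qed.

Lemma plane_basis l : \dim l = 2%N ->
  exists b1 b2, l = (<[b1]> + <[b2]>)%VS /\ indep2 b1 b2.
Proof.
move=> d2; have := vbasisP l; have := size_tuple (vbasis l); rewrite {2}d2.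
case: (tval (vbasis l)) => [|b1 [|b2 [|]]] // _ /andP[/eqP spanE].
rewrite free_cons span_seq1 seq1_free => /andP[b12 b20]; exists b1, b2; split.
  by rewrite -spanE span_cons span_seq1.
move=> k1 k2 e; have k10 : k1 = 0.
  apply/eqP; apply: contraNT b12 => k10; apply/vlineP; exists (- (k2 / k1)).
  apply: (scalerI k10); rewrite scalerA mulrN mulrC divfK // scaleNr.
  by apply/eqP; rewrite -addr_eq0 e.
move: e; rewrite k10 scale0r add0r => /eqP; rewrite scaler_eq0 (negPf b20) orbF => /eqP.
by [].
Qed.

Lemma plane_dim b1 b2 : indep2 b1 b2 -> \dim (<[b1]> + <[b2]>) = 2%N.
Proof.
move=> h; have : free [:: b1; b2].
  rewrite free_cons span_seq1 seq1_free; apply/andP; split.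
    apply/negP => /vlineP[k e]; have [|/eqP] := h 1 (- k).
      by rewrite e scale1r scaleNr subrr.
    by rewrite oner_eq0.
  apply/eqP => b20; have [|_ /eqP] := h 0 1; first by rewrite b20 scaler0 scale0r addr0.
  by rewrite oner_eq0.
by rewrite /free span_cons span_seq1 => /eqP.
Qed.

End Planes.

Section Lines.
Variable K : fieldType.
Hypothesis charK : [pchar K] =i pred0.
Local Notation pt := (pt K).
Variables (F : {mpoly K[4]}) (O : 'rV[K]_4) (M : 'I_4 -> pt).
Hypothesis MO : frame_at M O.
Local Notation E := (emb M O).
Variables F3 F4 : pt -> K.
Hypotheses (form3 : form 3 F3) (form4 : form 4 F4).
Hypothesis FE : forall X t, eval_at F (E X t) = t * F3 X + F4 X.

(** If t F3 + F4 has order 2 at p, the point (p, t) is singular: the derivative of F in a direction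
    (Q, u) is that of t F3 + F4 along Q plus u F3 (p), and both vanish. The extension field is [K]
    itself. *)
Lemma base_transversal : no_singular_point_but F O ->
  forall p, base_pt F3 F4 p -> forall t, ~ order2 (fun P => t * F3 P + F4 P) p.
Proof.
move=> nosing p [p0 p3 p4] t ord.
have [|c] := nosing K idfun (E p t).
  rewrite (_ : map_mpoly _ F = F); last by apply/mpolyP => m; rewrite mcoeff_map_mpoly.
  split=> [||i].
  - by apply: contraNneq p0 => /(MO.2)[-> _].
  - by rewrite FE p3 p4; ring.
  - rewrite /eval_at mderiv_along.
    have [Q [u e]] := MO.1 (\row_j (j == i)%:R).
    have [r rE] := ord Q; have [r3 _ r3E] := form_poly p Q form3.
    have -> : along (fun j => (E p t) 0 j) (fun j => (j == i)%:R) F =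
        'X * ('X * r) + u *: ('X * r3).
      apply/eqP; rewrite -subr_eq0; apply/eqP/(poly_dense charK (xs := [::])) => s _.
      rewrite hornerD hornerN alongE !(hornerD, hornerM, hornerZ, hornerX) -r3E.
      have -> : F.@[fun j => (E p t) 0 j + s * (j == i)%:R] =
          eval_at F (E (seg p Q 1 s) (t + s * u)).
        rewrite /eval_at; apply: meval_eq => j.
        have -> : (j == i)%:R = (E Q u) 0 j by rewrite -e mxE.
        by rewrite !mxE dot_seg; ring.
      have h : t * F3 (seg p Q 1 s) + F4 (seg p Q 1 s) = s ^+ 2 * r.[s] by exact: rE.
      rewrite FE; transitivity (t * F3 (seg p Q 1 s) + F4 (seg p Q 1 s) + s * u * F3 (seg p Q 1 s) -
        (s * (s * r.[s]) + u * (s * F3 (seg p Q 1 s)))); first by ring.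
      by rewrite h; ring.
    rewrite !(derivD, derivZ, derivM, derivX) !hornerE -r3E.
    by rewrite /seg cmb_e1 p3; ring.
rewrite map_mx_id // (@emb_apex _ O M) => /(emb_inj MO)[e _].
by rewrite e eqxx in p0.
Qed.

(** The two kinds of lines of the surface: the join of [O] with a base point, and, in [graph_line],
    the graph of t = - [dot a] X over a lifting line. *)
Definition apex_line (l : {vspace 'rV[K]_4}) (p : pt) :=
  base_pt F3 F4 p /\ forall P, P \in l <-> exists k u, P = E (scal k p) u.

Definition graph_line (l : {vspace 'rV[K]_4}) (g : pt) := g != null K /\
  exists a, (forall X, dot g X = 0 -> F4 X = dot a X * F3 X) /\
  forall P, P \in l <-> exists X, dot g X = 0 /\ P = E X (- dot a X).

Lemma apex_line_apex l p : apex_line l p -> O \in l.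
Proof.
move=> [_ h]; apply/h; exists 0, 1; rewrite -[LHS]scale1r (@emb_apex _ O M).
by congr emb; apply: pt_ext => /=; ring.
Qed.

Lemma graph_line_apex l g : graph_line l g -> O \notin l.
Proof.
move=> [g0 [a [_ h]]]; apply/negP => /h[X [_]].
move=> e; have : E (null K) 1 = E X (- dot a X) by rewrite -(@emb_apex _ O M) scale1r.
move=> /(emb_inj MO)[<-] /eqP.
by rewrite /dot /= !mulr0 !addr0 oppr0 oner_eq0.
Qed.

Lemma dot_interp p q u v : cross p q != null K -> exists a, dot a p = u /\ dot a q = v.
Proof.
move=> /null_dot[r]; rewrite dot_cross => d.
by have [a [ap aq _]] := dual_basis u v 0 d; exists a.
Qed.

(** The projections X1, X2 of two spanning vectors are either dependent, and the line contains [O],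
    or independent, and t is a linear function of X on the line. *)
Lemma line_cases l : line_in F l -> (exists p, apex_line l p) \/ (exists g, graph_line l g).
Proof.
move=> [d2 Fl]; have [b1 [b2 [lE ind]]] := plane_basis d2.
have [X1 [t1 e1]] := MO.1 b1; have [X2 [t2 e2]] := MO.1 b2.
have mem P : P \in l <-> exists k1 k2, P = E (seg X1 X2 k1 k2) (k1 * t1 + k2 * t2).
  rewrite lE mem_plane; split=> -[k1 [k2 ->]]; exists k1, k2;
    by rewrite e1 e2 !emb_scale emb_add; congr emb; apply: pt_ext => /=; ring.
have ind' k1 k2 : seg X1 X2 k1 k2 = null K -> k1 * t1 + k2 * t2 = 0 -> k1 = 0 /\ k2 = 0.
  move=> h1 h2; apply: ind; rewrite e1 e2 !emb_scale emb_add -[RHS](scale0r O) (@emb_apex _ O M).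
  by congr emb; [rewrite -h1; apply: pt_ext => /=; ring | exact: h2].
have [X12|X12] := eqVneq (cross X1 X2) (null K).
  left.
  have base p : p != null K -> (forall P, P \in l <-> exists k u, P = E (scal k p) u) ->
      base_pt F3 F4 p.
    move=> p0 lp; have Fp u : u * F3 p + F4 p = 0.
      rewrite -FE; apply: Fl; apply/lp; exists 1, u.
      by congr emb; apply: pt_ext => /=; ring.
    have p4 : F4 p = 0 by have := Fp 0; rewrite mul0r add0r.
    by split=> //; have := Fp 1; rewrite p4 addr0 mul1r.
  have [X10|X10] := eqVneq X1 (null K).
    have t10 : t1 != 0.
      apply/eqP => t10; have [||/eqP] := ind' 1 0; rewrite ?X10 ?t10; last by rewrite oner_eq0.
        by apply: pt_ext => /=; ring.
      by ring.
    have X20 : X2 != null K.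
      apply/eqP => X20; have [||_ /eqP] := ind' (- t2 / t1) 1; rewrite ?X10 ?X20.
      - by apply: pt_ext => /=; ring.
      - by rewrite divfK // mul1r addNr.
      - by rewrite oner_eq0.
    have lX2 P : P \in l <-> exists k u, P = E (scal k X2) u.
      rewrite mem; split=> [[k1 [k2 ->]]|[k [u ->]]].
        by exists k2, (k1 * t1 + k2 * t2); congr emb; rewrite X10; apply: pt_ext => /=; ring.
      exists ((u - k * t2) / t1), k; congr emb; first by rewrite X10; apply: pt_ext => /=; ring.
      by rewrite divfK // subrK.
    by exists X2; split=> //; exact: base.
  have [k X2E] := cross_null X10 X12.
  have t0 : t2 - k * t1 != 0.
    apply/eqP => t0; have [||_ /eqP] := ind' (- k) 1.
    - by rewrite X2E; apply: pt_ext => /=; ring.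
    - by rewrite mulNr mul1r addrC.
    - by rewrite oner_eq0.
  have lX1 P : P \in l <-> exists k u, P = E (scal k X1) u.
    rewrite mem; split=> [[k1 [k2 ->]]|[h [u ->]]].
      exists (k1 + k2 * k), (k1 * t1 + k2 * t2); congr emb.
      by rewrite X2E; apply: pt_ext => /=; ring.
    exists (h - (u - h * t1) / (t2 - k * t1) * k), ((u - h * t1) / (t2 - k * t1)); congr emb.
      by rewrite X2E; apply: pt_ext => /=; ring.
    by field.
  by exists X1; split=> //; exact: base.
right; exists (cross X1 X2); split=> //.
have [a [a1 a2]] := dot_interp (- t1) (- t2) X12.
have at_seg k1 k2 : E (seg X1 X2 k1 k2) (- dot a (seg X1 X2 k1 k2)) =
    E (seg X1 X2 k1 k2) (k1 * t1 + k2 * t2).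
  by rewrite dot_seg a1 a2; congr emb; ring.
have lP P : P \in l <-> exists X, dot (cross X1 X2) X = 0 /\ P = E X (- dot a X).
  rewrite mem; split=> [[k1 [k2 ->]]|[X [gX ->]]].
    by exists (seg X1 X2 k1 k2); split; rewrite ?at_seg // dot_seg dot_crossl dot_crossr; ring.
  by have [k1 [k2 ->]] := line_param X12 gX; exists k1, k2.
exists a; split=> // X gX.
have : eval_at F (E X (- dot a X)) = 0 by apply: Fl; apply/lP; exists X.
by rewrite FE mulNr addrC => /eqP; rewrite subr_eq0 => /eqP.
Qed.

End Lines.

Section Config.
Variable K : fieldType.
Hypothesis charK : [pchar K] =i pred0.
Local Notation pt := (pt K).
Variables (F : {mpoly K[4]}) (O : 'rV[K]_4) (M : 'I_4 -> pt).
Hypothesis MO : frame_at M O.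
Local Notation E := (emb M O).
Variables F3 F4 : pt -> K.
Hypotheses (form3 : form 3 F3) (form4 : form 4 F4).
Hypothesis FE : forall X t, eval_at F (E X t) = t * F3 X + F4 X.
Local Notation apex_line := (apex_line O M F3 F4).
Local Notation graph_line := (graph_line O M F3 F4).

Lemma apex_line_unique l l' p p' : apex_line l p -> apex_line l' p' ->
  cross p p' = null K -> l = l'.
Proof.
move=> [[p0 _ _] h] [[p'0 _ _] h'] /(cross_null p0)[k p'E].
have k0 : k != 0 by case: (@scal_neq0 _ k p); rewrite -?p'E.
apply/vspaceP => P; apply/idP/idP => [/h[j [u ->]]|/h'[j [u ->]]].
  by apply/h'; exists (j / k), u; congr emb; rewrite p'E; apply: pt_ext; rewrite /= mulrA divfK.
by apply/h; exists (j * k), u; congr emb; rewrite p'E; apply: pt_ext; rewrite /= mulrA.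
Qed.

(** Two multipliers for the same plane line agree on it, since F3 is not identically zero there. *)
Lemma graph_line_unique l l' g g' : (exists X, dot g X = 0 /\ ~ (F3 X = 0 /\ F4 X = 0)) ->
  graph_line l g -> graph_line l' g' -> cross g g' = null K -> l = l'.
Proof.
move=> [Y [gY Y34]] [g0 [a [ha h]]] [g'0 [a' [ha' h']]] /(cross_null g0)[k g'E].
have k0 : k != 0 by case: (@scal_neq0 _ k g); rewrite -?g'E.
have gg' X : dot g' X = 0 <-> dot g X = 0.
  rewrite g'E dotC dot_scal dotC; split=> [/eqP|->]; last by rewrite mulr0.
  by rewrite mulf_eq0 (negPf k0) => /eqP.
have subE X : dot (cmb a a' (null K) 1 (-1) 0) X = dot a X - dot a' X by rewrite /dot /=; ring.
have aE : cross g (cmb a a' (null K) 1 (-1) 0) = null K.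
  apply/eqP; apply: contraT => n0; case: Y34.
  have Z3 : F3 Y = 0.
    apply: (line_cancel charK form3 n0) gY => X gX.
    have : dot a X * F3 X = dot a' X * F3 X by rewrite -ha // -ha' //; apply/gg'.
    by move=> e0; rewrite subE mulrBl e0 subrr.
  by rewrite ha // Z3 mulr0.
have [j e] := cross_null g0 aE.
have aa' X : dot g X = 0 -> dot a X = dot a' X.
  move=> gX; apply/eqP; rewrite -subr_eq0.
  by rewrite -subE dotC e dot_scal dotC gX mulr0.
apply/vspaceP => P; apply/idP/idP => [/h[X [gX ->]]|/h'[X [gX ->]]].
  by apply/h'; exists X; split; [exact/gg' | rewrite aa'].
by move/gg' in gX; apply/h; exists X; rewrite aa'.
Qed.

Lemma graph_line_eq l g g' : graph_line l g -> graph_line l g' -> cross g g' = null K.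
Proof.
move=> [g0 [a [_ h]]] [g'0 [a' [_ h']]]; have [b [c [k k0 e]]] := line_basis g0.
have bc0 : cross b c != null K by rewrite e scal_eq0.
have gb : dot g b = 0 by apply: (mulfI k0); rewrite mulr0 dotC -dot_scal -e dotC dot_crossl.
have gc : dot g c = 0 by apply: (mulfI k0); rewrite mulr0 dotC -dot_scal -e dotC dot_crossr.
have on X : dot g X = 0 -> dot g' X = 0.
  move=> gX; have /h'[Y [g'Y /(emb_inj MO)[-> _]]] // : E X (- dot a X) \in l.
  by apply/h; exists X.
exact: (cross_lines bc0 gb gc (on _ gb) (on _ gc)).
Qed.

Lemma apex_line_exists p : base_pt F3 F4 p -> exists2 l, line_in F l & apex_line l p.
Proof.
move=> base; have [p0 p3 p4] := base; pose b1 := E p 0.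
have mem P : P \in (<[b1]> + <[O]>)%VS <-> exists k u, P = E (scal k p) u.
  have eq k u : k *: b1 + u *: O = E (scal k p) u.
    rewrite emb_scale (@emb_apex _ O M) emb_add; congr emb; last by ring.
    by apply: pt_ext => /=; ring.
  by rewrite mem_plane; split=> -[k [u ->]]; exists k, u; rewrite eq.
exists (<[b1]> + <[O]>)%VS; last by split.
split=> [|P /mem[k [u ->]]]; last first.
  by rewrite FE (form_scal _ _ form3) (form_scal _ _ form4) p3 p4; ring.
apply: plane_dim => k u.
rewrite emb_scale (@emb_apex _ O M) emb_add => /(MO.2)[e].
rewrite mulr0 add0r => ->; split=> //.
have : scal k p = null K by rewrite -e; apply: pt_ext => /=; ring.
by apply: contra_eq => k0; rewrite scal_eq0.
Qed.

Lemma graph_line_exists g : lifts F3 F4 g -> exists2 l, line_in F l & graph_line l g.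
Proof.
move=> [g0 [a ha]]; have [b [c [k k0 e]]] := line_basis g0.
have bc0 : cross b c != null K by rewrite e scal_eq0.
have gb : dot g b = 0 by apply: (mulfI k0); rewrite mulr0 dotC -dot_scal -e dotC dot_crossl.
have gc : dot g c = 0 by apply: (mulfI k0); rewrite mulr0 dotC -dot_scal -e dotC dot_crossr.
pose b1 := E b (- dot a b); pose b2 := E c (- dot a c).
have eq u v : u *: b1 + v *: b2 = E (seg b c u v) (- dot a (seg b c u v)).
  rewrite !emb_scale emb_add dot_seg; congr emb; last by ring.
  by apply: pt_ext => /=; ring.
have mem P : P \in (<[b1]> + <[b2]>)%VS <-> exists X, dot g X = 0 /\ P = E X (- dot a X).
  rewrite mem_plane; split=> [[u [v ->]]|[X [gX ->]]].
    by exists (seg b c u v); rewrite eq dot_seg gb gc; split=> //; ring.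
  have [|u [v ->]] := line_param bc0 (P := X).
    by rewrite e dotC dot_scal dotC gX mulr0.
  by exists u, v; rewrite eq.
exists (<[b1]> + <[b2]>)%VS; last by split=> //; exists a.
split=> [|P /mem[X [gX ->]]]; last by rewrite FE ha //; ring.
apply: plane_dim => u v; rewrite eq => /(MO.2)[s0 _].
have [phi [p1 p2]] := dot_interp 1 0 bc0; have [psi [q1 q2]] := dot_interp 0 1 bc0.
have phi0 : dot phi (seg b c u v) = 0 by rewrite s0 /dot /=; ring.
have psi0 : dot psi (seg b c u v) = 0 by rewrite s0 /dot /=; ring.
split; first by rewrite -phi0 dot_seg p1 p2; ring.
by rewrite -psi0 dot_seg q1 q2; ring.
Qed.

Lemma config_exists n : no_singular_point_but F O -> (exists X, F3 X != 0) ->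
  number_of_lines F n ->
  exists ps ls, monoid_config F3 F4 ps ls /\ (size ps + size ls)%N = n.
Proof.
move=> nosing F30 [s [us sn sE]].
pose s1 := [seq l : {vspace 'rV[K]_4} <- s | O \in l].
pose s2 := [seq l : {vspace 'rV[K]_4} <- s | O \notin l].
have [f1 f1P] : exists f, forall l, l \in s1 -> apex_line l (f l).
  apply: (seq_choice (null K)) => l; rewrite mem_filter => /andP[Ol /sE /(line_cases MO FE)].
  by case=> // -[g /(graph_line_apex MO)]; rewrite Ol.
have [f2 f2P] : exists f, forall l, l \in s2 -> graph_line l (f l).
  apply: (seq_choice (null K)) => l; rewrite mem_filter => /andP[Ol /sE /(line_cases MO FE)].
  by case=> // -[g /apex_line_apex Ol']; rewrite Ol' in Ol.
pose ps := map f1 s1; pose ls := map f2 s2.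
have all1 p : base_pt F3 F4 p -> exists2 q, q \in ps & cross p q = null K.
  move=> base; have [l lF lp] := apex_line_exists base.
  have ls1 : l \in s1 by rewrite mem_filter (apex_line_apex lp); apply/sE.
  exists (f1 l); first exact: map_f.
  have [[q0 _ _] h] := f1P l ls1; have [_ hp] := lp.
  have /h[k [u /(emb_inj MO)[-> _]]] : E p 0 \in l.
    by apply/hp; exists 1, 0; congr emb; apply: pt_ext => /=; ring.
  by apply: pt_ext => /=; ring.
(* A plane line of base points would give infinitely many lines through [O]. *)
have nonbase g : g != null K -> exists X, dot g X = 0 /\ ~ (F3 X = 0 /\ F4 X = 0).
  move=> g0; have [X [X0 gX avoid]] := line_avoid charK ps g0; exists X; split=> // -[X3 X4].
  have [|q qin e] := all1 X; first by [].
  have q0 : q != null K by move/mapP: qin => [l /f1P[[q0 _ _] _] ->].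
  by have := avoid q qin q0; rewrite e eqxx.
have inj1 : {in s1 &, forall l l', cross (f1 l) (f1 l') = null K -> l = l'}.
  by move=> l l' /f1P h /f1P h'; exact: apex_line_unique h h'.
have inj2 : {in s2 &, forall l l', cross (f2 l) (f2 l') = null K -> l = l'}.
  move=> l l' /f2P h /f2P h'; apply: (graph_line_unique _ h h'); apply: nonbase.
  by case: h.
exists ps, ls; split; last first.
  by rewrite !size_map !size_filter -sn; exact: count_predC.
split=> //.
- exact: (base_transversal charK MO form3 FE nosing).
- rewrite map_inj_in_uniq ?filter_uniq // => l l' h h' e; apply: inj1 => //.
  by rewrite e crosspp.
- by move=> p /mapP[l /f1P[base _] ->].
- by move=> p q /mapP[l lin ->] /mapP[l' lin' ->] /(inj1 _ _ lin lin') ->.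
- rewrite map_inj_in_uniq ?filter_uniq // => l l' h h' e; apply: inj2 => //.
  by rewrite e crosspp.
- by move=> g /mapP[l /f2P[g0 [a [ha _]]] ->]; split=> //; exists a.
- by move=> p q /mapP[l lin ->] /mapP[l' lin' ->] /(inj2 _ _ lin lin') ->.
move=> g lg; have [l lF hg] := graph_line_exists lg.
have ls2 : l \in s2 by rewrite mem_filter (graph_line_apex MO hg); apply/sE.
by exists (f2 l); [exact: map_f | exact: (graph_line_eq hg (f2P l ls2))].
Qed.

End Config.

Section EvalRules.
Variables (K : fieldType) (v : 'I_4 -> K).
Implicit Types (p q : {mpoly K[4]}) (b c : K).

(** These rules build the value of a polynomial expression from its syntax, leaving an identity in
    [K]. *)
Lemma meval_add p q b c : p.@[v] = b -> q.@[v] = c -> (p + q).@[v] = b + c.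
Proof. by move=> <- <-; exact: mevalD. Qed.

Lemma meval_opp p b : p.@[v] = b -> (- p).@[v] = - b.
Proof. by move=> <-; exact: mevalN. Qed.

Lemma meval_mul p q b c : p.@[v] = b -> q.@[v] = c -> (p * q).@[v] = b * c.
Proof. by move=> <- <-; exact: mevalM. Qed.

Lemma meval_scale k p b : p.@[v] = b -> (k *: p).@[v] = k * b.
Proof. by move=> <-; exact: mevalZ. Qed.

Lemma meval_exp p b n : p.@[v] = b -> (p ^+ n).@[v] = b ^+ n.
Proof. by move=> <-; exact: rmorphXn. Qed.

End EvalRules.

Lemma meval_Q (K : fieldType) (a : K) (v : 'I_4 -> K) :
  let x := v (inord 0) in let y := v (inord 1) in let z := v (inord 2) in
  (Q a).@[v] = v (inord 3) * normal_cubic a x y z + normal_quartic a x y z.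
Proof.
cbv zeta; rewrite /Q; cbv zeta; etransitivity.
repeat match goal with
  | |- meval _ (_ + _) = _ => eapply meval_add
  | |- meval _ (- _) = _ => eapply meval_opp
  | |- meval _ (_ * _) = _ => eapply meval_mul
  | |- meval _ (_ *: _) = _ => eapply meval_scale
  | |- meval _ (_ ^+ _) = _ => eapply meval_exp
  | |- meval _ 'X_ _ = _ => apply: mevalXU
  end.
by rewrite /normal_cubic /normal_quartic; ring.
Qed.

Lemma meval_linear_subst (K : fieldType) (A : 'M[K]_4) (F : {mpoly K[4]}) (v : 'rV[K]_4) :
  (linear_subst A F).@[fun i => v 0 i] = eval_at F (v *m A).
Proof.
rewrite /linear_subst comp_mpoly_meval; apply: meval_eq => j.
rewrite tnth_mktuple mxE raddf_sum; apply: eq_bigr => i _ /=.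
by rewrite mevalZ mevalXU mulrC.
Qed.

Lemma sum4 (V : nmodType) (f : 'I_4 -> V) :
  \sum_i f i = f (inord 0) + f (inord 1) + f (inord 2) + f (inord 3).
Proof.
rewrite !big_ord_recl big_ord0 addr0 !addrA.
by congr (f _ + f _ + f _ + f _); apply: val_inj; rewrite /= inordK.
Qed.

Lemma cmb_null (K : fieldType) (p q r : pt K) x y z : det3 p q r != 0 ->
  cmb p q r x y z = null K -> [/\ x = 0, y = 0 & z = 0].
Proof.
move=> d e; have eq0 u v w : exists a, [/\ dot a p = u, dot a q = v & dot a r = w].
  exact: dual_basis.
have [a [a1 a2 a3]] := eq0 1 0 0; have [b [b1 b2 b3]] := eq0 0 1 0.
have [c [c1 c2 c3]] := eq0 0 0 1.
have dn w : dot w (cmb p q r x y z) = 0 by rewrite e /dot /=; ring.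
split.
- by rewrite -(dn a) dot_cmb a1 a2 a3; ring.
- by rewrite -(dn b) dot_cmb b1 b2 b3; ring.
- by rewrite -(dn c) dot_cmb c1 c2 c3; ring.
Qed.

Theorem theorem8 (K : fieldType) (charK : [pchar K] =i pred0)
    (F : {mpoly K[4]}) (O : 'rV[K]_4) :
  quartic_monoid F O ->
  no_singular_point_but F O ->
  number_of_lines F 31 ->
  exists a : K,
    a \notin [:: -1; 0; 1 / 2; 1; 2] /\ projectively_equivalent F (Q a).
Proof.
move=> [[F0 Fhom] [O0 triple]] nosing lines.
have [M MO] := frame_exists O0.
have [F3 [F4 [form3 form4 F30 FE]]] := monoid_equation charK Fhom MO triple.
have [ps [ls [H total]]] := config_exists charK MO form3 form4 FE nosing F30 lines.
have [a [am1 a0 ah a1 a2] [p [q [r [pqr [c [d [e [c0 d0 nf]]]]]]]]] := normal_form charK H total.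
exists a; split.
  rewrite !inE !negb_or am1 a0 a1 a2 !andbT /=; apply: contraNneq ah => ->.
  by rewrite divfK //; have := charK 2; rewrite !inE /= => ->.
(* The images of the coordinate vectors. The shift of t by - e / c cancels the multiple of the cubic
   in F4, and scaling t by d / c gives the cubic and the quartic the common factor d. *)
pose rows := [:: emb M O p (- e.1.1 / c); emb M O q (- e.1.2 / c); emb M O r (- e.2 / c);
  emb M O (null K) (d / c)].
pose A : 'M[K]_4 := \matrix_(i < 4) rows`_i.
have vA (v : 'rV[K]_4) : v *m A = emb M O
    (cmb p q r (v 0 (inord 0)) (v 0 (inord 1)) (v 0 (inord 2)))
    ((d * v 0 (inord 3) - dot e (v 0 (inord 0), v 0 (inord 1), v 0 (inord 2))) / c).
  rewrite mulmx_sum_row sum4 !rowK /rows !inordK //= !emb_scale !emb_add.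
  by congr emb; [apply: pt_ext => /=; ring | rewrite /dot /=; field].
exists A, d; split=> //.
  rewrite -row_free_unit; apply/inj_row_free => v; rewrite vA => /(MO.2)[].
  move=> /(cmb_null pqr)[v0 v1 v2]; rewrite v0 v1 v2.
  have -> : dot e (0, 0, 0) = 0 by rewrite /dot /=; ring.
  rewrite subr0 => /eqP; rewrite !mulf_eq0 invr_eq0 (negPf c0) (negPf d0) orbF /= => /eqP v3.
  apply/rowP => i; rewrite mxE; have : i \in [:: inord 0; inord 1; inord 2; inord 3].
    by case: i => -[|[|[|[|]]]] // h; rewrite !inE -!val_eqE /= !inordK.
  by rewrite !inE => /or4P[] /eqP ->.
apply: (mpoly_eval_inj charK) => v.
have vE : v =1 (fun i => (\row_i v i) 0 i) by move=> i; rewrite mxE.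
rewrite (meval_eq _ vE) [RHS](meval_eq _ vE) meval_linear_subst vA FE mevalZ meval_Q.
by rewrite (nf _ _ _).1 (nf _ _ _).2; field.
Qed.
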